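(* No simply-connected compact manifold can be minimally immersed in a complete Cartan-Hadamard manifold.
   Context: A Cartan-Hadamard manifold here is a Riemannian manifold with non-positive sectional curvature; it is not assumed to be simply-connected. An immersion is minimal if the mean curvature vector field of the immersed submanifold (with the induced metric) vanishes identically. The compact manifold is connected, without boundary, of dimension at least one and smaller than the dimension of the ambient manifold. *)

(* Defs.v *)
(* Smooth manifolds are given by an atlas, and tensors by their coordinate
   expressions in the charts of that atlas.  Tangent vectors are row vectors,
   so a linear map acts by multiplication on the right: the differential of F
   at y sends v to v *m 'J F y. *)
From HB Require Import structures.
From mathcomp Require Import all_boot all_order all_algebra.
From mathcomp Require Import all_classical all_reals all_analysis.

Set Implicit Arguments.
Unset Strict Implicit.
Unset Printing Implicit Defensive.

Import Order.TTheory GRing.Theory Num.Theory.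
Import numFieldNormedType.Exports.

Local Open Scope classical_set_scope.
Local Open Scope ring_scope.

Definition partial (R : realType) (n : nat) (W : normedModType R) (i : 'I_n)
    (f : 'rV[R]_n -> W) : 'rV[R]_n -> W :=
  fun x => 'D_(delta_mx 0 i) f x.

(* C^oo on an open set U: all iterated partial derivatives, including f
   itself, are differentiable at every point of U. *)
Definition smooth_on (R : realType) (n : nat) (W : normedModType R)
    (U : set 'rV[R]_n) (f : 'rV[R]_n -> W) : Prop :=
  forall (s : seq 'I_n) (x : 'rV[R]_n), U x ->
    differentiable (foldr (@partial R n W) f s) x.

(* [chart_fun] and [chart_inv] are total; only their values on [chart_dom] and
   on [chart_fun @` chart_dom] are meaningful. *)
Record chart (R : realType) (n : nat) (T : topologicalType) := Chart {
  chart_dom : set T ;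
  chart_fun :> T -> 'rV[R]_n ;
  chart_inv : 'rV[R]_n -> T ;
  chart_dom_open : open chart_dom ;
  chart_img_open : open (chart_fun @` chart_dom) ;
  chart_fun_continuous : {within chart_dom, continuous chart_fun} ;
  chart_inv_continuous :
    {within chart_fun @` chart_dom, continuous chart_inv} ;
  chart_funK : forall x, chart_dom x -> chart_inv (chart_fun x) = x
}.

Definition chart_img (R : realType) (n : nat) (T : topologicalType)
    (c : chart R n T) : set 'rV[R]_n := c @` chart_dom c.

(* The charts have open images in R^n, so there is no boundary. *)
Record manifold (R : realType) (n : nat) := Manifold {
  manifold_space :> topologicalType ;
  atlas : set (chart R n manifold_space) ;
  manifold_hausdorff : hausdorff_space manifold_space ;
  manifold_second_countable : @second_countable manifold_space ;
  atlas_cover : forall x, exists2 c, atlas c & chart_dom c x ;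
  atlas_compatible : forall c d, atlas c -> atlas d ->
    smooth_on (c @` (chart_dom c `&` chart_dom d)) (d \o chart_inv c)
}.

Definition form (R : realType) (n : nat) (G : 'M[R]_n) (u v : 'rV[R]_n) : R :=
  (u *m G *m v^T) 0 0.

(* [metric_coord c y] is the Gram matrix of the coordinate vector fields of the
   chart c at the point with coordinates y; [metric_compatible] is the
   transformation law of a covariant 2-tensor. *)
Record riemannian_metric (R : realType) (n : nat) (M : manifold R n) :=
    RiemannianMetric {
  metric_coord :> chart R n M -> 'rV[R]_n -> 'M[R]_n ;
  metric_smooth : forall c, atlas c ->
    smooth_on (chart_img c) (metric_coord c) ;
  metric_sym : forall c y, atlas c -> chart_img c y ->
    (metric_coord c y)^T = metric_coord c y ;
  metric_pos : forall c y u, atlas c -> chart_img c y -> u != 0 ->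
    0 < form (metric_coord c y) u u ;
  metric_compatible : forall c d x, atlas c -> atlas d ->
    chart_dom c x -> chart_dom d x ->
    let J := 'J (d \o chart_inv c) (c x) in
    metric_coord c (c x) = J *m metric_coord d (d x) *m J^T
}.

(* Coordinate formulas for the Levi-Civita connection of a metric
   G : 'rV_n -> 'M_n given on an open subset of R^n. *)

(* The vector Gamma(u, v) = u^i v^j Gamma_ij^k e_k, determined by
   <Gamma(u, v), e_l> = (D_u G(v, e_l) + D_v G(u, e_l) - D_{e_l} G(u, v)) / 2. *)
Definition christoffel (R : realType) (n : nat) (G : 'rV[R]_n -> 'M[R]_n)
    (x u v : 'rV[R]_n) : 'rV[R]_n :=
  2^-1 *: (v *m 'D_u G x + u *m 'D_v G x
           - \row_l form (partial l G x) u v) *m invmx (G x).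

Definition covariant_derivative (R : realType) (n : nat)
    (G : 'rV[R]_n -> 'M[R]_n) (X Y : 'rV[R]_n -> 'rV[R]_n) :
    'rV[R]_n -> 'rV[R]_n :=
  fun x => 'D_(X x) Y x + christoffel G x (X x) (Y x).

(* R(u, v) w, with u, v, w extended to vector fields with constant components;
   these commute, so the term with the Lie bracket vanishes. *)
Definition curvature (R : realType) (n : nat) (G : 'rV[R]_n -> 'M[R]_n)
    (x u v w : 'rV[R]_n) : 'rV[R]_n :=
  let nabla := covariant_derivative G in
  nabla (cst u) (nabla (cst v) (cst w)) x
  - nabla (cst v) (nabla (cst u) (cst w)) x.

Definition sectional_curvature (R : realType) (n : nat)
    (G : 'rV[R]_n -> 'M[R]_n) (x u v : 'rV[R]_n) : R :=
  form (G x) (curvature G x u v v) u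
  / (form (G x) u u * form (G x) v v - form (G x) u v ^+ 2).

Definition nonpositively_curved (R : realType) (n : nat) (N : manifold R n)
    (g : riemannian_metric N) : Prop :=
  forall (d : chart R n N) (y u v : 'rV[R]_n), atlas d -> chart_img d y ->
    row_free (col_mx u v) -> sectional_curvature (g d) y u v <= 0.

Definition is_geodesic (R : realType) (n : nat) (N : manifold R n)
    (g : riemannian_metric N) (gamma : R -> N) : Prop :=
  continuous gamma /\
  forall (d : chart R n N) (t : R), atlas d -> chart_dom d (gamma t) ->
    let c := d \o gamma in
    [/\ derivable c t 1, derivable (derive1 c) t 1 &
        derive1 (derive1 c) t
        + christoffel (g d) (c t) (derive1 c t) (derive1 c t) = 0].

(* Every exponential map is defined on the whole tangent space. *)
Definition complete_metric (R : realType) (n : nat) (N : manifold R n)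
    (g : riemannian_metric N) : Prop :=
  forall (d : chart R n N) (p : N) (v : 'rV[R]_n), atlas d -> chart_dom d p ->
    exists gamma : R -> N,
      [/\ is_geodesic g gamma, gamma 0 = p & derive1 (d \o gamma) 0 = v].

(* [local_map f c d] is f read in the charts c and d. *)
Definition local_map (R : realType) (m n : nat) (M : manifold R m)
    (N : manifold R n) (f : M -> N) (c : chart R m M) (d : chart R n N) :
    'rV[R]_m -> 'rV[R]_n :=
  d \o f \o chart_inv c.

Definition smooth_map (R : realType) (m n : nat) (M : manifold R m)
    (N : manifold R n) (f : M -> N) : Prop :=
  continuous f /\
  forall (c : chart R m M) (d : chart R n N), atlas c -> atlas d ->
    smooth_on (c @` (chart_dom c `&` f @^-1` chart_dom d)) (local_map f c d).

Definition immersion (R : realType) (m n : nat) (M : manifold R m)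
    (N : manifold R n) (f : M -> N) : Prop :=
  smooth_map f /\
  forall (c : chart R m M) (d : chart R n N) (x : M), atlas c -> atlas d ->
    chart_dom c x -> chart_dom d (f x) ->
    injective ('d (local_map f c d) (c x)).

(* Gram matrix at y of the metric induced by F : 'rV_m -> 'rV_n from G. *)
Definition induced_metric (R : realType) (m n : nat) (G : 'rV[R]_n -> 'M[R]_n)
    (F : 'rV[R]_m -> 'rV[R]_n) (y : 'rV[R]_m) : 'M[R]_m :=
  'J F y *m G (F y) *m ('J F y)^T.

(* w minus its G-orthogonal projection onto the image of the differential of F
   at y. *)
Definition normal_part (R : realType) (m n : nat) (G : 'rV[R]_n -> 'M[R]_n)
    (F : 'rV[R]_m -> 'rV[R]_n) (y : 'rV[R]_m) (w : 'rV[R]_n) : 'rV[R]_n :=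
  w - w *m G (F y) *m ('J F y)^T *m invmx (induced_metric G F y) *m 'J F y.

(* Normal part of the ambient covariant derivative, along F and in the
   direction u, of the field y |-> dF_y(v). *)
Definition second_fundamental_form (R : realType) (m n : nat)
    (G : 'rV[R]_n -> 'M[R]_n) (F : 'rV[R]_m -> 'rV[R]_n)
    (y u v : 'rV[R]_m) : 'rV[R]_n :=
  normal_part G F y
    ('D_u (fun z => 'd F z v) y + christoffel G (F y) ('d F y u) ('d F y v)).

(* Normalised trace of the second fundamental form for the induced metric. *)
Definition mean_curvature (R : realType) (m n : nat)
    (G : 'rV[R]_n -> 'M[R]_n) (F : 'rV[R]_m -> 'rV[R]_n)
    (y : 'rV[R]_m) : 'rV[R]_n :=
  m%:R^-1 *: \sum_(i < m) \sum_(j < m) invmx (induced_metric G F y) i j *: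
    second_fundamental_form G F y (delta_mx 0 i) (delta_mx 0 j).

Definition minimal_immersion (R : realType) (m n : nat) (M : manifold R m)
    (N : manifold R n) (g : riemannian_metric N) (f : M -> N) : Prop :=
  immersion f /\
  forall (c : chart R m M) (d : chart R n N) (x : M), atlas c -> atlas d ->
    chart_dom c x -> chart_dom d (f x) ->
    mean_curvature (g d) (local_map f c d) (c x) = 0.

Definition path_connected (R : realType) (T : topologicalType) : Prop :=
  forall x y : T, exists gamma : R -> T,
    [/\ {within `[0, 1], continuous gamma}, gamma 0 = x & gamma 1 = y].

(* H (s, t) is a homotopy, with parameter s and fixed base point, from gamma to
   the constant loop. *)
Definition null_homotopic (R : realType) (T : topologicalType)
    (gamma : R -> T) : Prop :=
  exists H : R * R -> T,
    [/\ {within `[0, 1] `*` `[0, 1], continuous H},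
        forall t, t \in `[0, 1] -> H (0, t) = gamma t,
        forall t, t \in `[0, 1] -> H (1, t) = gamma 0,
        forall s, s \in `[0, 1] -> H (s, 0) = gamma 0 &
        forall s, s \in `[0, 1] -> H (s, 1) = gamma 0].

Definition simply_connected (R : realType) (T : topologicalType) : Prop :=
  [/\ [set: T] !=set0, path_connected R T &
      forall gamma : R -> T, {within `[0, 1], continuous gamma} ->
        gamma 0 = gamma 1 -> null_homotopic gamma].

(* Main.v *)
(* Let E be the exponential map of N at p = f x0.  Along a geodesic, nonpositive
   curvature makes the square norm of every Jacobi field convex, so dE is
   injective and E is a local homeomorphism.  Lifting a coordinate segment
   through E, the Gauss lemma bounds the growth of the lift, so the segment lifts
   entirely and E is a covering (Cartan-Hadamard).  As M is simply connected,
   f = E o V for a continuous V from M to the tangent space at p.  At a maximum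
   of |V|^2 on the compact M, let tau be the velocity at time 1 of the geodesic
   with initial velocity V.  By the Gauss lemma the differential of |V|^2 / 2 is
   u |-> <df u, tau>, so tau is normal to M, and the second derivative along u is
   <II(u, u), tau> + <J', J> <= 0, where J is the Jacobi field with value df u at
   time 1.  Convexity gives <J', J> >= |df u|^2 / 2 > 0, hence
   <II(u, u), tau> < 0 for every u != 0, and the mean curvature is not 0. *)
From Pilot Require Import Defs.
From HB Require Import structures.
From mathcomp Require Import all_boot all_order all_algebra.
From mathcomp Require Import all_classical all_reals all_analysis.
From mathcomp Require Import ring lra.
Import Pilot.Defs.

Set Implicit Arguments.
Unset Strict Implicit.
Unset Printing Implicit Defensive.

Import Order.TTheory GRing.Theory Num.Theory.
Import numFieldNormedType.Exports.

Local Open Scope classical_set_scope.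
Local Open Scope ring_scope.

(** The main obstacle is that completeness only hands over some geodesic for each initial velocity:
    the family [gam] obtained by choice carries no regularity in the velocity. Its
    differentiability, and with it the Jacobi fields, is recovered from the geodesic equation: a
    short-time Grönwall estimate makes difference quotients converge, and connectedness of the time
    line spreads regularity from time 0, where the state is explicit. Strict differentiability is
    the notion carried along: it is a condition at one point, it passes through the flow and through
    changes of chart, and the inverse function argument consumes it. One order of differentiability
    of the flow of positions and velocities suffices, since the derivative of |V|^2 / 2 involves
    tau, which is itself a component of that flow. The lift w of a segment with direction u is
    bounded without comparing |dE w'| to |w'|: the derivative of |w|^2 is 2 <u, tau>, and |tau| =
    |w| by conservation of energy, so 2 <u, tau> <= 2 |u|^2 + |w|^2 / 2 closes the estimate. *)

(** * Induction on connected sets and on intervals; a short Grönwall estimate *)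

(** The transfer hypothesis is symmetric in [s] and [s'], so both [P] and its negation are
    relatively open in [A]; connectedness leaves no room for the negation. *)
Lemma connected_chain (T : topologicalType) (A : set T) (P : T -> Prop) (a : T) :
  connected A -> A a -> P a ->
  (forall t, A t -> exists2 U, nbhs t U &
     forall s s', A s -> A s' -> U s -> U s' -> P s -> P s') ->
  forall t, A t -> P t.
Proof.
move=> cA Aa Pa chain.
suff <- : A `&` P = A by move=> t [].
apply: cA; first by exists a.
  (* Only points of [A] are tested, so the relatively open set is cut out by interiors of sets
     defined on the whole space. *)
  exists (\bigcup_(t in A `&` P) [set s | exists2 U, nbhs s U & forall u, A u -> U u -> P u]°).
    by apply: bigcup_open => t _; exact: open_interior.
  rewrite predeqE => t; split.
    move=> [At Pt]; split=> //; exists t => //.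
    have [U Ut PU] := chain t At.
    have Utt := nbhs_singleton Ut.
    rewrite /interior; move: Ut; rewrite nbhsE => -[W [oW Wt] WU].
    exists W; first by split.
    move=> s Ws; exists W; first exact: open_nbhs_nbhs.
    by move=> u Au /WU Uu; apply: (PU t).
  move=> [At [s _ /interior_subset [U /nbhs_singleton Ut PU]]].
  by split=> //; exact: PU.
exists (~` (\bigcup_(t in A `&` ~` P) [set s | exists2 U, nbhs s U & forall u, A u -> U u -> ~ P u]°)).
  by apply: open_closedC; apply: bigcup_open => t _; exact: open_interior.
rewrite predeqE => t; split.
  move=> [At Pt]; split=> // -[s _ /interior_subset [U /nbhs_singleton Ut PU]].
  exact: (PU t).
move=> [At nt]; split=> //; apply: contrapT => Pt; apply: nt.
exists t => //; have [U Ut PU] := chain t At.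
have Utt := nbhs_singleton Ut.
rewrite /interior; move: Ut; rewrite nbhsE => -[W [oW Wt] WU].
exists W; first by split.
move=> s Ws; exists W; first exact: open_nbhs_nbhs.
by move=> u Au /WU Uu Pu; apply: Pt; apply: (PU u).
Qed.

(** Downward closure makes the good times an interval; its supremum is good by the closing step, and
    the extension step forbids it to lie below [b]. *)
Lemma real_ind (R : realType) (P : R -> Prop) (b : R) : 0 <= b ->
  (forall s t, 0 <= s -> s <= t -> P t -> P s) ->
  P 0 ->
  (forall t, 0 < t -> t <= b -> (forall s, 0 <= s -> s < t -> P s) -> P t) ->
  (forall t, 0 <= t -> t < b -> P t -> exists2 h, 0 < h & P (t + h)) ->
  P b.
Proof.
move=> b0 dn P0 cl op.
pose A := [set t | 0 <= t <= b /\ P t].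
have A0 : A 0 by split=> //; rewrite lexx.
have supA : has_sup A by split; [exists 0| exists b => t [/andP[]]].
have s0 : 0 <= sup A by apply: sup_ubound => //; case: supA.
have sb : sup A <= b by apply: sup_le_ub; [exists 0| move=> t [/andP[]]].
have Ps : P (sup A).
  move: s0; rewrite le_eqVlt => /predU1P[<-//|s0].
  apply: cl => // s s0' ss.
  have [t [_ Pt] st] := sup_gt (proj1 supA) ss.
  by apply: dn Pt => //; exact: ltW.
move: sb; rewrite le_eqVlt => /predU1P[<-//|sb].
have [h h0 Ph] := op _ s0 sb Ps.
have [bh|hb] := leP b (sup A + h); first exact: dn Ph.
have : A (sup A + h).
  by split=> //; rewrite (ltW hb) andbT addr_ge0// ltW.
move=> /(sup_ubound (proj2 supA)); rewrite gerDl => h0'.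
by move: h0; rewrite ltNge h0'.
Qed.

(* The norm of W need not be differentiable, so this is proved by real induction. *)
Lemma mvt_ineq (R : realType) (W : normedModType R) (u : R -> W) (a b C : R) :
  a <= b -> (forall t, a <= t <= b -> {for t, continuous u}) ->
  (forall t, a < t < b -> derivable u t 1 /\ `|'D_1 u t| <= C) ->
  `|u b - u a| <= C * (b - a).
Proof.
move=> ab cu du.
(* The extension step of the induction also starts at the left end, so it needs the derivative
   there; the general case follows from the intervals starting at [a + h] as [h] tends to 0. *)
wlog du' : a b ab cu du / forall t, a <= t < b -> derivable u t 1 /\ `|'D_1 u t| <= C.
  move=> H; have [<-|neab] := eqVneq a b; first by rewrite !subrr normr0 mulr0.
  have {ab neab}ab : a < b by rewrite lt_neqAle neab.
  have cua : `|u b - u (a + h)| @[h --> 0^'+] --> `|u b - u a|.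
    apply: cvg_norm; apply: cvgB; first exact: cvg_cst.
    have /= cua : u x @[x --> a^'+] --> u a.
      by apply: cvg_at_right_filter; apply: cu; rewrite lexx ltW.
    have := @cvg_comp _ _ _ (fun h => a + h) u (0^'+) (a^'+) _ _ cua.
    apply; move=> B [e /= e0 Be]; exists e => //= h /=; rewrite sub0r normrN => he h0.
    by apply: Be => //=; [rewrite opprD addrA subrr add0r normrN | rewrite ltrDl].
  have cva : C * (b - (a + h)) @[h --> 0^'+] --> C * (b - a).
    apply: cvgMr; apply: cvgB; first exact: cvg_cst.
    rewrite -[X in _ --> X]addr0; apply: cvgD; first exact: cvg_cst.
    exact: cvg_at_right_filter.
  apply: ler_cvg_to cua cva _; near=> h.
  have h0 : 0 < h by [].
  have hb : h < b - a by near: h; apply: nbhs_right_lt; rewrite subr_gt0.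
  have du' t : a + h <= t < b -> derivable u t 1 /\ `|'D_1 u t| <= C.
    by move=> /andP[h1 h2]; apply: du; rewrite h2 andbT (lt_le_trans _ h1)// ltrDl.
  apply: H => //.
  - lra.
  - by move=> t /andP[at_ tb]; apply: cu; rewrite tb andbT (le_trans _ at_)// lerDl ltW.
  - by move=> t /andP[h1 h2]; apply: du'; rewrite h2 (ltW h1).
have [->|neab] := eqVneq a b; first by rewrite !subrr normr0 mulr0.
apply/ler_addgt0Pr => /= e e0.
have ba : 0 < b - a by rewrite subr_gt0 lt_neqAle neab.
(* The slack over [C] makes the bound on the derivative strict, which lets the estimate extend a
   little to the right. *)
pose k := C + e / (b - a).
have -> : C * (b - a) + e = k * (b - a).
  by rewrite /k mulrDl mulfVK// gt_eqF.
pose P (t : R) := forall s : R, 0 <= s -> s <= t -> `|u (a + s) - u a| <= k * s.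
suff : P (b - a) by move=> /(_ (b - a)); rewrite (addrC a) subrK; apply => //; exact: ltW.
apply: real_ind; first exact: ltW.
- by move=> s t s0 st Pt r r0 rs; apply: Pt => //; exact: le_trans st.
- move=> s s0 s0'; have -> : s = 0 by apply/eqP; rewrite eq_le s0 s0'.
  by rewrite addr0 subrr normr0 mulr0.
- move=> t t0 tb IH s s0; rewrite le_eqVlt => /predU1P[->{s s0}|st]; last exact: (IH s).
  have cl : `|u (a + s) - u a| @[s --> t^'-] --> `|u (a + t) - u a|.
    apply: cvg_norm; apply: cvgB; last exact: cvg_cst.
    apply: cvg_at_left_filter.
    have : {for t, continuous (u \o (fun x => a + x))}.
      apply: continuous_comp; first by apply: continuousD; [exact: cst_continuous|].
      apply: cu; rewrite lerDl ltW//=; lra.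
    by [].
  have cr : k * s @[s --> t^'-] --> k * t.
    by apply: cvg_at_left_filter; apply: cvgMr.
  apply: ler_cvg_to cl cr _; near=> s.
  have s0 : 0 < s by near: s; apply: nbhs_left_gt.
  by apply: (IH s) => //; exact: ltW.
- move=> t t0 tb Pt.
  have /du'[dut Cut] : a <= a + t < b by lra.
  have k' : `|'D_1 u (a + t)| < k.
    by apply: (le_lt_trans Cut); rewrite ltrDl divr_gt0.
  have /cvgrPdist_lt /(_ (k - `|'D_1 u (a + t)|)) := dut.
  rewrite subr_gt0 => /(_ k') [r /= r0 Hr].
  exists (r / 2); first by rewrite divr_gt0.
  move=> s s0 str.
  have [st|ts] := leP s t; first exact: Pt.
  have h0 : 0 < s - t by rewrite subr_gt0.
  have str' : s - t < r by lra.
  have nz : s - t != 0 by rewrite gt_eqF.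
  have := Hr (s - t); rewrite /= sub0r normrN gtr0_norm// => /(_ str' nz).
  rewrite [_%:A]mulr1 (_ : s - t + (a + t) = a + s); last by lra.
  move=> H.
  have : `|(s - t)^-1 *: (u (a + s) - u (a + t))| < k.
    have := ler_normB ('D_1 u (a + t)) ('D_1 u (a + t) - (s - t)^-1 *: (u (a + s) - u (a + t))).
    rewrite opprB addrC subrK /derive => h1.
    by apply: le_lt_trans h1 _; rewrite /derive in H; lra.
  rewrite normrZ gtr0_norm ?invr_gt0// mulrC ltr_pdivrMr// => h1.
  have h2 := Pt t t0 (lexx _).
  have h3 := ler_normD (u (a + s) - u (a + t)) (u (a + t) - u a).
  rewrite addrA subrK in h3.
  by apply: (le_trans h3); nra.
Unshelve. all: by end_near. Qed.

(** On an interval this short no exponential appears: at a maximum [d] of the norm the mean value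
    bound gives |u d| <= |u c| + |u d| / 2 + (b - a) e, and the middle term is absorbed. The
    reference time [c] may lie anywhere, so the estimate runs both forwards and backwards. *)
Lemma gronwall_short (R : realType) (W : normedModType R) (u : R -> W)
    (a b c L e : R) :
  a <= c <= b -> 0 <= L -> 0 <= e -> L * (b - a) <= 2^-1 ->
  (forall t, a <= t <= b ->
     derivable u t 1 /\ `|'D_1 u t| <= L * `|u t| + e) ->
  forall t, a <= t <= b -> `|u t| <= 2 * `|u c| + 2 * (b - a) * e.
Proof.
move=> /andP[ac cb] L0 e0 Lab du.
have ab := le_trans ac cb.
have cu t : a <= t <= b -> {for t, continuous u}.
  by move=> /du[/derivable1_diffP/differentiable_continuous].
have [d] : exists2 d, d \in `[a, b]%R & forall t, t \in `[a, b]%R -> `|u t| <= `|u d|.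
  apply: EVT_max => //; apply: continuous_in_subspaceT => x.
  rewrite inE /= in_itv /= => xab; apply: cvg_norm; exact: cu.
rewrite in_itv /= => /andP[ad db] dm.
have dm' t : a <= t <= b -> `|u t| <= `|u d| by move=> h; apply: dm; rewrite in_itv.
have H s t : a <= s -> s <= t -> t <= b -> `|u t - u s| <= (L * `|u d| + e) * (b - a).
  move=> as_ st tb; apply: (@le_trans _ _ ((L * `|u d| + e) * (t - s))).
    apply: mvt_ineq => // r /andP[sr rt].
      by apply: cu; rewrite (le_trans as_ sr) (le_trans rt tb).
    have /du[du1 du2] : a <= r <= b by lra.
    split=> //; apply: (le_trans du2); rewrite lerD2r; apply: ler_wpM2l => //.
    by apply: dm'; lra.
  apply: ler_wpM2l; last lra.
  by rewrite addr_ge0// mulr_ge0.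
have Hd : `|u d - u c| <= (L * `|u d| + e) * (b - a).
  have [cd|dc] := leP c d; first exact: H.
  by rewrite distrC; apply: H => //; exact: ltW.
have h1 : `|u d| <= `|u c| + (L * `|u d| + e) * (b - a).
  have := ler_normD (u d - u c) (u c); rewrite subrK => h; lra.
have h2 : L * (b - a) * `|u d| <= 2^-1 * `|u d| by apply: ler_wpM2r.
have h3 : `|u d| <= 2 * `|u c| + 2 * (b - a) * e by nra.
by move=> t /dm' tm; exact: le_trans h3.
Qed.

(** * Strict differentiability *)

(** Both points of the increment move near [a]. This yields a local Lipschitz bound and the inverse
    function theorem, and it can be proved at a single parameter without knowing differentials at
    the neighbouring ones. *)
Definition strictly_diff (R : realType) (V W : normedModType R) (f : V -> W)
    (a : V) :=
  differentiable f a /\ forall e : R, 0 < e -> \forall p \near (a, a),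
    `|f p.1 - f p.2 - 'd f a (p.1 - p.2)| <= e * `|p.1 - p.2|.

Lemma differentiable_eps (R : realType) (V W : normedModType R) (f : V -> W)
    (a : V) (D : {linear V -> W}) : continuous D ->
  (forall e : R, 0 < e -> \forall x \near a,
     `|f x - f a - D (x - a)| <= e * `|x - a|) ->
  differentiable f a /\ 'd f a = D :> (V -> W).
Proof.
move=> cD H.
have E : f \o shift a = cst (f a) + D +o_ 0 id.
  apply/eqaddoP => e e0.
  have := H _ e0; rewrite (near_shift 0) /= subr0 => Ha.
  near=> x; rewrite /= -[_ x]/(f (x + a) - (f a + D x)).
  have : `|f (x + a) - f a - D (x + a - a)| <= e * `|x + a - a|.
    by near: x; exact: Ha.
  by rewrite addrK opprD addrA.
have dE := diff_unique cD E; split => //.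
apply/diff_locallyP; rewrite dE; split=> //.
Unshelve. all: by end_near. Qed.

Lemma strictly_diff_eps (R : realType) (V W : normedModType R) (f : V -> W)
    (a : V) (D : {linear V -> W}) : continuous D ->
  (forall e : R, 0 < e -> \forall p \near (a, a),
    `|f p.1 - f p.2 - D (p.1 - p.2)| <= e * `|p.1 - p.2|) ->
  strictly_diff f a /\ 'd f a = D :> (V -> W).
Proof.
move=> cD H.
have [df dE] : differentiable f a /\ 'd f a = D :> (V -> W).
  apply: differentiable_eps => // e /H.
  by move=> [[A B] [/= Aa Ba] AB]; near=> x; apply: (AB (x, a)); split=> /=;
    [near: x|exact: nbhs_singleton].
by split => //; split => // e /H; rewrite dE.
Unshelve. all: by end_near. Qed.

Lemma diff_bound (R : realType) (V W : normedModType R) (f : V -> W) a :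
  differentiable f a -> exists2 k : R, 0 < k & forall x, `|'d f a x| <= k * `|x|.
Proof. by move=> df; apply: linear_lipschitz; exact: diff_continuous. Qed.

Lemma strictly_diff_lip (R : realType) (V W : normedModType R) (f : V -> W) a :
  strictly_diff f a -> exists2 k : R, 0 < k &
    \forall p \near (a, a), `|f p.1 - f p.2| <= k * `|p.1 - p.2|.
Proof.
move=> [df sf]; have [k k0 kf] := diff_bound df.
exists (1 + k); first by rewrite addr_gt0.
have := sf 1 ltr01; apply: filterS => -[x y] /= h.
have := ler_normD (f x - f y - 'd f a (x - y)) ('d f a (x - y)).
rewrite subrK => h1; have h2 := kf (x - y).
by rewrite mulrDl; lra.
Qed.

Lemma near_pair_cvg (T U S : topologicalType) (f : T -> U) (g : T -> S) (a : T)
  (P : U * S -> Prop) : {for a, continuous f} -> {for a, continuous g} ->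
  (\forall p \near (f a, g a), P p) -> \forall x \near a, P (f x, g x).
Proof. by move=> fa ga; apply: (cvg_pair fa ga). Qed.

Lemma strictly_diff_comp (R : realType) (U V W : normedModType R) (f : U -> V)
    (g : V -> W) a :
  strictly_diff f a -> strictly_diff g (f a) ->
  strictly_diff (g \o f) a /\ 'd (g \o f) a = 'd g (f a) \o 'd f a :> (U -> W).
Proof.
move=> sf sg; have [k k0 lf] := strictly_diff_lip sf.
have [[df ef] [dg eg]] := (sf, sg).
have E : 'd (g \o f) a = 'd g (f a) \o 'd f a :> (U -> W) by rewrite diff_comp.
split => //; split; first exact: differentiable_comp.
move=> e e0; rewrite E; have [K K0 dgK] := diff_bound dg.
have e1 : 0 < e / (2 * K) by rewrite divr_gt0// mulr_gt0.
have e2 : 0 < e / (2 * k) by rewrite divr_gt0// mulr_gt0.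
have cf := differentiable_continuous df.
near=> p.
have h1 : `|f p.1 - f p.2 - 'd f a (p.1 - p.2)| <= e / (2 * K) * `|p.1 - p.2|.
  by near: p; exact: ef.
have h2 : `|f p.1 - f p.2| <= k * `|p.1 - p.2| by near: p.
have h3 : `|g (f p.1) - g (f p.2) - 'd g (f a) (f p.1 - f p.2)|
   <= e / (2 * k) * `|f p.1 - f p.2|.
  near: p; apply: (@near_pair_cvg _ _ _ (f \o fst) (f \o snd) (a, a)
    (fun q => `|g q.1 - g q.2 - 'd g (f a) (q.1 - q.2)| <= e / (2 * k) * `|q.1 - q.2|)).
  - by apply: (@continuous_comp _ _ _ fst) => //; exact: cvg_fst.
  - by apply: (@continuous_comp _ _ _ snd) => //; exact: cvg_snd.
  - exact: eg.
rewrite /= -(subrKA ('d g (f a) (f p.1 - f p.2))) -linearB.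
apply: (le_trans (ler_normD _ _)).
have h4 := dgK (f p.1 - f p.2 - 'd f a (p.1 - p.2)).
have h5 : K * (e / (2 * K) * `|p.1 - p.2|) = e / 2 * `|p.1 - p.2|.
  by field; rewrite gt_eqF.
have h6 : e / (2 * k) * (k * `|p.1 - p.2|) = e / 2 * `|p.1 - p.2|.
  by field; rewrite gt_eqF.
have h7 : K * `|f p.1 - f p.2 - 'd f a (p.1 - p.2)| <= e / 2 * `|p.1 - p.2|.
  by rewrite -h5; apply: ler_wpM2l => //; exact: ltW.
have h8 : e / (2 * k) * `|f p.1 - f p.2| <= e / 2 * `|p.1 - p.2|.
  by rewrite -h6; apply: ler_wpM2l => //; exact: ltW.
by lra.
Unshelve. all: by end_near. Qed.

Lemma strictly_diff_lin (R : realType) (V W : normedModType R)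
  (f : {linear V -> W}) a : continuous f -> strictly_diff f a.
Proof.
move=> cf; apply: (proj1 (@strictly_diff_eps _ _ _ f a f cf _)) => e e0.
near=> p; rewrite linearB subrr normr0 mulr_ge0//; exact: ltW.
Unshelve. all: by end_near. Qed.

Lemma strictly_diff_near_eq (R : realType) (V W : normedModType R)
    (f g : V -> W) a : (\near a, f a = g a) ->
  strictly_diff f a -> strictly_diff g a.
Proof.
move=> fg [df ef]; have fga := nbhs_singleton fg.
apply: (proj1 (@strictly_diff_eps _ _ _ g a ('d f a) _ _)).
  exact: diff_continuous.
move=> e /ef h; near=> p.
have <- : f p.1 = g p.1.
  near: p; apply: (@near_pair_cvg _ _ _ fst snd (a, a) (fun q => f q.1 = g q.1)); [exact: cvg_fst|exact: cvg_snd|].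
  by exists ([set x | f x = g x], setT) => //=; [split => //; exact: filterT|move=> x []].
have <- : f p.2 = g p.2.
  near: p; apply: (@near_pair_cvg _ _ _ fst snd (a, a) (fun q => f q.2 = g q.2)); [exact: cvg_fst|exact: cvg_snd|].
  by exists (setT, [set x | f x = g x]) => //=; [split => //; exact: filterT|move=> x []].
by near: p.
Unshelve. all: by end_near. Qed.

(** A difference quotient at [x] compares two points near [a], so the strict estimate bounds it and
    passes to the limit: the differential is continuous at [a] along the points where it exists. *)
Lemma strictly_diff_close (R : realType) (V W : normedModType R) (f : V -> W)
    a : strictly_diff f a -> forall e : R, 0 < e ->
  \forall x \near a, differentiable f x ->
    forall h, `|'d f x h - 'd f a h| <= e * `|h|.
Proof.
move=> [df ef] e e0.
have := ef _ e0 => -[[A B] [/= Aa Ba] AB].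
have [X [oX Xa] XAB] : exists2 X, open_nbhs a X & X `<=` A `&` B.
  have AB' : nbhs a (A `&` B) by exact: filterI.
  by move: AB'; rewrite nbhsE => -[X ? ?]; exists X.
have nX : nbhs a X by exact: open_nbhs_nbhs.
apply: filterS nX => x Xx dx h.
have cv : `|h0^-1 *: (f (h0 *: h + x) - f x) - 'd f a h| @[h0 --> 0^'] --> `|'d f x h - 'd f a h|.
  by apply: cvg_norm; apply: cvgB; [rewrite -deriveE//; exact: diff_derivable|exact: cvg_cst].
apply: ler_cvg_to cv (cvg_cst _) _; near=> h0.
have h00 : h0 != 0 by near: h0; exact: nbhs_dnbhs_neq.
have Xh : X (h0 *: h + x).
  near: h0; apply: cvg_within.
  have : {for 0, continuous (fun h0 : R => h0 *: h + x)}.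
    by apply: continuousD; [exact: scalel_continuous|exact: cst_continuous].
  by apply; rewrite scale0r add0r; exact: open_nbhs_nbhs.
have -> : h0^-1 *: (f (h0 *: h + x) - f x) - 'd f a h =
    h0^-1 *: (f (h0 *: h + x) - f x - 'd f a (h0 *: h + x - x)).
  by rewrite addrK linearZ /= [in RHS]scalerBr scalerA mulVf// scale1r.
rewrite normrZ normfV mulrC ler_pdivrMr ?normr_gt0//.
have := AB (h0 *: h + x, x) _; rewrite /= addrK normrZ => H.
rewrite -mulrA (mulrC `|h|); apply: H; split=> /=.
  by case: (XAB _ Xh).
by case: (XAB _ Xx).
Unshelve. all: by end_near. Qed.

Lemma is_derive_line (R : realType) (V : normedModType R) (v : V) (t : R) :
  is_derive t 1 (fun s : R => s *: v) v.
Proof.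
have [dl El] := is_diff_scalel t v.
apply: DeriveDef; first exact: diff_derivable.
by rewrite deriveE// El scale1r.
Qed.

Lemma is_derive_chain (R : realType) (V W : normedModType R) (f : V -> W)
    (c : R -> V) (t : R) (dc : V) :
  differentiable f (c t) -> is_derive t 1 c dc ->
  is_derive t 1 (f \o c) ('d f (c t) dc).
Proof.
move=> df [dct <-]; have dc' : differentiable c t by apply/derivable1_diffP.
have dfc := differentiable_comp dc' df.
apply: DeriveDef; first exact: diff_derivable.
by rewrite !deriveE// diff_comp.
Qed.

(* A C^1 function is strictly differentiable: mean value inequality applied to
   f - 'd f a on segments. *)
Lemma C1_strictly_diff (R : realType) (V W : normedModType R) (f : V -> W) a :
  (forall e : R, 0 < e -> \forall x \near a, differentiable f x /\
    forall h, `|'d f x h - 'd f a h| <= e * `|h|) -> strictly_diff f a.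
Proof.
move=> H.
have df : differentiable f a by have /nbhs_singleton[] := H 1 ltr01.
split=> // e /H /nbhs_ballP[r /= r0 Hr].
exists (ball a r, ball a r); first by split; exact: nbhsx_ballx.
move=> [x y] [/= xr yr].
pose z (t : R) := y + t *: (x - y).
have zr t : 0 <= t <= 1 -> ball a r (z t).
  move=> /andP[t0 t1]; move: xr yr; rewrite -ball_normE /= => xr yr.
  have -> : a - z t = t *: (a - x) + (1 - t) *: (a - y).
    rewrite /z opprD addrA -scalerN opprB scalerBl scale1r addrCA -scalerBr.
    by rewrite opprB (addrC (a - x)) subrKA.
  apply: (le_lt_trans (ler_normD _ _)); rewrite !normrZ.
  rewrite (ger0_norm t0) ger0_norm ?subr_ge0//.
  have [->|tn0] := eqVneq t 0; first by rewrite mul0r add0r subr0 mul1r.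
  have t0' : 0 < t by rewrite lt_neqAle eq_sym tn0.
  nra.
pose u t := f (z t) - t *: 'd f a (x - y).
have dz (t : R) : is_derive t 1 z (x - y).
  rewrite -[X in is_derive _ _ _ X]add0r; apply: is_deriveD.
  exact: is_derive_line.
have du (t : R) : 0 <= t <= 1 ->
    is_derive t 1 u ('d f (z t) (x - y) - 'd f a (x - y)).
  move=> /zr/Hr[dft _]; apply: is_deriveB; first exact: is_derive_chain.
  exact: is_derive_line.
have -> : f (x, y).1 - f (x, y).2 - 'd f a ((x, y).1 - (x, y).2) = u 1 - u 0.
  by rewrite /u /z !scale1r !scale0r addr0 subr0 (addrC y) subrK addrAC.
rewrite -[leRHS](mulr1 _) -[X in _ <= _ * X](subr0 1).
apply: mvt_ineq => //.
  by move=> t /du[/derivable1_diffP/differentiable_continuous].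
move=> t /andP[t0 t1]; have t01 : 0 <= t <= 1 by rewrite !ltW.
have [dut ->] := du t t01; split => //.
by have [_] := Hr _ (zr _ t01); apply.
Qed.

Lemma C1_strictly_diffE (R : realType) (V W : normedModType R) (f : V -> W)
    (D : V -> V -> W) a :
  (forall e : R, 0 < e -> \forall x \near a, [/\ differentiable f x,
     forall h, 'd f x h = D x h & forall h, `|D x h - D a h| <= e * `|h|]) ->
  strictly_diff f a.
Proof.
move=> H; have [_ Da _] := nbhs_singleton (H _ ltr01).
apply: C1_strictly_diff => e e0; apply: filterS (H e e0) => x [dx Dx DD].
split; first exact: dx.
by move=> h; have := DD h; rewrite -Dx -Da.
Qed.

(** * Smooth functions on open sets of R^n *)

Lemma linfunE (R : realType) n (W : normedModType R) (L : {linear 'rV[R]_n -> W}) h :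
  L h = \sum_i h 0 i *: L (delta_mx 0 i).
Proof.
rewrite {1}[h]row_sum_delta linear_sum; apply: eq_bigr => i _.
by rewrite linearZ.
Qed.

Lemma norm_coord (R : realType) m n (h : 'M[R]_(m, n)) i j : `|h i j| <= `|h|.
Proof.
by rewrite [leRHS]/Num.Def.normr/= mx_normrE; apply: (le_bigmax _ _ (i, j)).
Qed.

Lemma linear_rV_continuous (R : realType) n (W : normedModType R)
  (L : {linear 'rV[R]_n -> W}) : continuous L.
Proof.
have h x : L x = (\sum_i (fun x : 'rV[R]_n => x 0 i *: L (delta_mx 0 i))) x.
  by rewrite fct_sumE; exact: linfunE.
move=> x; rewrite /continuous_at h; under eq_cvg do rewrite h.
apply: differentiable_continuous; apply: differentiable_sum => i.
by apply: differentiableZl; exact: differentiable_coord.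
Qed.

Lemma smooth_on_partial (R : realType) n (W : normedModType R) U
    (f : 'rV[R]_n -> W) i : smooth_on U f -> smooth_on U (partial i f).
Proof. by move=> sf s x Ux; have := sf (rcons s i) x Ux; rewrite foldr_rcons. Qed.

Lemma smooth_on_diff (R : realType) n (W : normedModType R) U
    (f : 'rV[R]_n -> W) x : smooth_on U f -> U x -> differentiable f x.
Proof. by move=> sf Ux; exact: (sf [::] x Ux). Qed.

Lemma smooth_strictly_diff (R : realType) n (W : normedModType R) U
    (f : 'rV[R]_n -> W) x : open U -> smooth_on U f -> U x -> strictly_diff f x.
Proof.
move=> oU sf Ux; pose D (x h : 'rV[R]_n) : W := \sum_i h 0 i *: partial i f x.
apply: (@C1_strictly_diffE R 'rV[R]_n W f D) => e e0.
(* The differential is a sum over [n] partial derivatives; dividing by [n.+1] also covers dimension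
   0. *)
have e1 : 0 < e / (n.+1)%:R by rewrite divr_gt0// ltr0n.
have Ui i : \forall y \near x, `|partial i f x - partial i f y| <= e / (n.+1)%:R.
  have /differentiable_continuous := smooth_on_diff (smooth_on_partial i sf) Ux.
  by move/cvgrPdist_le; apply.
have /= Ua : \forall y \near x, forall i, `|partial i f x - partial i f y| <= e / (n.+1)%:R.
  exact: (@filter_forall _ _ (fun i y => `|partial i f x - partial i f y| <= e / (n.+1)%:R) _ _ Ui).
near=> y; have Uy : U y by near: y; exact: open_nbhs_nbhs.
have dy := smooth_on_diff sf Uy.
split; first exact: dy.
  move=> h; rewrite linfunE; apply: eq_bigr => i _; congr (_ *: _).
  by rewrite /partial deriveE.
move=> h; rewrite /D -sumrB.
apply: (le_trans (ler_norm_sum _ _ _)).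
apply: (@le_trans _ _ (\sum_(i < n) (e / (n.+1)%:R * `|h|))).
  apply: ler_sum => i _; rewrite -scalerBr normrZ mulrC; apply: ler_pM => //.
    by rewrite distrC; move: i; near: y; exact: Ua.
  exact: norm_coord.
rewrite sumr_const card_ord -mulrnAl; apply: ler_wpM2r => //.
rewrite -mulr_natr -mulrA -[leRHS]mulr1; apply: ler_wpM2l; first exact: ltW.
by rewrite mulrC ler_pdivrMr ?ltr0n// mul1r ler_nat.
Unshelve. all: by end_near. Qed.

(** * Strict differentiability of pairs, sums, products and inverses *)

Lemma strictly_diff_pair (R : realType) (U V W : normedModType R) (f : U -> V)
    (g : U -> W) a : strictly_diff f a -> strictly_diff g a ->
  strictly_diff (fun x => (f x, g x)) a /\
  'd (fun x => (f x, g x)) a = (fun h => ('d f a h, 'd g a h)) :> (U -> V * W).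
Proof.
move=> [df ef] [dg eg].
have E : 'd (fun x => (f x, g x)) a = (fun h => ('d f a h, 'd g a h)) :> (U -> V * W).
  by rewrite diff_pair.
split=> //; split; first exact: differentiable_pair.
move=> e e0; near=> p; rewrite E prod_normE /= ge_max; apply/andP; split; near: p.
  exact: ef.
exact: eg.
Unshelve. all: by end_near. Qed.

Lemma strictly_diffD (R : realType) (V W : normedModType R) (f g : V -> W) a :
  strictly_diff f a -> strictly_diff g a -> strictly_diff (fun x => f x + g x) a.
Proof.
move=> sf sg; have [sfg _] := strictly_diff_pair sf sg.
apply: (proj1 (strictly_diff_comp (g := fun p : W * W => p.1 + p.2) sfg _)).
have lin : linear (fun p : W * W => p.1 + p.2).
  by move=> k [p q] [r s] /=; rewrite scalerDr addrACA.
pose L : {linear (W * W)%type -> W} := HB.pack (fun p : W * W => p.1 + p.2)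
  (GRing.isLinear.Build _ _ _ _ _ lin).
apply: (@strictly_diff_lin _ _ _ L); exact: add_continuous.
Qed.

Lemma strictly_diff_cst (R : realType) (V W : normedModType R) (k : W) (a : V) :
  strictly_diff (fun=> k) a.
Proof.
split; first exact: differentiable_cst.
move=> e e0; near=> p; rewrite diff_cst /= subrr subrr normr0 mulr_ge0// ltW//.
Unshelve. all: by end_near. Qed.

Lemma strictly_diffZr (R : realType) (V W : normedModType R) (f : V -> W) k a :
  strictly_diff f a -> strictly_diff (fun x => k *: f x) a.
Proof.
move=> sf; apply: (proj1 (strictly_diff_comp (g := *:%R k) sf _)).
have lin : linear (fun w : W => k *: w).
  by move=> l p q /=; rewrite scalerDr !scalerA mulrC.
pose L : {linear W -> W} := HB.pack (fun w : W => k *: w)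
  (GRing.isLinear.Build _ _ _ _ _ lin).
apply: (@strictly_diff_lin _ _ _ L); exact: scaler_continuous.
Qed.

Lemma strictly_diff_sum (R : realType) (V W : normedModType R) (I : Type)
    (r : seq I) (P : pred I) (f : I -> V -> W) a :
  (forall i, P i -> strictly_diff (f i) a) ->
  strictly_diff (fun x => \sum_(i <- r | P i) f i x) a.
Proof.
move=> sf; elim: r => [|i r IH].
  by under eq_fun do rewrite big_nil; exact: strictly_diff_cst.
under eq_fun do rewrite big_cons.
case: (boolP (P i)) => Pi; last exact: IH.
by apply: strictly_diffD; [exact: sf|exact: IH].
Qed.

Lemma strictly_diffM (R : realType) (V : normedModType R) (f g : V -> R) a :
  strictly_diff f a -> strictly_diff g a -> strictly_diff (fun x => f x * g x) a.
Proof.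
move=> sf sg; have [sfg _] := strictly_diff_pair sf sg.
apply: (proj1 (strictly_diff_comp (g := fun p : R * R => p.1 * p.2) sfg _)).
set b := (f a, g a).
have dm (x : R * R) : differentiable (fun p : R * R => p.1 * p.2) x /\
    forall h, 'd (fun p : R * R => p.1 * p.2) x h = x.1 * h.2 + h.1 * x.2.
  have D := is_diff_mulr x; split; first exact: (@ex_diff _ _ _ _ _ _ _ D).
  by move=> h; rewrite (@diff_val _ _ _ _ _ _ _ D) /= mulrC; congr (_ + _); rewrite mulrC.
pose D (x h : R * R) : R := x.1 * h.2 + h.1 * x.2.
apply: (@C1_strictly_diffE R (R * R)%type R _ D) => e e0; near=> x.
have [dx Ex] := dm x; split; [exact: dx|exact: Ex|move=> h].
rewrite /D.
have h1 : `|b - x| <= e / 2.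
  by near: x; apply: cvgr_dist_le; [exact: cvg_id|rewrite divr_gt0].
have := h1; rewrite prod_normE ge_max /= => /andP[h2 h3].
have : `|h| <= `|h| by []; rewrite [leLHS]prod_normE ge_max => /andP[h4 h5].
have -> : x.1 * h.2 + h.1 * x.2 - (b.1 * h.2 + h.1 * b.2) =
   (x.1 - b.1) * h.2 + (x.2 - b.2) * h.1 by ring.
apply: (le_trans (ler_normD _ _)); rewrite !normrM.
rewrite (distrC x.1) (distrC x.2).
have := ler_pM (normr_ge0 _) (normr_ge0 _) h2 h5.
have := ler_pM (normr_ge0 _) (normr_ge0 _) h3 h4; lra.
Unshelve. all: by end_near. Qed.

Lemma strictly_diff_prod (R : realType) (V : normedModType R) (I : Type)
    (r : seq I) (P : pred I) (f : I -> V -> R) a :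
  (forall i, P i -> strictly_diff (f i) a) ->
  strictly_diff (fun x => \prod_(i <- r | P i) f i x) a.
Proof.
move=> sf; elim: r => [|i r IH].
  by under eq_fun do rewrite big_nil; exact: strictly_diff_cst.
under eq_fun do rewrite big_cons.
case: (boolP (P i)) => Pi; last exact: IH.
by apply: strictly_diffM; [exact: sf|exact: IH].
Qed.

Lemma strictly_diffV (R : realType) (V : normedModType R) (f : V -> R) a :
  strictly_diff f a -> f a != 0 -> strictly_diff (fun x => (f x)^-1) a.
Proof.
move=> sf fa0; apply: (proj1 (strictly_diff_comp (g := @GRing.inv R) sf _)).
set b := f a.
have dv (x : R) : x != 0 -> differentiable (@GRing.inv R) x /\
    forall h, 'd (@GRing.inv R) x h = - (x ^- 2) * h.
  by move=> x0; split; [exact: differentiable_Rinv|move=> h; rewrite diff_Rinv].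
pose D (x h : R) : R := - (x ^- 2) * h.
apply: (@C1_strictly_diffE R R R _ D) => e e0.
have cD : (fun y : R => y ^- 2) y @[y --> b] --> b ^- 2.
  apply: cvgV; first by rewrite expf_neq0.
  exact: (@exprn_continuous R 2 b).
have H : \forall y \near b, `|b ^- 2 - y ^- 2| <= e.
  by move: cD => /cvgrPdist_le /(_ e e0).
near=> x.
have x0 : x != 0 by near: x; apply: (@cvgr_neq0 _ _ _ _ _ id b); [exact: cvg_id|exact: fa0].
have [dx Ex] := dv x x0; split; [exact: dx|exact: Ex|move=> h].
rewrite /D -mulrBl normrM.
apply: ler_wpM2r => //; rewrite opprK addrC.
rewrite -/b.
by near: x; exact: H.
Unshelve. all: by end_near. Qed.

(** * Dependence of a solution of an ODE on a parameter *)

Lemma line_cvg0 (R : realType) (V : normedModType R) (v h : V) :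
  v + s *: h @[s --> (0:R)] --> v.
Proof.
rewrite -[X in _ --> X]addr0; apply: cvgD; first exact: cvg_cst.
by rewrite -(scale0r h); exact: scalel_continuous.
Qed.

(** Completeness in the form in which it is used: difference quotients that are Cauchy as [s] tends
    to 0 converge. In this form it passes to products component by component. *)
Definition dir_complete (R : realType) (X : normedModType R) : Prop :=
  forall Q : R -> X, (forall e, 0 < e -> exists2 d, 0 < d & forall s r,
    0 < `|s| < d -> 0 < `|r| < d -> `|Q s - Q r| <= e) ->
  cvg (Q s @[s --> 0^']).

Lemma dir_complete_complete (R : realType) (X : completeNormedModType R) :
  dir_complete X.
Proof.
move=> Q H; apply/cauchy_cvgP; apply/cauchy_ballP => e e0.
have e20 : 0 < e / 2 by rewrite divr_gt0.
have [d d0 Hd] := H (e / 2) e20.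
pose B := [set Q s | s in [set s | 0 < `|s| < d]].
have dB : \forall s \near 0^', B (Q s).
  near=> s; exists s => //=; apply/andP; split.
    by rewrite normr_gt0; near: s; exact: nbhs_dnbhs_neq.
  by near: s; exact: dnbhs0_lt.
exists (B, B) => //= -[x y] [[s /= sd <-] [r /= rd <-]] /=.
by rewrite -ball_normE /=; apply: (le_lt_trans (Hd _ _ sd rd)); rewrite ltr_pdivrMr//; lra.
Unshelve. all: by end_near. Qed.

Lemma dir_complete_pair (R : realType) (X Y : normedModType R) :
  dir_complete X -> dir_complete Y -> dir_complete (X * Y)%type.
Proof.
move=> cX cY Q H.
have h1 : cvg ((Q s).1 @[s --> 0^']).
  apply: cX => e /H[d d0 Hd]; exists d => // s r sd rd.
  apply: le_trans (Hd s r sd rd); rewrite [leRHS]prod_normE /=.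
  by rewrite le_max lexx.
have h2 : cvg ((Q s).2 @[s --> 0^']).
  apply: cY => e /H[d d0 Hd]; exists d => // s r sd rd.
  apply: le_trans (Hd s r sd rd); rewrite [leRHS]prod_normE /=.
  by rewrite le_max lexx orbT.
apply/cvg_ex; exists (lim ((Q s).1 @[s --> 0^']), lim ((Q s).2 @[s --> 0^'])).
have -> : Q = (fun s => ((Q s).1, (Q s).2)) by apply/funext => s; case: (Q s).
exact: cvg_pair.
Qed.

Lemma near_fst (T U : topologicalType) (x : T) (y : U) (P : T -> Prop) :
  (\forall v \near x, P v) -> \forall p \near (x, y), P p.1.
Proof.
move=> H; exists ([set v | P v], setT); last by move=> p [].
by split=> //; exact: filterT.
Qed.

Lemma near_snd (T U : topologicalType) (x : T) (y : U) (P : U -> Prop) :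
  (\forall v \near y, P v) -> \forall p \near (x, y), P p.2.
Proof.
move=> H; exists (setT, [set v | P v]); last by move=> p [].
by split=> //; exact: filterT.
Qed.

Lemma near_pair_fst (T U : topologicalType) (x : T) (y : U) (P : T * U -> Prop) :
  (\forall p \near (x, y), P p) -> \forall v \near x, P (v, y).
Proof.
move=> [[A B] [/= Ax Bx] AB]; apply: filterS Ax => v Av; apply: AB; split => //=.
exact: nbhs_singleton Bx.
Qed.

(* Existence of solutions is an assumption here: difference quotients of
   solutions are shown to be Cauchy, so no existence theorem for the linearised
   equation is needed. *)
Section OdeParameter.
Context (R : realType) (n : nat) (X : normedModType R) (F : X -> X)
  (S : 'rV[R]_n -> R -> X) (v0 : 'rV[R]_n) (a b c L : R).
Hypothesis cX : dir_complete X.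
Hypothesis acb : a < c < b.
Hypothesis L0 : 0 <= L.
Hypothesis Lab : L * (b - a) <= 2^-1.
Hypothesis sF : forall t, a <= t <= b -> strictly_diff F (S v0 t).
Hypothesis dFL : forall t, a <= t <= b -> forall h, `|'d F (S v0 t) h| <= L * `|h|.
Hypothesis dS : \forall v \near v0, forall t, a <= t <= b -> is_derive t 1 (S v) (F (S v t)).
Hypothesis FLp : \forall p \near (v0, v0), forall t, a <= t <= b ->
  `|F (S p.1 t) - F (S p.2 t)| <= L * `|S p.1 t - S p.2 t|.
Hypothesis sS : strictly_diff (S ^~ c) v0.

Let A t := 'd F (S v0 t).

Let dS0 t : a <= t <= b -> is_derive t 1 (S v0) (F (S v0 t)).
Proof. by move=> tab; exact: (nbhs_singleton dS). Qed.

Let dSp : \forall p \near (v0, v0), forall t, a <= t <= b ->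
  is_derive t 1 (S p.1) (F (S p.1 t)) /\ is_derive t 1 (S p.2) (F (S p.2 t)).
Proof.
have h1 := near_fst v0 dS; have h2 := near_snd v0 dS.
by near=> p => t tab; split; move: t tab; near: p.
Unshelve. all: by end_near. Qed.

Let cS0 t : a <= t <= b -> {for t, continuous (S v0)}.
Proof. by move=> /dS0[/derivable1_diffP/differentiable_continuous]. Qed.

Let Dbound : \forall p \near (v0, v0), forall t, a <= t <= b ->
  `|S p.1 t - S p.2 t| <= 2 * `|S p.1 c - S p.2 c|.
Proof.
near=> p => t tab.
have h := @gronwall_short _ _ (fun t => S p.1 t - S p.2 t) a b c L 0.
have := h _ L0 (lexx 0) Lab _ t tab; rewrite mulr0 addr0; apply.
  by case/andP: acb => /ltW -> /ltW ->.
move=> s sab.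
have /(_ s sab)[d1 d2] : forall t, a <= t <= b ->
  is_derive t 1 (S p.1) (F (S p.1 t)) /\ is_derive t 1 (S p.2) (F (S p.2 t)) by near: p; exact: dSp.
have d3 := is_deriveB d1 d2; have [d4 d5] := d3.
split; first exact: d4.
rewrite addr0 [X in `|X|]d5.
by have /(_ s sab) : forall t, a <= t <= b -> `|F (S p.1 t) - F (S p.2 t)| <= L * `|S p.1 t - S p.2 t| by near: p; exact: FLp.
Unshelve. all: by end_near. Qed.

Let Dlip : exists2 k, 0 < k & \forall p \near (v0, v0), forall t, a <= t <= b ->
  `|S p.1 t - S p.2 t| <= k * `|p.1 - p.2|.
Proof.
have [k k0 Hk] := strictly_diff_lip sS.
exists (2 * k); first by rewrite mulr_gt0.
near=> p => t tab.
have h1 : forall t, a <= t <= b -> `|S p.1 t - S p.2 t| <= 2 * `|S p.1 c - S p.2 c|.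
  by near: p; exact: Dbound.
have h2 : `|S p.1 c - S p.2 c| <= k * `|p.1 - p.2| by near: p.
by apply: (le_trans (h1 t tab)); rewrite -mulrA ler_wpM2l.
Unshelve. all: by end_near. Qed.

Let Aclose t : a <= t <= b -> forall e, 0 < e -> \forall s \near t,
  a <= s <= b -> forall h, `|A s h - A t h| <= e * `|h|.
Proof.
move=> tab e e0.
have := cS0 tab (strictly_diff_close (sF tab) e0); rewrite /= => H.
near=> s => sab.
have : differentiable F (S v0 s) -> forall h, `|'d F (S v0 s) h - 'd F (S v0 t) h| <= e * `|h|.
  by near: s.
by apply; case: (sF sab).
Unshelve. all: by end_near. Qed.

(* Uniformity in t comes from compactness of [a, b]. *)
Let Flin (e : R) : 0 < e -> \forall p \near (v0, v0), forall t, a <= t <= b ->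
  `|F (S p.1 t) - F (S p.2 t) - A t (S p.1 t - S p.2 t)| <= e * `|S p.1 t - S p.2 t|.
Proof.
move=> e0.
pose P (p : 'rV[R]_n * 'rV[R]_n) (t : R) := a <= t <= b ->
  `|F (S p.1 t) - F (S p.2 t) - A t (S p.1 t - S p.2 t)| <= e * `|S p.1 t - S p.2 t|.
have : \forall p \near (v0, v0), `[a, b] `<=` P p.
  have cov : near_covering `[a, b] by apply/compact_near_coveringP; exact: segment_compact.
  apply: (cov _ (nbhs (v0, v0)) P) => t /=; rewrite in_itv /= => tab.
  have e20 : 0 < e / 2 by rewrite divr_gt0.
  have [k k0 Dk] := Dlip.
  have [[_ /(_ _ e20) [[B1 B2] [/= B1t B2t] BF]]] := sF tab.
  have : nbhs (S v0 t) (B1 `&` B2) by exact: filterI.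
  move=> /nbhs_ballP[r /= r0 Br].
  have r20 : 0 < r / 2 by rewrite divr_gt0.
  have r40 : 0 < r / 4 by rewrite divr_gt0.
  have rk : 0 < r / 4 / k by rewrite divr_gt0.
  have D0 : \forall v \near v0, forall t, a <= t <= b -> `|S v t - S v0 t| <= r / 4.
    have D1 := near_pair_fst Dk.
    near=> v => u uab.
    have h1 : forall t, a <= t <= b -> `|S v t - S v0 t| <= k * `|v - v0| by near: v.
    apply: (le_trans (h1 _ uab)); rewrite mulrC -ler_pdivlMr//.
  have D1 := near_fst v0 D0; have D2 := near_snd v0 D0.
  have C1 : \forall s \near t, `|S v0 t - S v0 s| <= r / 4.
    by move/cvgrPdist_le: (cS0 tab); apply; rewrite divr_gt0.
  near=> s p => sab.
  have inB (q : 'rV[R]_n) : `|S q s - S v0 s| <= r / 4 -> ball (S v0 t) r (S q s).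
    move=> h; rewrite -ball_normE /=.
    have h1 : `|S v0 t - S v0 s| <= r / 4 by near: s.
    have := ler_normD (S v0 t - S v0 s) (S v0 s - S q s).
    rewrite addrA subrK (distrC (S v0 s)) => h2; lra.
  have n1 : `|S p.1 s - S v0 s| <= r / 4.
    have : forall t, a <= t <= b -> `|S p.1 t - S v0 t| <= r / 4 by near: p.
    exact.
  have n2 : `|S p.2 s - S v0 s| <= r / 4.
    have : forall t, a <= t <= b -> `|S p.2 t - S v0 t| <= r / 4 by near: p.
    exact.
  have [_ Bp2] := Br _ (inB _ n2); have [Bp1 _] := Br _ (inB _ n1).
  have := BF (S p.1 s, S p.2 s) (conj Bp1 Bp2) => /= h1.
  have h2 : `|A s (S p.1 s - S p.2 s) - A t (S p.1 s - S p.2 s)| <= e / 2 * `|S p.1 s - S p.2 s|.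
    have : a <= s <= b -> forall h, `|A s h - A t h| <= e / 2 * `|h| by near: s; exact: Aclose.
    by apply.
  rewrite -(subrKA (A t (S p.1 s - S p.2 s))).
  apply: (le_trans (ler_normD _ _)); rewrite (distrC (A t _)).
  have := h1; rewrite -/(A t) => h1'; lra.
move=> H; near=> p => t tab.
have : `[a, b] `<=` P p by near: p.
by move/(_ t); rewrite /= in_itv /= => /(_ tab); exact.
Unshelve. all: by end_near. Qed.

Let Q (h : 'rV[R]_n) (s t : R) : X := s^-1 *: (S (v0 + s *: h) t - S v0 t).

Let Qbound (h : 'rV[R]_n) : exists2 C, 0 <= C & \forall s \near 0^', forall t, a <= t <= b ->
  `|Q h s t| <= C.
Proof.
have [k k0 Dk] := Dlip; have D1 := near_pair_fst Dk.
exists (k * `|h|); first by rewrite mulr_ge0// ltW.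
have D2 : \forall s \near (0:R), forall t, a <= t <= b ->
    `|S (v0 + s *: h) t - S v0 t| <= k * `|v0 + s *: h - v0| by exact: line_cvg0 D1.
have D3 : \forall s \near 0^', forall t, a <= t <= b ->
    `|S (v0 + s *: h) t - S v0 t| <= k * `|v0 + s *: h - v0| by exact: cvg_within.
near=> s => t tab.
have s0 : s != 0 by near: s; exact: nbhs_dnbhs_neq.
rewrite /Q normrZ normfV mulrC ler_pdivrMr ?normr_gt0//.
have : forall t, a <= t <= b ->
    `|S (v0 + s *: h) t - S v0 t| <= k * `|v0 + s *: h - v0| by near: s.
move=> /(_ t tab); rewrite addrAC subrr add0r normrZ.
by rewrite -mulrA (mulrC `|h|).
Unshelve. all: by end_near. Qed.

Let dQ h (s t : R) := s^-1 *: (F (S (v0 + s *: h) t) - F (S v0 t)).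

Let dQP h : \forall s \near 0^', forall t, a <= t <= b -> is_derive t 1 (Q h s) (dQ h s t).
Proof.
have D2 : \forall s \near (0:R), forall t, a <= t <= b ->
    is_derive t 1 (S (v0 + s *: h)) (F (S (v0 + s *: h) t)) by exact: line_cvg0 dS.
have D3 : \forall s \near 0^', forall t, a <= t <= b ->
    is_derive t 1 (S (v0 + s *: h)) (F (S (v0 + s *: h) t)) by exact: cvg_within.
near=> s => t tab.
apply: is_deriveZ; apply: is_deriveB; last exact: dS0.
by move: t tab; near: s.
Unshelve. all: by end_near. Qed.

(** The quotients nearly solve the linearised equation: the linearisation error is small relative to
    the difference of the two solutions, and after division by [s] that difference is bounded by
    [C]. *)
Let dQlin h (e : R) : 0 < e -> \forall s \near 0^', forall t, a <= t <= b ->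
  `|dQ h s t - A t (Q h s t)| <= e.
Proof.
move=> e0; have [C C0 QC] := Qbound h.
have e1 : 0 < e / (C + 1) by rewrite divr_gt0// ltr_wpDl.
have D1 := near_pair_fst (Flin e1).
have D2 : \forall s \near (0:R), forall t, a <= t <= b ->
  `|F (S (v0 + s *: h) t) - F (S v0 t) - A t (S (v0 + s *: h) t - S v0 t)|
  <= e / (C + 1) * `|S (v0 + s *: h) t - S v0 t| by exact: line_cvg0 D1.
have D3 : \forall s \near 0^', forall t, a <= t <= b ->
  `|F (S (v0 + s *: h) t) - F (S v0 t) - A t (S (v0 + s *: h) t - S v0 t)|
  <= e / (C + 1) * `|S (v0 + s *: h) t - S v0 t| by exact: cvg_within.
near=> s => t tab.
rewrite /dQ /Q linearZ /= -scalerBr normrZ.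
have : forall t, a <= t <= b ->
  `|F (S (v0 + s *: h) t) - F (S v0 t) - A t (S (v0 + s *: h) t - S v0 t)|
  <= e / (C + 1) * `|S (v0 + s *: h) t - S v0 t| by near: s.
move=> /(_ t tab) h1.
have : forall t, a <= t <= b -> `|Q h s t| <= C by near: s.
move=> /(_ t tab); rewrite /Q normrZ => h2.
apply: (@le_trans _ _ (e / (C + 1) * C)).
  apply: le_trans (ler_wpM2l (ltW e1) h2).
  by rewrite mulrCA; apply: ler_wpM2l.
rewrite mulrAC ler_pdivrMr ?ltr_wpDl//.
by rewrite ler_wpM2l// ?ltW// ltrDl.
Unshelve. all: by end_near. Qed.

Let Qcvg0 h : Q h s c @[s --> 0^'] --> 'd (S ^~ c) v0 h.
Proof.
have [dSc _] := sS.
have := @diff_derivable _ _ _ _ _ h dSc; rewrite /derivable => cv.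
rewrite -deriveE// /derive.
apply: cvg_trans cv; apply: near_eq_cvg.
by near=> s; rewrite /Q /= (addrC v0).
Unshelve. all: by end_near. Qed.

(** Two quotients solve the same linear equation up to small errors and nearly agree at time [c], so
    Grönwall compares them. The tolerances contribute 2 (e / 4) from time [c] and 2 (b - a) (2 e /
    (8 (b - a))) = e / 2 from the equation. *)
Let Qcauchy h (e : R) : 0 < e -> exists2 d, 0 < d & forall s r,
  0 < `|s| < d -> 0 < `|r| < d -> forall t, a <= t <= b -> `|Q h s t - Q h r t| <= e.
Proof.
move=> e0; have /andP[ac cb] := acb; have ab : 0 < b - a by lra.
have e1 : 0 < e / (8 * (b - a)) by rewrite divr_gt0// mulr_gt0.
have e2 : 0 < e / 8 by rewrite divr_gt0.
have H1 := dQlin h e1; have H2 := dQP h.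
have H3 : \forall s \near 0^', `|'d (S ^~ c) v0 h - Q h s c| <= e / 8.
  by move/cvgrPdist_le : (@Qcvg0 h); apply.
have [d /= d0 Hd] : \forall s \near 0^', [/\ forall t, a <= t <= b ->
  `|dQ h s t - A t (Q h s t)| <= e / (8 * (b - a)),
   forall t, a <= t <= b -> is_derive t 1 (Q h s) (dQ h s t) &
   `|'d (S ^~ c) v0 h - Q h s c| <= e / 8].
  by near=> s; split; near: s.
have {}Hd s : 0 < `|s| < d -> [/\ forall t, a <= t <= b ->
  `|dQ h s t - A t (Q h s t)| <= e / (8 * (b - a)),
   forall t, a <= t <= b -> is_derive t 1 (Q h s) (dQ h s t) &
   `|'d (S ^~ c) v0 h - Q h s c| <= e / 8].
  move=> /andP[s0 sd]; apply: Hd => /=; first by rewrite sub0r normrN.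
  by rewrite -normr_gt0.
exists d => // s r /Hd[a1 a2 a3] /Hd[b1 b2 b3] t tab.
have := @gronwall_short _ _ (Q h s - Q h r) a b c L (e / (8 * (b - a)) * 2).
have acb' : a <= c <= b by case/andP: acb => /ltW -> /ltW ->.
have ee : 0 <= e / (8 * (b - a)) * 2 by rewrite mulr_ge0// ltW.
move=> /(_ acb' L0 ee Lab) G.
apply: le_trans (G _ t tab) _; last first.
  have : `|(Q h s - Q h r) c| <= e / 4.
    rewrite -[X in `|X|](subrKA ('d (S ^~ c) v0 h)) (addrC (_ - _)).
    by have := ler_normB ('d (S ^~ c) v0 h - Q h r c) ('d (S ^~ c) v0 h - Q h s c);
      rewrite opprB; lra.
  have -> : 2 * (b - a) * (e / (8 * (b - a)) * 2) = e / 2 by field; rewrite gt_eqF.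
  lra.
move=> u uab; have [d1 d2] := is_deriveB (a2 u uab) (b2 u uab).
split; first exact: d1.
rewrite d2.
have -> : dQ h s u - dQ h r u = A u ((Q h s - Q h r) u) +
   ((dQ h s u - A u (Q h s u)) - (dQ h r u - A u (Q h r u))).
  by rewrite linearB /= opprB addrACA (addrC (A u _)) subrK addKr.
apply: (le_trans (ler_normD _ _)).
have h1 := dFL uab ((Q h s - Q h r) u).
have h2 := ler_normB (dQ h s u - A u (Q h s u)) (dQ h r u - A u (Q h r u)).
have h3 := a1 u uab; have h4 := b1 u uab.
rewrite -/(A u) in h1.
lra.
Unshelve. all: by end_near. Qed.

Let q h t := lim (Q h s t @[s --> 0^']).

Let Qcvg h t : a <= t <= b -> Q h s t @[s --> 0^'] --> q h t.
Proof.
move=> tab; apply: cX => e e0.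
have [d d0 Hd] := Qcauchy h e0; exists d => // s r sd rd; exact: Hd.
Qed.

Let Qunif h (e : R) : 0 < e -> \forall s \near 0^', forall t, a <= t <= b ->
  `|Q h s t - q h t| <= e.
Proof.
move=> e0; have [d d0 Hd] := Qcauchy h e0.
near=> s => t tab.
have sd : 0 < `|s| < d.
  apply/andP; split; first by rewrite normr_gt0; near: s; exact: nbhs_dnbhs_neq.
  by near: s; exact: dnbhs0_lt.
have cv : `|Q h s t - Q h r t| @[r --> 0^'] --> `|Q h s t - q h t|.
  by apply: cvg_norm; apply: cvgB; [exact: cvg_cst|exact: Qcvg].
apply: ler_cvg_to cv (cvg_cst _) _; near=> r.
apply: Hd => //; apply/andP; split.
  by rewrite normr_gt0; near: r; exact: nbhs_dnbhs_neq.
by near: r; exact: dnbhs0_lt.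
Unshelve. all: by end_near. Qed.

Let qc h : q h c = 'd (S ^~ c) v0 h.
Proof.
have cab : a <= c <= b by case/andP: acb => /ltW -> /ltW ->.
by apply: cvg_lim => //; exact: Qcvg0.
Qed.

(** Bounds inherited from the quotients; they provide the continuity in time with which [q] is
    differentiated below. *)
Let qlip h : exists2 C, 0 <= C & (forall t, a <= t <= b -> `|q h t| <= C) /\
  forall s t, a <= s <= b -> a <= t <= b -> `|q h s - q h t| <= L * C * `|s - t|.
Proof.
have [C C0 HC] := Qbound h; exists C => //.
have qC t : a <= t <= b -> `|q h t| <= C.
  move=> tab; apply: ler_cvg_to (cvg_norm (@Qcvg h t tab)) (cvg_cst _) _.
  by near=> s; move: t tab; near: s.
split => // s t sab tab.
wlog st : s t sab tab / s <= t.
  move=> H; have [/H|/ltW/H] := leP s t; first exact.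
  by rewrite distrC (distrC s); apply.
have cv : `|Q h r s - Q h r t| @[r --> 0^'] --> `|q h s - q h t|.
  by apply: cvg_norm; apply: cvgB; exact: Qcvg.
apply/ler_addgt0Pr => e e0.
have ts1 : 0 < t - s + 1 by rewrite ltr_wpDl// subr_ge0.
have e1 : 0 < e / (t - s + 1) by rewrite divr_gt0.
apply: ler_cvg_to cv (cvg_cst _) _; near=> r.
have h1 : forall u, a <= u <= b -> is_derive u 1 (Q h r) (dQ h r u).
  by near: r; exact: dQP.
have h2 : forall u, a <= u <= b -> `|dQ h r u - A u (Q h r u)| <= e / (t - s + 1).
  by near: r; exact: dQlin.
have h3 : forall u, a <= u <= b -> `|Q h r u| <= C by near: r.
rewrite distrC (distrC s) (@ger0_norm _ (t - s)) ?subr_ge0//.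
apply: (@le_trans _ _ ((L * C + e / (t - s + 1)) * (t - s))).
  apply: mvt_ineq => // u /andP[su ut].
    have uab : a <= u <= b.
      by case/andP: sab => as_ _; case/andP: tab => _ tb; rewrite (le_trans as_ su) (le_trans ut tb).
    by have [/derivable1_diffP/differentiable_continuous] := h1 u uab.
  have uab : a <= u <= b.
    case/andP: sab => as_ _; case/andP: tab => _ tb.
    by rewrite (le_trans as_ (ltW su)) (le_trans (ltW ut) tb).
  have [d1 d2] := h1 u uab; split => //; rewrite d2.
  have h4 := ler_normD (A u (Q h r u)) (dQ h r u - A u (Q h r u)).
  rewrite addrC subrK in h4.
  have h5 := dFL uab (Q h r u); rewrite -/(A u) in h5.
  have h6 := h2 u uab.
  have h7 : L * `|Q h r u| <= L * C by apply: ler_wpM2l => //; exact: h3.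
  lra.
rewrite mulrDl lerD2l mulrAC ler_pdivrMr//.
by apply: ler_wpM2l; [exact: ltW|rewrite lerDl].
Unshelve. all: by end_near. Qed.

(** The limit solves the linearised equation. Limit and derivative cannot simply be exchanged: for a
    fixed pair of times the mean value inequality is applied to [Q h r] minus a line of slope A t (q
    h t), and the resulting bound passes to the limit in [r]. *)
Let dq h t : a < t < b -> is_derive t 1 (q h) (A t (q h t)).
Proof.
move=> /andP[at_ tb]; have tab : a <= t <= b by rewrite !ltW.
have [C C0 [qC qL]] := qlip h.
suff cv : r^-1 *: (q h (r%:A + t) - q h t) @[r --> 0^'] --> A t (q h t).
  by apply: DeriveDef; [apply/cvg_ex; exists (A t (q h t))|exact: cvg_lim].
apply/cvgrPdist_le => e e0.
(* Four errors of e / 4 each: the equation for [Q], the distance from [Q] to [q], the change of [A]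
   in time and the change of [q] in time. *)
have e1 : 0 < e / (4 * (C + 1)) by rewrite divr_gt0// mulr_gt0// ltr_wpDl.
have e4 : 0 < e / 4 by rewrite divr_gt0.
have e5 : 0 < e / (4 * (L + 1)) by rewrite divr_gt0// mulr_gt0// ltr_wpDl.
have e6 : 0 < e / (4 * (L * L * C + 1)) by rewrite divr_gt0// mulr_gt0// ltr_wpDl// !mulr_ge0.
have /nbhs_ballP[d1 /= d10 Hd1] := Aclose tab e1.
have [d [d0 dd1 da db de]] : exists d, [/\ 0 < d, d <= d1, a <= t - d, t + d <= b & d <= e / (4 * (L * L * C + 1))].
  exists (Num.min (Num.min d1 (t - a)) (Num.min (b - t) (e / (4 * (L * L * C + 1))))).
  rewrite !lt_min !ge_min d10 e6 !subr_gt0 at_ tb !lexx !orbT /=; split => //.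
    by rewrite lerBrDl -lerBrDr !ge_min lexx ?orbT.
  by rewrite -lerBrDl !ge_min lexx ?orbT.
have key s u : t - d < s -> u < t + d -> s <= u -> `|q h u - q h s - (u - s) *: A t (q h t)| <= e * (u - s).
  move=> ds ud su.
  have cv : `|Q h r u - Q h r s - (u - s) *: A t (q h t)| @[r --> 0^'] -->
     `|q h u - q h s - (u - s) *: A t (q h t)|.
    apply: cvg_norm; apply: cvgB; last exact: cvg_cst.
    by apply: cvgB; apply: Qcvg; lra.
  apply: ler_cvg_to cv (cvg_cst _) _; near=> r.
  have h1 : forall w, a <= w <= b -> is_derive w 1 (Q h r) (dQ h r w).
    by near: r; exact: dQP.
  have h2 : forall w, a <= w <= b -> `|dQ h r w - A w (Q h r w)| <= e / 4.
    by near: r; exact: dQlin.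
  have h3 : forall w, a <= w <= b -> `|Q h r w - q h w| <= e / (4 * (L + 1)).
    by near: r; exact: Qunif.
  pose g w := Q h r w - w *: A t (q h t).
  have -> : Q h r u - Q h r s - (u - s) *: A t (q h t) = g u - g s.
    by rewrite /g scalerBl !opprB addrACA (addrC (- _)) -!addrA; congr (_ + _); rewrite addrCA addrC -!addrA.
  have dg w : a <= w <= b -> is_derive w 1 g (dQ h r w - A t (q h t)).
    by move=> wab; apply: is_deriveB; [exact: h1|exact: is_derive_line].
  apply: mvt_ineq => // w /andP[sw wu].
    have wab : a <= w <= b by lra.
    by have [/derivable1_diffP/differentiable_continuous] := dg w wab.
  have wab : a <= w <= b by lra.
  have [g1 ->] := dg w wab; split => //.
  have -> : dQ h r w - A t (q h t) = (dQ h r w - A w (Q h r w)) +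
    (A w (Q h r w - q h w) + ((A w (q h w) - A t (q h w)) + A t (q h w - q h t))).
    by rewrite !linearB /= !subrKA.
  have k1 := h2 w wab; have k2 := h3 w wab.
  have k3 := dFL wab (Q h r w - q h w); rewrite -/(A w) in k3.
  have k4 := dFL tab (q h w - q h t); rewrite -/(A t) in k4.
  have wt : `|w - t| <= d by rewrite ler_norml; lra.
  have k5 : `|A w (q h w) - A t (q h w)| <= e / (4 * (C + 1)) * `|q h w|.
    apply: Hd1 => //; rewrite -ball_normE /= distrC; apply: lt_le_trans dd1.
    by rewrite ltr_norml; lra.
  have k6 := qC w wab; have k7 := qL w t wab tab.
  have l1 : L * `|Q h r w - q h w| <= e / 4.
    apply: (@le_trans _ _ (L * (e / (4 * (L + 1))))); first exact: ler_wpM2l.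
    have -> : L * (e / (4 * (L + 1))) = e / 4 * (L / (L + 1)).
      by field; rewrite gt_eqF// ltr_wpDl.
    rewrite -[leRHS]mulr1; apply: ler_wpM2l; first exact: ltW.
    by rewrite ler_pdivrMr ?ltr_wpDl// mul1r lerDl.
  have l2 : e / (4 * (C + 1)) * `|q h w| <= e / 4.
    apply: (@le_trans _ _ (e / (4 * (C + 1)) * C)); first by apply: ler_wpM2l => //; exact: ltW.
    have -> : e / (4 * (C + 1)) * C = e / 4 * (C / (C + 1)).
      by field; rewrite gt_eqF// ltr_wpDl.
    rewrite -[leRHS]mulr1; apply: ler_wpM2l; first exact: ltW.
    by rewrite ler_pdivrMr ?ltr_wpDl// mul1r lerDl.
  have l3 : L * `|q h w - q h t| <= e / 4.
    apply: (@le_trans _ _ (L * (L * C * d))).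
      apply: ler_wpM2l => //; apply: (le_trans k7); apply: ler_wpM2l => //.
      exact: mulr_ge0.
    apply: (@le_trans _ _ (L * (L * C * (e / (4 * (L * L * C + 1)))))).
      by apply: ler_wpM2l => //; apply: ler_wpM2l => //; exact: mulr_ge0.
    have LC : 0 <= L * L * C by rewrite !mulr_ge0.
    have -> : L * (L * C * (e / (4 * (L * L * C + 1)))) = e / 4 * (L * L * C / (L * L * C + 1)).
      by field; rewrite gt_eqF// ltr_wpDl.
    rewrite -[leRHS]mulr1; apply: ler_wpM2l; first exact: ltW.
    by rewrite ler_pdivrMr ?ltr_wpDl// mul1r lerDl.
  apply: (le_trans (ler_normD _ _)).
  have n1 := ler_normD (A w (Q h r w - q h w)) ((A w (q h w) - A t (q h w)) + A t (q h w - q h t)).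
  have n2 := ler_normD (A w (q h w) - A t (q h w)) (A t (q h w - q h t)).
  lra.
near=> r.
have r0 : r != 0 by near: r; exact: nbhs_dnbhs_neq.
have rd : `|r| < d by near: r; exact: dnbhs0_lt.
rewrite [_%:A]mulr1 distrC.
have -> : r^-1 *: (q h (r + t) - q h t) - A t (q h t) =
   r^-1 *: (q h (r + t) - q h t - r *: A t (q h t)).
  by rewrite [in RHS]scalerBr scalerA mulVf// scale1r.
rewrite normrZ normfV mulrC ler_pdivrMr ?normr_gt0//.
move: rd; rewrite ltr_norml => /andP[rd1 rd2].
have [r1|r1] := leP 0 r.
  have := key t (r + t); rewrite addrK ger0_norm//; apply; lra.
have := key (r + t) t.
have -> : t - (r + t) = - r by rewrite opprD addrCA subrr addr0.
have -> : q h t - q h (r + t) - - r *: A t (q h t) = - (q h (r + t) - q h t - r *: A t (q h t)).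
  by rewrite scaleNr opprK opprB opprB addrC; congr (_ + _).
rewrite normrN ltr0_norm//; apply; lra.
Unshelve. all: by end_near. Qed.

(** Assembled from the basis directions, so that linearity in [h] holds by construction. *)
Let D t (h : 'rV[R]_n) : X := \sum_i h 0 i *: q (delta_mx 0 i) t.

Let D_linear t : linear (D t).
Proof.
move=> k x y; rewrite /D scaler_sumr -big_split; apply: eq_bigr => i _ /=.
by rewrite !mxE scalerDl scalerA.
Qed.

Let dD h t : a < t < b -> is_derive t 1 (D ^~ h) (A t (D t h)).
Proof.
move=> tab.
have -> : D ^~ h = \sum_i (fun t => h 0 i *: q (delta_mx 0 i) t).
  by apply/funext => u; rewrite fct_sumE.
rewrite /D linear_sum; apply: is_derive_sum => i.
by rewrite linearZ; apply: is_deriveZ; exact: dq.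
Qed.

Let Dc h : D c h = 'd (S ^~ c) v0 h.
Proof. by rewrite linfunE; apply: eq_bigr => i _; rewrite qc. Qed.

Let DL t : {linear 'rV[R]_n -> X} :=
  HB.pack (D t) (GRing.isLinear.Build _ _ _ _ _ (D_linear t)).

(** Grönwall for the remainder S p.1 - S p.2 - D (p.1 - p.2): it is small at time [c], and its
    derivative is [A] of itself plus a small linearisation error. *)
Let sdD t : a < t < b -> strictly_diff (S ^~ t) v0 /\ 'd (S ^~ t) v0 = D t :> (_ -> _).
Proof.
move=> tab; have [at_ tb] := andP tab; have [ac cb] := andP acb.
have ab : 0 < b - a by lra.
have := @strictly_diff_eps _ _ _ (S ^~ t) v0 (DL t) (@linear_rV_continuous _ _ _ (DL t)).
apply=> e e0 /=.
have [k k0 Dk] := Dlip.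
have e1 : 0 < e / (4 * (b - a) * k) by rewrite divr_gt0// !mulr_gt0.
have e2 : 0 < e / 4 by rewrite divr_gt0.
have [_ /(_ _ e2) Hc] := sS.
have Hl := Flin e1.
near=> p.
have p1 : forall t, a <= t <= b -> `|S p.1 t - S p.2 t| <= k * `|p.1 - p.2| by near: p.
have p2 : `|S p.1 c - S p.2 c - 'd (S ^~ c) v0 (p.1 - p.2)| <= e / 4 * `|p.1 - p.2| by near: p.
have p3 : forall t, a <= t <= b ->
  `|F (S p.1 t) - F (S p.2 t) - A t (S p.1 t - S p.2 t)| <= e / (4 * (b - a) * k) * `|S p.1 t - S p.2 t|.
  by near: p.
have p4 : forall t, a <= t <= b -> is_derive t 1 (S p.1) (F (S p.1 t)) /\ is_derive t 1 (S p.2) (F (S p.2 t)).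
  by near: p; exact: dSp.
(* The derivative of [D] is known on the open interval only, so Grönwall runs between [t] and
   [c]. *)
pose a' := Num.min t c; pose b' := Num.max t c.
have aa : a < a' by rewrite /a' lt_min at_ ac.
have bb : b' < b by rewrite /b' gt_max tb cb.
have ta' : a' <= t <= b' by rewrite /a' /b' ge_min le_max !lexx.
have ca' : a' <= c <= b' by rewrite /a' /b' ge_min le_max !lexx !orbT.
have Lab' : L * (b' - a') <= 2^-1 by apply: le_trans Lab; apply: ler_wpM2l => //; lra.
have := @gronwall_short _ _ (fun t => S p.1 t - S p.2 t - D t (p.1 - p.2)) a' b' c L
  (e / (4 * (b - a)) * `|p.1 - p.2|) ca' L0 _ Lab' _ t ta'.
have eb : 0 <= e / (4 * (b - a)) by rewrite divr_ge0 ?ltW// mulr_gt0.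
move=> G; apply: le_trans (G _ _) _.
- exact: mulr_ge0.
- move=> u /andP[ua ub]; have uab : a < u < b by lra.
  have uab' : a <= u <= b by lra.
  have [q1 q2] := p4 u uab'.
  have [g1 g2] := is_deriveB (is_deriveB q1 q2) (dD (p.1 - p.2) uab).
  split; first exact: g1.
  rewrite [X in `|X|]g2.
  have -> : F (S p.1 u) - F (S p.2 u) - A u (D u (p.1 - p.2)) =
     A u (S p.1 u - S p.2 u - D u (p.1 - p.2)) +
     (F (S p.1 u) - F (S p.2 u) - A u (S p.1 u - S p.2 u)).
    by rewrite [A u (_ - D _ _)]linearB /= [RHS]addrC subrKA.
  apply: (le_trans (ler_normD _ _)); apply: lerD; first exact: dFL.
  apply: (le_trans (p3 u uab')).
  apply: (@le_trans _ _ (e / (4 * (b - a) * k) * (k * `|p.1 - p.2|))).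
    by apply: ler_wpM2l; [exact: ltW|exact: p1].
  rewrite mulrA; apply: ler_wpM2r => //; rewrite le_eqVlt; apply/orP; left; apply/eqP.
  by field; rewrite !gt_eqF.
- rewrite /= Dc.
  have -> : 2 * (b' - a') * (e / (4 * (b - a)) * `|p.1 - p.2|) =
     (b' - a') / (b - a) * (e / 2 * `|p.1 - p.2|).
    by field; rewrite gt_eqF.
  have h1 : (b' - a') / (b - a) <= 1 by rewrite ler_pdivrMr// mul1r; lra.
  have h2 : 0 <= e / 2 * `|p.1 - p.2| by rewrite mulr_ge0// divr_ge0// ltW.
  have h3 := ler_wpM2r h2 h1.
  lra.
Unshelve. all: by end_near. Qed.

Lemma ode_param_strictly_diff t : a < t < b -> strictly_diff (S ^~ t) v0.
Proof. by case/sdD. Qed.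

(** The variational equation. For the geodesic flow it becomes the Jacobi equation. *)
Lemma ode_param_variation h t : a < t < b ->
  is_derive t 1 (fun u => 'd (S ^~ u) v0 h) ('d F (S v0 t) ('d (S ^~ t) v0 h)).
Proof.
move=> tab; rewrite (proj2 (sdD tab)).
apply: (@near_eq_is_derive _ _ _ (D ^~ h)); last exact: dD.
have [at_ tb] := andP tab.
near=> u; have uab : a < u < b.
  by apply/andP; split; near: u; [exact: lt_nbhsr|exact: lt_nbhsl].
by rewrite (proj2 (sdD uab)).
Unshelve. all: by end_near. Qed.
End OdeParameter.

(** * The inverse function theorem *)

Lemma injective_inverse (R : realType) n (D : {linear 'rV[R]_n -> 'rV[R]_n}) :
  injective D -> exists2 Di : {linear 'rV[R]_n -> 'rV[R]_n}, cancel D Di & cancel Di D.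
Proof.
move=> Dinj; pose J := lin1_mx D.
have DJ v : D v = v *m J by rewrite mul_rV_lin1.
have uJ : J \in unitmx.
  rewrite -row_free_unit; apply/row_freeP.
  have : row_free J.
    rewrite -kermx_eq0; apply/eqP/row_matrixP => i; rewrite row0.
    apply: Dinj; rewrite linear0 DJ.
    by apply/sub_kermxP; exact: row_sub.
  by move/row_freeP.
exists (mulmxr (invmx J)) => v /=.
  by rewrite DJ mulmxK.
by rewrite DJ mulmxKV.
Qed.

(** Newton's iteration x - Di (f x - y) with the inverse [Di] frozen at [a] is a contraction of
    ratio 1/2. The conclusion is local injectivity and openness, the two properties from which local
    sections of the exponential map are made. *)
Lemma inverse_function (R : realType) n (f : 'rV[R]_n -> 'rV[R]_n) a :
  strictly_diff f a -> injective ('d f a) ->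
  exists2 r, 0 < r & (forall x y, `|x - a| < r -> `|y - a| < r -> f x = f y -> x = y) /\
    forall e, 0 < e -> e <= r -> exists2 d, 0 < d &
      forall y, `|y - f a| < d -> exists2 x, `|x - a| < e & f x = y.
Proof.
move=> [df sf] inj.
have [Di DK DiK] := injective_inverse inj.
have [K K0 KD] := linear_lipschitz (@linear_rV_continuous _ _ _ Di).
(* As [K] bounds [Di], this tolerance makes [Di] of the remainder at most half of |x - y|. *)
have e0 : 0 < (2 * K)^-1 by rewrite invr_gt0 mulr_gt0.
have [[A B] [/= Aa Ba] AB] := sf _ e0.
have /nbhs_ballP[r /= r0 Hr] : nbhs a (A `&` B) by exact: filterI.
have {}AB x y : `|x - a| < r -> `|y - a| < r ->
    `|Di (f x - f y) - (x - y)| <= 2^-1 * `|x - y|.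
  move=> xr yr.
  have [Ax _] : (A `&` B) x by apply: Hr; rewrite -ball_normE /= distrC.
  have [_ By] : (A `&` B) y by apply: Hr; rewrite -ball_normE /= distrC.
  have /= h := AB (x, y) (conj Ax By).
  rewrite -{1}(DK (x - y)) -linearB.
  apply: (le_trans (KD _)); apply: (@le_trans _ _ (K * ((2 * K)^-1 * `|x - y|))).
    by apply: ler_wpM2l => //; exact: ltW.
  by rewrite mulrA invfM mulrCA mulfV ?gt_eqF// mulr1.
exists r => //; split.
  move=> x y xr yr fxy; have := AB x y xr yr.
  rewrite fxy subrr linear0 sub0r normrN => h.
  have : `|x - y| <= 0 by lra.
  by rewrite normr_le0 subr_eq0 => /eqP.
(* A target within e / (4 K) moves the centre by at most e / 4; with ratio 1/2 the closed ball of
   radius e / 2 is then mapped into itself. *)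
move=> e e00 er; exists (e / (4 * K)); first by rewrite divr_gt0// mulr_gt0.
move=> y yd.
pose U := [set x | `|x - a| <= e / 2].
pose T x := x - Di (f x - y).
have Ur x : U x -> `|x - a| < r by rewrite /U /= => h; lra.
have TT x x' : U x -> U x' -> `|T x - T x'| <= 2^-1 * `|x - x'|.
  move=> /Ur Ux /Ur Ux'.
  have -> : T x - T x' = - (Di (f x - f x') - (x - x')).
    rewrite /T; have -> : f x - f x' = (f x - y) - (f x' - y) by rewrite opprB subrKA.
    rewrite (linearB Di (f x - y)) /= -[f x - y]/(f x - y); move: (Di _) (Di _) => p p'.
    by rewrite !opprB addrACA [RHS]addrACA; congr (_ + _); exact: addrC.
  by rewrite normrN; exact: AB.
have Ta : `|T a - a| <= e / 4.
  rewrite /T addrAC subrr sub0r normrN (le_trans (KD _))//.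
  rewrite distrC in yd.
  have : K * `|f a - y| <= K * (e / (4 * K)) by apply: ler_wpM2l; exact: ltW.
  by have -> : K * (e / (4 * K)) = e / 4 by field; rewrite gt_eqF.
have Ua : U a by rewrite /U /= subrr normr0; lra.
have TU : set_fun U U T.
  move=> x Ux; rewrite /U /=.
  have := ler_normD (T x - T a) (T a - a); rewrite subrKA => h.
  have h2 := TT x a Ux Ua; rewrite /U /= in Ux; lra.
pose TF : {fun U >-> U} := HB.pack T (isFun.Build _ _ U U T TU).
have cT : is_contraction TF.
  have q0 : 0 <= (2^-1 : R) by [].
  exists (NngNum q0); split => /=; first lra.
  by move=> [x x'] [/= Ux Ux']; exact: TT.
have cU : closed U.
  have -> : U = closed_ball_ (fun x => `|x|) a (e / 2).
    by apply/seteqP; split => x; rewrite /U /closed_ball_ /= distrC.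
  exact: closed_closed_ball_.
pose X : completeNormedModType R := HB.pack 'rV[R]_n.
have [x Ux] := @banach_fixed_point R X U TF cT cU (ex_intro _ a Ua).
rewrite /= /T => /eqP; rewrite eq_sym addrC -subr_eq0 addrK oppr_eq0 => /eqP h.
exists x; first by rewrite /U /= in Ux; lra.
have : 'd f a (Di (f x - y)) = 0 by rewrite h linear0.
by rewrite DiK => /eqP; rewrite subr_eq0 => /eqP.
Qed.

Lemma differentiable_near (R : realType) (V W : normedModType R) (f : V -> W) x :
  differentiable f x -> forall e : R, 0 < e ->
  \forall y \near x, `|f y - f x - 'd f x (y - x)| <= e * `|y - x|.
Proof.
move=> df e e0; have /diff_locallyP[_ /eqaddoP H] := df.
have {H} : \forall h \near (0 : V),
  `|(f \o shift x - (cst (f x) + 'd f x)) h| <= e * `|h| := H e e0.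
rewrite (near_shift x 0) /= sub0r => H.
near=> y; have : `|(f \o shift x - (cst (f x) + 'd f x)) (y - x)| <= e * `|y - x|.
  by near: y; exact: H.
by rewrite /= -[X in `|X|]/(f (y - x + x) - (f x + 'd f x (y - x))) subrK opprD addrA.
Unshelve. all: by end_near. Qed.

(** A merely continuous lift is differentiable: since f (v w) = g w, the increment of [v] is [Di] of
    the increment of [g] up to a small multiple of the increment of [v] itself. *)
Lemma lift_differentiable (R : realType) n (Z : normedModType R)
    (f : 'rV[R]_n -> 'rV[R]_n) (g v : Z -> 'rV[R]_n) z :
  differentiable f (v z) -> injective ('d f (v z)) ->
  {for z, continuous v} -> differentiable g z ->
  (\forall w \near z, f (v w) = g w) ->
  differentiable v z /\ forall h, 'd f (v z) ('d v z h) = 'd g z h.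
Proof.
move=> df inj cv dg fvg.
have [Di DK DiK] := injective_inverse inj.
have [K K0 KD] := linear_lipschitz (@linear_rV_continuous _ _ _ Di).
have [G G0 GD] := diff_bound dg.
have dfe := differentiable_near df; have dge := differentiable_near dg.
have fz := nbhs_singleton fvg.
have key e : 0 < e -> \forall w \near z, `|(v w - v z) - Di (g w - g z)| <= K * e * `|v w - v z|.
  move=> /dfe H; near=> w.
  rewrite -{1}(DK (v w - v z)) -linearB -mulrA (le_trans (KD _))//.
  apply: ler_wpM2l; first exact: ltW.
  have <- : f (v w) = g w by near: w.
  by rewrite distrC -fz; near: w; exact: (cv _ H).
(* With tolerance 1 / (2 K) half of |v w - v z| is absorbed, which gives a Lipschitz bound at [z]; a
   second pass with small tolerance then gives the differential. *)
have vlip : \forall w \near z, `|v w - v z| <= 2 * K * (G + 1) * `|w - z|.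
  have h1 : 0 < (2 * K)^-1 by rewrite invr_gt0 mulr_gt0.
  have H1 := key _ h1; have H2 := dge _ ltr01.
  near=> w.
  have : `|(v w - v z) - Di (g w - g z)| <= K * (2 * K)^-1 * `|v w - v z| by near: w.
  have -> : K * (2 * K)^-1 = 2^-1 by field; rewrite gt_eqF.
  move=> k1.
  have k2 : `|g w - g z - 'd g z (w - z)| <= 1 * `|w - z| by near: w.
  have k3 := GD (w - z).
  have k4 := ler_normD (g w - g z - 'd g z (w - z)) ('d g z (w - z)); rewrite subrK in k4.
  have k5 := ler_normD ((v w - v z) - Di (g w - g z)) (Di (g w - g z)); rewrite subrK in k5.
  have k6 := KD (g w - g z).
  have k7 : K * `|g w - g z| <= K * ((G + 1) * `|w - z|) by apply: ler_wpM2l; [exact: ltW|lra].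
  have -> : 2 * K * (G + 1) * `|w - z| = 2 * (K * ((G + 1) * `|w - z|)) by ring.
  lra.
have [dv dvE] : differentiable v z /\ 'd v z = (Di \o 'd g z) :> (Z -> _).
  apply: (@differentiable_eps _ _ _ v z (Di \o 'd g z)).
    move=> x; apply: continuous_comp; first exact: diff_continuous.
    exact: linear_rV_continuous.
  move=> e e0.
  have G1 : 0 < G + 1 by rewrite addr_gt0.
  have e1 : 0 < e / (4 * K * K * (G + 1)) by rewrite divr_gt0// !mulr_gt0.
  have e2 : 0 < e / (2 * K) by rewrite divr_gt0// mulr_gt0.
  have H1 := key _ e1; have H2 := dge _ e2.
  near=> w => /=.
  have k1 : `|(v w - v z) - Di (g w - g z)| <= K * (e / (4 * K * K * (G + 1))) * `|v w - v z| by near: w.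
  have k2 : `|g w - g z - 'd g z (w - z)| <= e / (2 * K) * `|w - z| by near: w.
  have k3 : `|v w - v z| <= 2 * K * (G + 1) * `|w - z| by near: w.
  rewrite -(subrKA (Di (g w - g z))) -linearB.
  apply: (le_trans (ler_normD _ _)).
  have k4 := KD (g w - g z - 'd g z (w - z)).
  have k5 : K * `|g w - g z - 'd g z (w - z)| <= K * (e / (2 * K) * `|w - z|).
    by apply: ler_wpM2l => //; exact: ltW.
  have k6 : K * (e / (2 * K) * `|w - z|) = e / 2 * `|w - z| by field; rewrite gt_eqF.
  have k7 : K * (e / (4 * K * K * (G + 1))) * `|v w - v z| <=
      K * (e / (4 * K * K * (G + 1))) * (2 * K * (G + 1) * `|w - z|).
    by apply: ler_wpM2l => //; rewrite mulr_ge0// ltW.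
  have k8 : K * (e / (4 * K * K * (G + 1))) * (2 * K * (G + 1) * `|w - z|) = e / 2 * `|w - z|.
    by field; rewrite !gt_eqF.
  lra.
split; first exact: dv.
move=> h; have E : 'd v z h = Di ('d g z h) := congr1 (fun L => L h) dvE.
by apply: etrans (congr1 _ E) _; exact: DiK.
Unshelve. all: by end_near. Qed.

(** * A second derivative test and a trace inequality *)

(** If [c] were positive, [k1] would be positive just to the right of 0, and the mean value theorem
    would push [k] above [k 0]. *)
Lemma second_derivative_max (R : realType) (k k1 : R -> R) (c : R) :
  (\forall s \near (0 : R), is_derive s (1 : R) k (k1 s)) ->
  is_derive (0 : R) (1 : R) k1 c ->
  (\forall s \near (0 : R), k s <= k 0) -> k1 0 = 0 /\ c <= 0.
Proof.
move=> dk dk1 km.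
have : \forall s \near (0:R), is_derive s (1 : R) k (k1 s) /\ k s <= k 0 by near=> s; split; near: s.
move=> /nbhs_ballP[r /= r0 Hr].
have inb s : - r < s -> s < r -> ball 0 r s.
  by move=> h1 h2; rewrite -ball_normE /= sub0r normrN ltr_norml h1 h2.
have k10 : k1 0 = 0.
  have : is_derive (0:R) (1:R) k 0.
    apply: (@derive1_at_max _ _ (- r) r); rewrite ?in_itv /= ?oppr_lt0 ?r0//; first lra.
      by move=> t; rewrite in_itv /= => /andP[h1 h2]; have [[]] := Hr t (inb _ h1 h2).
    by move=> t; rewrite in_itv /= => /andP[h1 h2]; have [] := Hr t (inb _ h1 h2).
  move=> [_ E]; have b0 : ball 0 r (0 : R) by exact: ballxx.
  by have [[_ E2] _] := Hr 0 b0; rewrite -E2.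
split => //; rewrite leNgt; apply/negP => c0.
have cv : h^-1 * k1 h @[h --> 0^'] --> c.
  have [d1 d2] := dk1; rewrite -d2; apply: cvg_trans d1.
  apply: near_eq_cvg; near=> h.
  by rewrite /= [_%:A]mulr1 addr0 k10 subr0.
have : \forall h \near 0^', 0 < h^-1 * k1 h by move/cvgr_gt : cv; apply.
move=> [d /= d0 Hd].
pose s := Num.min (d / 2) (r / 2).
have s0 : 0 < s by rewrite /s lt_min !divr_gt0.
have sd : s < d by rewrite /s gt_min; apply/orP; left; lra.
have sr : s < r by rewrite /s gt_min; apply/orP; right; lra.
have [xi] : exists2 xi, xi \in `]0, s[%R & k s - k 0 = k1 xi * (s - 0).
  apply: MVT => //.
    move=> x; rewrite in_itv /= => /andP[x0 xs].
    have xr : ball 0 r x by apply: inb; lra.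
    by have [] := Hr x xr.
  apply: derivable_within_continuous => x; rewrite in_itv /= => /andP[x0 xs].
  have xr : ball 0 r x by apply: inb; lra.
  by have [[]] := Hr x xr.
rewrite in_itv /= subr0 => /andP[x0 xs] E.
have srb : ball 0 r s by apply: inb; lra.
have [_] := Hr s srb.
have := Hd xi; rewrite /= sub0r normrN gtr0_norm// => /(_ (lt_trans xs sd)).
rewrite gt_eqF// => /(_ isT); rewrite pmulr_rgt0 ?invr_gt0// => h1 h2.
have : 0 < k1 xi * s by rewrite mulr_gt0.
lra.
Unshelve. all: by end_near. Qed.

(* Schur complement: S = r^T r / S_00 + (0 + S') with S' positive definite. *)
Lemma trace_negative (R : realType) m (S q : 'M[R]_m) : (0 < m)%N ->
  S^T = S -> (forall u : 'rV[R]_m, u != 0 -> 0 < (u *m S *m u^T) 0 0) ->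
  (forall u : 'rV[R]_m, u != 0 -> (u *m q *m u^T) 0 0 < 0) ->
  \tr (S *m q) < 0.
Proof.
move=> m0 symS posS negq.
(* The empty matrix has trace 0, so the induction carries [m = 0] as an alternative. *)
suff [//|] : \tr (S *m q) < 0 \/ m = 0%N by move=> m0'; rewrite m0' in m0.
move: m {m0} S q symS posS negq; elim=> [|m IH]; first by right.
rewrite -[m.+1]/(1 + m)%N => S q symS posS negq; left.
pose o : 'I_(1 + m) := lshift m 0.
pose a := S o o; pose r := row o S.
have a0 : 0 < a.
  have o0 : (delta_mx 0 o : 'rV[R]_(1 + m)) != 0.
    apply/eqP => /matrixP /(_ 0 o); rewrite !mxE !eqxx => /eqP.
    by rewrite oner_eq0.
  by have := posS _ o0; rewrite -rowE trmx_delta -colE !mxE.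
have r0 : r != 0.
  by apply: contraTneq a0 => r0; have := congr1 (fun A : 'rV_(1 + m) => A 0 o) r0; rewrite !mxE -/a => ->; rewrite ltxx.
pose S2 := S - a^-1 *: (r^T *m r).
have S2o j : S2 o j = 0.
  by rewrite !mxE big_ord1 !mxE mulrA mulVf ?gt_eqF// mul1r subrr.
have symS2 : S2^T = S2 by rewrite /S2 linearB linearZ /= symS trmx_mul trmxK.
have S2o' j : S2 j o = 0 by rewrite -symS2 mxE S2o.
have blockE (T : 'M[R]_(1 + m)) : (forall j, T o j = 0) -> (forall j, T j o = 0) ->
    T = block_mx 0 0 0 (drsubmx T).
  move=> To To'; rewrite -{1}(submxK T); congr block_mx; apply/matrixP => i j;
    rewrite !mxE ?(ord1 i) ?(ord1 j); [exact: To|exact: To|exact: To'].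
have S2E := blockE S2 S2o S2o'.
have SE : S = a^-1 *: (r^T *m r) + S2 by rewrite /S2 addrC subrK.
have rq := negq _ r0.
have t1 : \tr (a^-1 *: (r^T *m r) *m q) < 0.
  rewrite -scalemxAl linearZ /= -mulmxA mxtrace_mulC trace_mx11.
  by rewrite pmulr_rlt0 ?invr_gt0.
rewrite SE mulmxDl linearD /=.
have [->|t2] : \tr (S2 *m q) = 0 \/ \tr (S2 *m q) < 0; last 2 first.
- by rewrite addr0.
- by move: t1 t2; move: (\tr _) (\tr _) => x y h1 h2; lra.
have tE : \tr (S2 *m q) = \tr (drsubmx S2 *m drsubmx q).
  rewrite S2E -{1}(submxK q) mulmx_block !mul0mx !add0r mxtrace_block linear0 add0r.
  by rewrite block_mxKdr.
rewrite tE.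
have embE (u : 'rV[R]_m) (x : 'M[R]_1) (T : 'M[R]_(1 + m)) : T = block_mx 0 0 0 (drsubmx T) ->
  row_mx x u *m T *m (row_mx x u)^T = u *m drsubmx T *m u^T.
  by move=> ->; rewrite mul_row_block !mulmx0 !add0r tr_row_mx mul_row_col mul0mx add0r block_mxKdr.
case: (IH (drsubmx S2) (drsubmx q)).
- by rewrite trmx_drsub symS2.
- move=> u u0.
  pose b := (rsubmx r) *m u^T.
  (* The first entry makes [w] orthogonal to the first basis vector for [S]; on such vectors the
     forms [S2] and [S] agree. *)
  pose w := row_mx (- (a^-1 *: b)) u : 'rV[R]_(1 + m).
  have w0 : w != 0.
    apply: contra_neq u0 => w0; have := congr1 rsubmx w0.
    by rewrite row_mxKr linear0.
  rewrite -(embE u (- (a^-1 *: b))) // -/w.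
  have rw : r *m w^T = 0.
    rewrite -{1}(hsubmxK r) /w tr_row_mx mul_row_col -/b.
    have -> : lsubmx r = a%:M.
      by apply/matrixP => i j; rewrite !mxE !(ord1 i) !(ord1 j) eqxx mulr1n.
    rewrite mul_scalar_mx linearN linearZ /= scalerN scalerA divff ?gt_eqF// scale1r.
    by rewrite [b]mx11_scalar tr_scalar_mx addNr.
  have -> : w *m S2 *m w^T = w *m S *m w^T.
    rewrite /S2 mulmxBr mulmxBl -scalemxAr -scalemxAl -!mulmxA rw !mulmx0 scaler0 subr0.
    by [].
  exact: posS.
- move=> u u0; have w0 : (row_mx 0 u : 'rV[R]_(1 + m)) != 0.
    apply: contra_neq u0 => w0; have := congr1 rsubmx w0.
    by rewrite row_mxKr linear0.
  have := negq _ w0.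
  rewrite -{1}(submxK q) mul_row_block !mul0mx !add0r tr_row_mx mul_row_col.
  by rewrite trmx0 mulmx0 add0r.
- by right.
- by move=> m0; left; rewrite /mxtrace big1// => i; have := ltn_ord i; rewrite {2}m0.
Qed.

Opaque derive diff.

(** * Strict differentiability and derivatives of matrix-valued maps *)

Lemma strictly_diffZl (R : realType) (V W : normedModType R) (f : V -> R) (w : W) a :
  strictly_diff f a -> strictly_diff (fun x => f x *: w) a.
Proof.
move=> sf; apply: (proj1 (strictly_diff_comp (g := fun k : R => k *: w) sf _)).
have lin : linear (fun k : R => k *: w).
  by move=> l p q /=; rewrite scalerDl scalerA.
pose L : {linear R -> W} := HB.pack (fun k : R => k *: w)
  (GRing.isLinear.Build _ _ _ _ _ lin).
apply: (@strictly_diff_lin _ _ _ L); exact: scalel_continuous.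
Qed.

Lemma strictly_diff_coord (R : realType) (V : normedModType R) m n
    (M : V -> 'M[R]_(m, n)) i j a :
  strictly_diff M a -> strictly_diff (fun x => M x i j) a.
Proof.
move=> sM; apply: (proj1 (strictly_diff_comp (g := fun N : 'M[R]_(m, n) => N i j) sM _)).
have lin : linear (fun N : 'M[R]_(m, n) => N i j : R) by move=> k x y /=; rewrite !mxE.
pose L : {linear 'M[R]_(m, n) -> R} := HB.pack (fun N : 'M[R]_(m, n) => N i j : R)
  (GRing.isLinear.Build _ _ _ _ _ lin).
apply: (@strictly_diff_lin _ _ _ L); exact: coord_continuous.
Qed.

Lemma strictly_diff_mx (R : realType) (V : normedModType R) m n
    (M : V -> 'M[R]_(m, n)) a :
  (forall i j, strictly_diff (fun x => M x i j) a) -> strictly_diff M a.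
Proof.
move=> sM.
have -> : M = fun x => \sum_i \sum_j M x i j *: delta_mx i j.
  by apply/funext => x; exact: matrix_sum_delta.
apply: strictly_diff_sum => i _; apply: strictly_diff_sum => j _.
exact: strictly_diffZl.
Qed.

Lemma strictly_diff_mulmx (R : realType) (V : normedModType R) m n p
    (M : V -> 'M[R]_(m, n)) (N : V -> 'M[R]_(n, p)) a :
  strictly_diff M a -> strictly_diff N a -> strictly_diff (fun x => M x *m N x) a.
Proof.
move=> sM sN; apply: strictly_diff_mx => i j.
under eq_fun do rewrite mxE.
apply: strictly_diff_sum => k _.
by apply: strictly_diffM; exact: strictly_diff_coord.
Qed.

Lemma strictly_diff_det (R : realType) (V : normedModType R) n
    (M : V -> 'M[R]_n) a :
  (forall i j, strictly_diff (fun x => M x i j) a) ->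
  strictly_diff (fun x => \det (M x)) a.
Proof.
move=> sM; rewrite /determinant; apply: strictly_diff_sum => s _.
apply: strictly_diffM; first exact: strictly_diff_cst.
by apply: strictly_diff_prod => i _; exact: sM.
Qed.

(** Near [a] the inverse is the adjugate over the determinant, so its entries are rational in those
    of [M]. *)
Lemma strictly_diff_invmx (R : realType) (V : normedModType R) n
    (M : V -> 'M[R]_n) a : (\forall x \near a, M x \in unitmx) ->
  strictly_diff M a -> strictly_diff (fun x => invmx (M x)) a.
Proof.
move=> uM sM; have sMij i j := strictly_diff_coord i j sM.
apply: (@strictly_diff_near_eq _ _ _ (fun x => (\det (M x))^-1 *: \adj (M x))).
  by near=> x; rewrite /invmx ifT//; near: x.
apply: strictly_diff_mx => i j; under eq_fun do rewrite !mxE.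
apply: strictly_diffM.
  apply: strictly_diffV; first exact: strictly_diff_det.
  by have := nbhs_singleton uM; rewrite unitmxE unitfE.
rewrite /cofactor; apply: strictly_diffM; first exact: strictly_diff_cst.
apply: strictly_diff_det => k l; under eq_fun do rewrite !mxE.
exact: sMij.
Unshelve. all: by end_near. Qed.

Lemma is_derive_mxP (R : realType) (V : normedModType R) m n
    (M : V -> 'M[R]_(m, n)) t v dM :
  is_derive t v M dM <-> forall i j, is_derive t v (fun x => M x i j) (dM i j).
Proof.
split=> [[d1 d2] i j|H].
  apply: DeriveDef; first by move/derivable_mxP : d1; exact.
  by rewrite -d2 derive_mx// mxE.
have dM' : derivable M t v by apply/derivable_mxP => i j; case: (H i j).
apply: DeriveDef => //; rewrite derive_mx//; apply/matrixP => i j; rewrite mxE.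
by case: (H i j).
Qed.

Lemma is_derive_mulr (R : realType) (V : normedModType R) (f g : V -> R) t v df dg :
  is_derive t v f df -> is_derive t v g dg ->
  is_derive t v (fun x => f x * g x) (df * g t + f t * dg).
Proof.
move=> hf hg; have h := is_deriveM hf hg.
have -> : df * g t + f t * dg = f t *: dg + g t *: df.
  by rewrite addrC (mulrC df).
exact: h.
Qed.

Lemma is_derive_scale_mx (R : realType) (V : normedModType R) m n
    (f : V -> R) (M : V -> 'M[R]_(m, n)) t v df dM :
  is_derive t v f df -> is_derive t v M dM ->
  is_derive t v (fun x => f x *: M x) (f t *: dM + df *: M t).
Proof.
move=> hf /is_derive_mxP hM; apply/is_derive_mxP => i j.
have h := is_derive_mulr hf (hM i j).
have -> : (fun x => (f x *: M x) i j) = (fun x => f x * M x i j).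
  by apply/funext => x; rewrite mxE.
have -> : (f t *: dM + df *: M t) i j = df * M t i j + f t * dM i j.
  by rewrite !mxE addrC.
exact: h.
Qed.

Lemma strictly_diff_scale_mx (R : realType) (V : normedModType R) m n
    (f : V -> R) (M : V -> 'M[R]_(m, n)) a :
  strictly_diff f a -> strictly_diff M a -> strictly_diff (fun x => f x *: M x) a.
Proof.
move=> sf sM; apply: strictly_diff_mx => i j.
have -> : (fun x => (f x *: M x) i j) = (fun x => f x * M x i j).
  by apply/funext => x; rewrite mxE.
exact: (strictly_diffM sf (strictly_diff_coord i j sM)).
Qed.

Lemma strictly_diff_fst (R : realType) (V W : normedModType R) (p : V * W) :
  strictly_diff fst p /\ 'd fst p = fst :> (V * W -> V).
Proof.
have lin : linear (fst : (V * W)%type -> V) by [].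
pose L : {linear (V * W)%type -> V} := HB.pack (fst : (V * W)%type -> V)
  (GRing.isLinear.Build _ _ _ _ _ lin).
have cL : continuous L by move=> q; exact: cvg_fst.
by split; [exact: (@strictly_diff_lin _ _ _ L)|exact: (@diff_lin _ _ _ L)].
Qed.

Lemma strictly_diff_snd (R : realType) (V W : normedModType R) (p : V * W) :
  strictly_diff snd p /\ 'd snd p = snd :> (V * W -> W).
Proof.
have lin : linear (snd : (V * W)%type -> W) by [].
pose L : {linear (V * W)%type -> W} := HB.pack (snd : (V * W)%type -> W)
  (GRing.isLinear.Build _ _ _ _ _ lin).
have cL : continuous L by move=> q; exact: cvg_snd.
by split; [exact: (@strictly_diff_lin _ _ _ L)|exact: (@diff_lin _ _ _ L)].
Qed.

Lemma is_derive_fst (R : realType) (V W : normedModType R) (f : R -> V * W) (t : R) df :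
  is_derive t 1 f df -> is_derive t 1 (fun s => (f s).1) df.1.
Proof.
move=> hf; have [[d _] E] := strictly_diff_fst (f t).
by have := is_derive_chain d hf; rewrite E.
Qed.

Lemma is_derive_snd (R : realType) (V W : normedModType R) (f : R -> V * W) (t : R) df :
  is_derive t 1 f df -> is_derive t 1 (fun s => (f s).2) df.2.
Proof.
move=> hf; have [[d _] E] := strictly_diff_snd (f t).
by have := is_derive_chain d hf; rewrite E.
Qed.

Lemma is_derive_pair (R : realType) (V W : normedModType R) (f : R -> V) (g : R -> W)
    (t : R) df dg : is_derive t 1 f df -> is_derive t 1 g dg ->
  is_derive t 1 (fun s => (f s, g s)) (df, dg).
Proof.
move=> [f1 f2] [g1 g2].
have df' : differentiable f t by apply/derivable1_diffP.
have dg' : differentiable g t by apply/derivable1_diffP.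
have dfg := differentiable_pair df' dg'.
apply: DeriveDef; first exact: diff_derivable.
rewrite deriveE// diff_pair//= -f2 -g2 !deriveE//.
Qed.

Lemma is_derive_affine (R : realType) (V : normedModType R) (x v : V) (t : R) :
  is_derive t 1 (fun s : R => x + s *: v) v.
Proof.
rewrite -[X in is_derive _ _ _ X]add0r; apply: is_deriveD; exact: is_derive_line.
Qed.

Lemma is_derive_unique (R : realType) (V W : normedModType R) (f : V -> W) t v a b :
  is_derive t v f a -> is_derive t v f b -> a = b.
Proof. by move=> [_ <-] [_ <-]. Qed.

(** * Coordinate formulas for the Levi-Civita connection *)

Lemma formD (R : realType) n (G : 'M[R]_n) u u' v :
  form G (u + u') v = form G u v + form G u' v.
Proof. by rewrite /form !mulmxDl mxE. Qed.

Lemma formDr (R : realType) n (G : 'M[R]_n) u v v' :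
  form G u (v + v') = form G u v + form G u v'.
Proof. by rewrite /form linearD mulmxDr mxE. Qed.

Lemma formZ (R : realType) n (G : 'M[R]_n) k u v : form G (k *: u) v = k * form G u v.
Proof. by rewrite /form -!scalemxAl mxE. Qed.

Lemma formZr (R : realType) n (G : 'M[R]_n) k u v : form G u (k *: v) = k * form G u v.
Proof. by rewrite /form linearZ -scalemxAr mxE. Qed.

Lemma formN (R : realType) n (G : 'M[R]_n) u v : form G (- u) v = - form G u v.
Proof. by rewrite -scaleN1r formZ mulN1r. Qed.

Lemma form0 (R : realType) n (G : 'M[R]_n) v : form G 0 v = 0.
Proof. by rewrite -(scale0r 0) formZ mul0r. Qed.

Lemma form0r (R : realType) n (G : 'M[R]_n) v : form G v 0 = 0.
Proof. by rewrite -(scale0r 0) formZr mul0r. Qed.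

Lemma formE (R : realType) n (G : 'M[R]_n) u v :
  form G u v = \sum_i \sum_j u 0 i * G i j * v 0 j.
Proof.
rewrite /form mxE exchange_big; apply: eq_bigr => j _ /=.
by rewrite !mxE mulr_suml.
Qed.

Lemma formC (R : realType) n (G : 'M[R]_n) u v : G^T = G -> form G u v = form G v u.
Proof.
move=> sG; rewrite /form -[in LHS](trmxK (u *m G *m v^T)) mxE.
by rewrite !trmx_mul trmxK sG mulmxA.
Qed.

Lemma form_suml (R : realType) n (G : 'M[R]_n) u (I : Type) (r : seq I) (P : pred I) (F : I -> 'rV_n) :
  form G (\sum_(i <- r | P i) F i) u = \sum_(i <- r | P i) form G (F i) u.
Proof. by rewrite /form !mulmx_suml summxE. Qed.

Lemma posdef_unitmx (R : realType) n (G : 'M[R]_n) :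
  (forall u, u != 0 -> 0 < form G u u) -> G \in unitmx.
Proof.
move=> pos; rewrite -row_free_unit -kermx_eq0; apply/eqP/row_matrixP => i; rewrite row0.
apply/eqP; apply: contraT => ne0; have := pos _ ne0.
have -> : form G (row i (kermx G)) (row i (kermx G)) = 0.
  rewrite /form; have -> : row i (kermx G) *m G = 0 by apply/sub_kermxP; exact: row_sub.
  by rewrite mul0mx mxE.
by rewrite ltxx.
Qed.

Lemma gram_det_gt0 (R : realType) n (G : 'M[R]_n) u v : G^T = G ->
  (forall u, u != 0 -> 0 < form G u u) -> row_free (col_mx u v) ->
  0 < form G u u * form G v v - form G u v ^+ 2.
Proof.
move=> sG pos uvf.
have indep (x y : R) : x *: u + y *: v = 0 -> x = 0 /\ y = 0.
  move=> h.
  have : row_mx x%:M y%:M *m col_mx u v = 0 *m col_mx u v.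
    by rewrite mul_row_col !mul_scalar_mx mul0mx.
  move=> /(row_free_inj uvf); rewrite -[RHS]row_mx0 => /eq_row_mx[].
  move=> /matrixP /(_ 0 0); rewrite !mxE eqxx mulr1n => ->.
  by move=> /matrixP /(_ 0 0); rewrite !mxE eqxx mulr1n => ->.
have v0 : v != 0.
  apply/eqP => v0; have [|_ /eqP] := indep 0 1.
    by rewrite v0 scaler0 scale0r addr0.
  by rewrite oner_eq0.
(* The part of [u] orthogonal to [v], scaled by <v, v>: its square norm is <v, v> times the Gram
   determinant. *)
have w0 : form G v v *: u + (- form G u v) *: v != 0.
  apply/eqP => /indep[h _]; have := pos v v0; by rewrite h ltxx.
have := pos _ w0; rewrite !formD !formDr !formZ !formZr (formC v u sG).
have := pos v v0; set a := form G v v; set b := form G u u; set c := form G u v.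
move=> a0 h; have {}h : 0 < a * (b * a - c ^+ 2) by nra.
by move: h; rewrite pmulr_rgt0.
Qed.

Section Coordinates.
Context (R : realType) (n : nat) (G : 'rV[R]_n -> 'M[R]_n) (U : set 'rV[R]_n).
Hypothesis oU : open U.
Hypothesis sG : smooth_on U G.
Hypothesis symG : forall y, U y -> (G y)^T = G y.
Hypothesis posG : forall y u, U y -> u != 0 -> 0 < form (G y) u u.

Let diffG x : U x -> differentiable G x.
Proof. by move=> Ux; exact: (smooth_on_diff sG Ux). Qed.

Lemma metric_derive_sym x u : U x -> ('D_u G x)^T = 'D_u G x.
Proof.
move=> Ux; have dG := @diff_derivable _ _ _ G x u (diffG Ux).
rewrite derive_mx//; apply/matrixP => i j; rewrite !mxE.
apply: near_eq_derive.
near=> y; have Uy : U y by near: y; exact: open_nbhs_nbhs.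
by rewrite -[in LHS](symG Uy) mxE.
Unshelve. all: by end_near. Qed.

Lemma metric_deriveE x u : U x -> 'D_u G x = \sum_l u 0 l *: partial l G x.
Proof.
move=> Ux; rewrite deriveE; last exact: diffG.
rewrite linfunE; apply: eq_bigr => l _.
by rewrite /partial deriveE//; exact: diffG.
Qed.

Lemma metric_unit x : U x -> G x \in unitmx.
Proof. by move=> Ux; apply: posdef_unitmx => u; exact: posG. Qed.

Lemma christoffelC x u v : U x -> christoffel G x u v = christoffel G x v u.
Proof.
move=> Ux; rewrite /christoffel [in RHS](addrC (u *m _)); congr ((_ *: (_ - _)) *m _).
apply/matrixP => i j; rewrite !mxE; apply: formC.
exact: metric_derive_sym.
Qed.

Lemma christoffelDl x u u' v : U x ->
  christoffel G x (u + u') v = christoffel G x u v + christoffel G x u' v.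
Proof.
move=> Ux; rewrite [LHS]/christoffel.
have -> : 'D_(u + u') G x = 'D_u G x + 'D_u' G x.
  by rewrite !deriveE ?linearD; do ?exact: diffG.
have -> : (\row_l form (partial l G x) (u + u') v) =
   (\row_l form (partial l G x) u v) + (\row_l form (partial l G x) u' v).
  by apply/matrixP => i j; rewrite !mxE formD.
rewrite /christoffel.
move: ('D_u G x) ('D_u' G x) ('D_v G x) (\row_l form _ u v) (\row_l form _ u' v) => A B C r r'.
rewrite -mulmxDl -scalerDr mulmxDr mulmxDl opprD.
by rewrite (addrACA (v *m A)) (addrACA (v *m A + u *m C)).
Qed.

Lemma christoffelZl x k u v : U x ->
  christoffel G x (k *: u) v = k *: christoffel G x u v.
Proof.
move=> Ux; rewrite [LHS]/christoffel.
have -> : 'D_(k *: u) G x = k *: 'D_u G x.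
  by rewrite !deriveE ?linearZ; do ?exact: diffG.
have -> : (\row_l form (partial l G x) (k *: u) v) = k *: (\row_l form (partial l G x) u v).
  by apply/matrixP => i j; rewrite !mxE formZ.
rewrite /christoffel.
move: ('D_u G x) ('D_v G x) (\row_l form _ u v) => A B r.
rewrite scalemxAl scalerA mulrC -scalerA; congr ((_ *: _) *m _).
by rewrite -scalemxAr -scalemxAl !scalerDr scalerN.
Qed.

Lemma christoffelDr x u v v' : U x ->
  christoffel G x u (v + v') = christoffel G x u v + christoffel G x u v'.
Proof. by move=> Ux; rewrite !(christoffelC u)// christoffelDl. Qed.

Lemma christoffelZr x k u v : U x ->
  christoffel G x u (k *: v) = k *: christoffel G x u v.
Proof. by move=> Ux; rewrite !(christoffelC u)// christoffelZl. Qed.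

(** Pairing with [G x] cancels [invmx (G x)]. This is Koszul's formula for constant fields, whose
    brackets vanish. *)
Lemma koszul x a b c : U x -> form (G x) (christoffel G x a b) c =
  2^-1 * (form ('D_a G x) b c + form ('D_b G x) a c - form ('D_c G x) a b).
Proof.
move=> Ux.
have E (X : 'rV[R]_n) : form (G x) (X *m invmx (G x)) c = (X *m c^T) 0 0.
  by rewrite /form mulmxKV ?metric_unit.
have Ec : ((\row_l form (partial l G x) a b) *m c^T) 0 0 = form ('D_c G x) a b.
  rewrite metric_deriveE// mxE /form mulmx_sumr mulmx_suml summxE.
  apply: eq_bigr => l _; rewrite -scalemxAr -scalemxAl [RHS]mxE [LHS]mulrC.
  by congr (_ * _); [rewrite mxE|rewrite [LHS]mxE].
rewrite /christoffel -scalemxAl formZ E -Ec; congr (_ * _).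
rewrite /form; move: ('D_a G x) ('D_b G x) (\row_l _) => A B r.
by rewrite mulmxBl mulmxDl [LHS]mxE [X in X + _]mxE [X in _ + X]mxE.
Qed.

(** In the sum of two Koszul formulas the derivatives along [v] and [w] cancel, and the two
    derivatives along [u] agree by symmetry. *)
Lemma metric_compat x u v w : U x ->
  form ('D_u G x) v w = form (G x) (christoffel G x u v) w + form (G x) v (christoffel G x u w).
Proof.
move=> Ux.
have aux (p q r s A B : R) : A = 2^-1 * (p + q - r) -> B = 2^-1 * (s + r - q) ->
  s = p -> p = A + B by move=> -> -> ->; field.
exact: (aux _ _ _ _ _ _ (koszul u v w Ux)
  (etrans (formC _ _ (symG Ux)) (koszul u w v Ux)) (formC w v (metric_derive_sym u Ux))).
Qed.

Lemma christoffel_strictly_diff u v x : U x ->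
  strictly_diff (fun y => christoffel G y u v) x.
Proof.
move=> Ux.
have nU : \forall y \near x, U y by exact: open_nbhs_nbhs.
have sGx : strictly_diff G x := smooth_strictly_diff oU sG Ux.
have sP l : strictly_diff (partial l G) x :=
  smooth_strictly_diff oU (smooth_on_partial l sG) Ux.
(* [smooth_on] speaks of partial derivatives, so directional derivatives are first written as
   combinations of them. *)
have sD w : strictly_diff (fun y => 'D_w G y) x.
  apply: (@strictly_diff_near_eq _ _ _ (fun y => \sum_l w 0 l *: partial l G y)).
    by near=> y; rewrite metric_deriveE//; near: y.
  apply: strictly_diff_sum => l _.
  exact: (@strictly_diffZr R _ _ (partial l G) (w 0 l) x (sP l)).
rewrite /christoffel; apply: strictly_diff_mulmx; last first.
  apply: strictly_diff_invmx => //.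
  by near=> y; apply: metric_unit; near: y.
apply: strictly_diffZr; apply: strictly_diffD.
  apply: strictly_diffD.
    exact: (strictly_diff_mulmx (strictly_diff_cst v x) (sD u)).
  exact: (strictly_diff_mulmx (strictly_diff_cst u x) (sD v)).
apply: (@strictly_diff_near_eq _ _ _ (fun y => (-1) *: \row_l form (partial l G y) u v)).
  by near=> y; rewrite scaleN1r.
apply: strictly_diffZr; apply: strictly_diff_mx => i l.
under eq_fun do rewrite mxE formE.
apply: strictly_diff_sum => j _; apply: strictly_diff_sum => k _.
apply: strictly_diffM; last exact: strictly_diff_cst.
apply: strictly_diffM; first exact: strictly_diff_cst.
exact: (strictly_diff_coord j k (sP l)).
Unshelve. all: by end_near. Qed.

(** Separates the base point from the vectors: the dependence on the point sits in a fixed finite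
    family of functions, so all three arguments can be differentiated together. *)
Lemma christoffelE x u v : U x -> christoffel G x u v =
  \sum_i \sum_j (u 0 i * v 0 j) *: christoffel G x (delta_mx 0 i) (delta_mx 0 j).
Proof.
move=> Ux; rewrite {1}[u]row_sum_delta.
have suml (r : seq 'I_n) w (F : 'I_n -> 'rV[R]_n) :
    christoffel G x (\sum_(i <- r) F i) w = \sum_(i <- r) christoffel G x (F i) w.
  elim: r => [|i r IH]; last by rewrite !big_cons christoffelDl// IH.
  rewrite !big_nil; have := @christoffelZl x 0 0 w Ux.
  by rewrite !scale0r.
rewrite suml; apply: eq_bigr => i _; rewrite christoffelZl// christoffelC//.
rewrite {1}[v]row_sum_delta suml scaler_sumr; apply: eq_bigr => j _.
by rewrite christoffelZl// scalerA christoffelC.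
Qed.

Lemma is_derive_christoffel (c a b : R -> 'rV[R]_n) t dc da db : U (c t) ->
  is_derive t 1 c dc -> is_derive t 1 a da -> is_derive t 1 b db ->
  is_derive t 1 (fun s => christoffel G (c s) (a s) (b s))
    ('D_dc (fun x => christoffel G x (a t) (b t)) (c t) +
     christoffel G (c t) da (b t) + christoffel G (c t) (a t) db).
Proof.
move=> Ut dct dat dbt.
have cc : {for t, continuous c} by case: dct => /derivable1_diffP/differentiable_continuous.
pose Gam i j x := christoffel G x (delta_mx 0 i) (delta_mx 0 j).
have dG i j : differentiable (Gam i j) (c t) := proj1 (christoffel_strictly_diff _ _ Ut).
have dGc i j : is_derive t 1 (Gam i j \o c) ('d (Gam i j) (c t) dc).
  exact: is_derive_chain.
have coord (e : R -> 'rV[R]_n) de i : is_derive t 1 e de ->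
    is_derive t 1 (fun s => e s 0 i) (de 0 i) by move=> /is_derive_mxP.
have D1 i j : is_derive t 1 (fun s => (a s 0 i * b s 0 j) *: Gam i j (c s))
  ((a t 0 i * b t 0 j) *: 'd (Gam i j) (c t) dc +
   (da 0 i * b t 0 j + a t 0 i * db 0 j) *: Gam i j (c t)).
  apply: (@is_derive_scale_mx R R 1 n (fun s => a s 0 i * b s 0 j)
    (fun s => Gam i j (c s)) t 1 _ _ _ (dGc i j)).
  exact: (is_derive_mulr (coord _ _ i dat) (coord _ _ j dbt)).
have E : is_derive t 1 (fun s => \sum_i \sum_j (a s 0 i * b s 0 j) *: Gam i j (c s))
  (\sum_i \sum_j ((a t 0 i * b t 0 j) *: 'd (Gam i j) (c t) dc +
   (da 0 i * b t 0 j + a t 0 i * db 0 j) *: Gam i j (c t))).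
  have -> : (fun s => \sum_i \sum_j (a s 0 i * b s 0 j) *: Gam i j (c s)) =
     \sum_i \sum_j (fun s => (a s 0 i * b s 0 j) *: Gam i j (c s)).
    by apply/funext => s; rewrite fct_sumE; apply: eq_bigr => i _; rewrite fct_sumE.
  by apply: is_derive_sum => i; apply: is_derive_sum => j.
apply: (@near_eq_is_derive _ _ _ (fun s => \sum_i \sum_j (a s 0 i * b s 0 j) *: Gam i j (c s))).
  have := cc _ (open_nbhs_nbhs (conj oU Ut)) => nU.
  near=> s; rewrite -christoffelE//.
  by near: s.
move: E; congr (is_derive _ _ _ _).
have -> : 'D_dc (fun x => christoffel G x (a t) (b t)) (c t) =
    \sum_i \sum_j (a t 0 i * b t 0 j) *: 'd (Gam i j) (c t) dc.
  have nU : \forall y \near c t, U y by exact: open_nbhs_nbhs.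
  rewrite (@near_eq_derive _ _ _ _ (\sum_i \sum_j (fun y => (a t 0 i * b t 0 j) *: Gam i j y))); last first.
    near=> y; rewrite fct_sumE christoffelE; last by near: y.
    by apply: eq_bigr => i _; rewrite fct_sumE.
  rewrite derive_sum; last first.
    move=> i; apply: derivable_sum => j; apply: derivableZ; exact: diff_derivable.
  apply: eq_bigr => i _; rewrite derive_sum; last first.
    move=> j; apply: derivableZ; exact: diff_derivable.
  apply: eq_bigr => j _; rewrite deriveZ; last exact: diff_derivable.
  by rewrite deriveE.
rewrite (christoffelE da)// (christoffelE (a t) db)// -!big_split; apply: eq_bigr => i _ /=.
rewrite -!big_split; apply: eq_bigr => j _ /=.
by rewrite scalerDl addrA.
Unshelve. all: by end_near. Qed.

(** The geodesic spray in coordinates, which turns the geodesic equation into a first-order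
    autonomous system. *)
Definition geodesic_field (p : 'rV[R]_n * 'rV[R]_n) : 'rV[R]_n * 'rV[R]_n :=
  (p.2, - christoffel G p.1 p.2 p.2).

Lemma geodesic_field_strictly_diff p : U p.1 -> strictly_diff geodesic_field p.
Proof.
move=> Up.
apply: (proj1 (strictly_diff_pair (proj1 (strictly_diff_snd p)) _)).
have [s1 _] := strictly_diff_fst p; have [s2 _] := strictly_diff_snd p.
pose Gam i j x := christoffel G x (delta_mx 0 i) (delta_mx 0 j).
pose g (q : 'rV[R]_n * 'rV[R]_n) :=
  \sum_i \sum_j (q.2 0 i * q.2 0 j) *: Gam i j q.1.
apply: (@strictly_diff_near_eq _ _ _ (fun q => (-1) *: g q)).
  have nU : \forall y \near p.1, U y by exact: open_nbhs_nbhs.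
  have nUp : \forall q \near p, U q.1 by case: p nU {Up s1 s2} => p1 p2 /=; exact: near_fst.
  near=> q; rewrite scaleN1r /g -christoffelE//.
  by near: q.
apply: strictly_diffZr; apply: strictly_diff_sum => i _; apply: strictly_diff_sum => j _.
apply: strictly_diff_scale_mx.
  exact: (strictly_diffM (strictly_diff_coord 0 i s2) (strictly_diff_coord 0 j s2)).
exact: (proj1 (strictly_diff_comp s1 (christoffel_strictly_diff _ _ Up))).
Unshelve. all: by end_near. Qed.

(** Read off along the line p + s (J, K), where the derivative of the field is computed in two ways.
    The two mixed terms merge into the factor 2 by symmetry of [christoffel]. *)
Lemma geodesic_field_diff p J K : U p.1 -> 'd geodesic_field p (J, K) =
  (K, - ('D_J (fun x => christoffel G x p.2 p.2) p.1 + 2 *: christoffel G p.1 p.2 K)).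
Proof.
move=> Up; have [dp _] := geodesic_field_strictly_diff Up.
pose c (s : R) := (p.1 + s *: J, p.2 + s *: K).
have c0 : c 0 = p by rewrite /c !scale0r !addr0; case: (p).
have d1 : is_derive (0 : R) 1 (fun s : R => p.1 + s *: J) J := is_derive_affine _ _ _.
have d2 : is_derive (0 : R) 1 (fun s : R => p.2 + s *: K) K := is_derive_affine _ _ _.
have dc : is_derive (0 : R) 1 c (J, K) := is_derive_pair d1 d2.
have dp' : differentiable geodesic_field (c 0) by rewrite c0.
have h1 := is_derive_chain dp' dc; rewrite c0 in h1.
have Uc : U (p.1 + (0 : R) *: J) by rewrite scale0r addr0.
have h2 := is_derive_christoffel Uc d1 d2 d2.
have h3 := is_derive_pair d2 (is_deriveN h2).
rewrite (is_derive_unique h1 h3) !scale0r !addr0.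
rewrite (christoffelC K)// -addrA -mulr2n -scaler_nat.
by [].
Qed.

Lemma is_derive_form (c a b : R -> 'rV[R]_n) t dc da db : U (c t) ->
  is_derive t 1 c dc -> is_derive t 1 a da -> is_derive t 1 b db ->
  is_derive t 1 (fun s => form (G (c s)) (a s) (b s))
    (form (G (c t)) (da + christoffel G (c t) dc (a t)) (b t) +
     form (G (c t)) (a t) (db + christoffel G (c t) dc (b t))).
Proof.
move=> Ut hc /is_derive_mxP ha /is_derive_mxP hb.
have hG : is_derive t 1 (G \o c) ('D_dc G (c t)).
  by rewrite deriveE; [apply: is_derive_chain => //|]; exact: diffG.
move: hG => /is_derive_mxP hG.
have E : is_derive t 1 (\sum_i \sum_j (fun s => a s 0 i * G (c s) i j * b s 0 j))
  (\sum_i \sum_j ((da 0 i * G (c t) i j + a t 0 i * 'D_dc G (c t) i j) * b t 0 j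
    + a t 0 i * G (c t) i j * db 0 j)).
  apply: is_derive_sum => i; apply: is_derive_sum => j.
  exact: (is_derive_mulr (is_derive_mulr (ha 0 i) (hG i j)) (hb 0 j)).
have -> : (fun s => form (G (c s)) (a s) (b s)) =
  (\sum_i \sum_j (fun s => a s 0 i * G (c s) i j * b s 0 j)).
  apply/funext => s; rewrite formE fct_sumE; apply: eq_bigr => i _.
  by rewrite fct_sumE.
move: E; congr (is_derive _ _ _ _).
rewrite formD formDr addrACA addrA -addrA -metric_compat// !formE -!big_split.
apply: eq_bigr => i _ /=; rewrite -!big_split; apply: eq_bigr => j _ /=; ring.
Qed.

Lemma curvatureE x u v w : U x -> curvature G x u v w =
  'D_u (fun y => christoffel G y v w) x + christoffel G x u (christoffel G x v w)
  - ('D_v (fun y => christoffel G y u w) x + christoffel G x v (christoffel G x u w)).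
Proof.
move=> Ux; rewrite /curvature /covariant_derivative.
have E z : (fun y => 'D_z (cst w) y + christoffel G y z w) = fun y => christoffel G y z w.
  by apply/funext => y; rewrite derive_cst add0r.
by rewrite /cst /= !E !derive_cst !add0r.
Qed.

(** For independent vectors the positive Gram determinant is cleared from the sectional curvature.
    For dependent ones the curvature itself vanishes, by antisymmetry in its first two arguments. *)
Lemma curvature_form_le0 x u v : U x ->
  (forall u v, row_free (col_mx u v) -> sectional_curvature G x u v <= 0) ->
  form (G x) (curvature G x u v v) u <= 0.
Proof.
move=> Ux sec.
have [uvf|uvf] := boolP (row_free (col_mx u v)).
  have := sec u v uvf; rewrite /sectional_curvature.
  have den := gram_det_gt0 (symG Ux) (fun u => @posG x u Ux) uvf.
  by rewrite pmulr_lle0// invr_gt0.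
suff -> : curvature G x u v v = 0 by rewrite form0.
have Z w : christoffel G x 0 w = 0.
  by have := @christoffelZl x 0 0 w Ux; rewrite !scale0r.
have Z' w : christoffel G x w 0 = 0 by rewrite christoffelC.
have nU : \forall y \near x, U y by exact: open_nbhs_nbhs.
have par k : curvature G x (k *: v) v v = 0.
  rewrite curvatureE//.
  have -> : 'D_(k *: v) (fun y => christoffel G y v v) x =
     k *: 'D_v (fun y => christoffel G y v v) x.
    by rewrite !deriveE ?linearZ//; exact: (proj1 (christoffel_strictly_diff _ _ Ux)).
  have -> : 'D_v (fun y => christoffel G y (k *: v) v) x =
     k *: 'D_v (fun y => christoffel G y v v) x.
    rewrite (@near_eq_derive _ _ _ _ (k *: (fun y => christoffel G y v v))); last first.
      by near=> y; rewrite christoffelZl//; near: y.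
    rewrite deriveZ//; apply: diff_derivable.
    exact: (proj1 (christoffel_strictly_diff _ _ Ux)).
  by rewrite !christoffelZl// christoffelZr// subrr.
have [v0|v0] := eqVneq v 0.
  rewrite v0 curvatureE// !Z' derive0 !addr0 subr0.
  have -> : 'D_u (fun y => christoffel G y 0 0) x = 'D_u (cst 0) x.
    apply: near_eq_derive; near=> y.
    have Uy : U y by near: y.
    by have := @christoffelZl y 0 0 0 Uy; rewrite !scale0r.
  by rewrite derive_cst.
move: uvf; rewrite -kermx_eq0 => /rowV0Pn[w /sub_kermxP].
rewrite -(hsubmxK w) mul_row_col.
rewrite [lsubmx w]mx11_scalar [rsubmx w]mx11_scalar !mul_scalar_mx.
set a := lsubmx w 0 0; set b := rsubmx w 0 0 => h w0.
have a0 : a != 0.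
  apply: contra_neq w0 => a0; move: h; rewrite a0 scale0r add0r => /eqP.
  by rewrite scaler_eq0 (negbTE v0) orbF => /eqP ->; rewrite (_ : 0%:M = 0) ?row_mx0// raddf0.
have -> : u = (- (a^-1 * b)) *: v.
  rewrite scaleNr -scalerA -[u in LHS](scalerK a0) -scalerN; congr (_ *: _).
  by apply/eqP; rewrite -addr_eq0 h.
exact: par.
Unshelve. all: by end_near. Qed.

(** The linearised geodesic equation for (J, K), rewritten for the covariant derivative K + Gamma(T,
    J), is the Jacobi equation. The ordinary derivative [B'] depends on the chart and only its
    covariant completion is meaningful, hence the existential. *)
Lemma jacobi_derive (c T J K : R -> 'rV[R]_n) t : U (c t) ->
  is_derive t 1 c (T t) -> is_derive t 1 T (- christoffel G (c t) (T t) (T t)) ->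
  is_derive t 1 J (K t) ->
  is_derive t 1 K (- ('D_(J t) (fun x => christoffel G x (T t) (T t)) (c t) +
                      2 *: christoffel G (c t) (T t) (K t))) ->
  exists2 B', is_derive t 1 (fun s => K s + christoffel G (c s) (T s) (J s)) B' &
    B' + christoffel G (c t) (T t) (K t + christoffel G (c t) (T t) (J t)) =
    - curvature G (c t) (J t) (T t) (T t).
Proof.
move=> Ut hc hT hJ hK.
have h := is_deriveD hK (is_derive_christoffel Ut hc hT hJ).
eexists; first exact: h.
have nU : \forall y \near c t, U y by exact: open_nbhs_nbhs.
rewrite curvatureE//.
have -> : 'D_(T t) (fun y => christoffel G y (J t) (T t)) (c t) =
   'D_(T t) (fun y => christoffel G y (T t) (J t)) (c t).
  by apply: near_eq_derive; near=> y; rewrite christoffelC//; near: y.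
rewrite christoffelDr// (christoffelC (J t))// (christoffelC (J t) (T t))//.
rewrite -(scaleN1r (christoffel G (c t) (T t) (T t))) christoffelZl//.
move: ('D_(J t) _ _) ('D_(T t) _ _) (christoffel G (c t) (T t) (K t))
  (christoffel G (c t) (christoffel _ _ _ _) (J t)) (christoffel G (c t) (T t) (christoffel _ _ _ _)).
move=> p q r s u; apply/matrixP => i j; rewrite !mxE; ring.
Unshelve. all: by end_near. Qed.
End Coordinates.

Opaque christoffel.

Lemma derivable_is_derive1 (R : realType) (V : normedModType R) (f : R -> V) (t : R) :
  derivable f t 1 -> is_derive t 1 f (derive1 f t).
Proof. by move=> df; rewrite derive1E; exact: derivableP. Qed.

(** * The geodesic flow *)

Section Charts.
Context (R : realType) (n : nat) (T : topologicalType).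
Implicit Types c d : chart R n T.

Lemma chart_imgP c x : chart_dom c x -> chart_img c (c x).
Proof. by move=> cx; exists x. Qed.

Lemma chart_inv_dom c y : chart_img c y -> chart_dom c (chart_inv c y) /\ c (chart_inv c y) = y.
Proof. by move=> [x cx <-]; rewrite chart_funK. Qed.

Lemma chart_inj c x y : chart_dom c x -> chart_dom c y -> c x = c y -> x = y.
Proof. by move=> cx cy e; rewrite -(chart_funK cx) e chart_funK. Qed.

Lemma chart_continuous c x : chart_dom c x -> {for x, continuous c}.
Proof.
move=> cx; have := @chart_fun_continuous _ _ _ c.
rewrite continuous_open_subspace; last exact: chart_dom_open.
by apply; rewrite inE.
Qed.

Lemma chart_inv_cont c y : chart_img c y -> {for y, continuous (chart_inv c)}.
Proof.
move=> cy; have := @chart_inv_continuous _ _ _ c.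
rewrite continuous_open_subspace; last exact: chart_img_open.
by apply; rewrite inE.
Qed.

Lemma chart_dom_nbhs c x : chart_dom c x -> \forall y \near x, chart_dom c y.
Proof. by move=> cx; apply: open_nbhs_nbhs; split => //; exact: chart_dom_open. Qed.

Lemma chart_img_nbhs c y : chart_img c y -> \forall z \near y, chart_img c z.
Proof. by move=> cy; apply: open_nbhs_nbhs; split => //; exact: chart_img_open. Qed.

Lemma chart_image_open c (A : set T) : open A -> open (c @` (chart_dom c `&` A)).
Proof.
move=> oA; rewrite openE => _ [x [cx Ax] <-].
have cy := chart_imgP cx.
have h1 := chart_img_nbhs cy.
have h2 : \forall z \near c x, A (chart_inv c z).
  have := chart_inv_cont cy; apply; rewrite chart_funK//.
  exact: open_nbhs_nbhs.
rewrite /interior; near=> z.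
have /chart_inv_dom[dz ez] : chart_img c z by near: z.
exists (chart_inv c z) => //; split => //.
by near: z.
Unshelve. all: by end_near. Qed.

Definition transition c d : 'rV[R]_n -> 'rV[R]_n := d \o chart_inv c.

Definition transition_dom c d := c @` (chart_dom c `&` chart_dom d).

Lemma transition_dom_open c d : open (transition_dom c d).
Proof. exact: chart_image_open (chart_dom_open d). Qed.

Lemma transition_domP c d x : chart_dom c x -> chart_dom d x -> transition_dom c d (c x).
Proof. by move=> cx dx; exists x. Qed.

Lemma transitionE c d x : chart_dom c x -> transition c d (c x) = d x.
Proof. by move=> cx; rewrite /transition /= chart_funK. Qed.

(** The change of charts on the tangent bundle, by which positions and velocities transform
    together. *)
Definition tangent_transition c d (p : 'rV[R]_n * 'rV[R]_n) : 'rV[R]_n * 'rV[R]_n :=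
  (transition c d p.1, 'd (transition c d) (p.1) (p.2)).

Lemma tangent_transition_strictly_diff c d p :
  smooth_on (transition_dom c d) (transition c d) -> transition_dom c d p.1 ->
  strictly_diff (tangent_transition c d) p /\
  forall h, ('d (tangent_transition c d) p h).1 = 'd (transition c d) (p.1) (h.1).
Proof.
move=> sm Vp; have oV := @transition_dom_open c d.
have [s1 e1] := strictly_diff_fst p; have [s2 _] := strictly_diff_snd p.
have [sf ef] := strictly_diff_comp s1 (smooth_strictly_diff oV sm Vp).
have sg : strictly_diff (fun q : 'rV[R]_n * 'rV[R]_n => 'd (transition c d) (q.1) (q.2)) p.
  apply: (@strictly_diff_near_eq _ _ _ (fun q : 'rV[R]_n * 'rV[R]_n => \sum_i q.2 0 i *: partial i (transition c d) q.1)).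
    have nV : \forall y \near p.1, transition_dom c d y by exact: open_nbhs_nbhs.
    have nVp : \forall q \near p, transition_dom c d q.1.
      by case: p nV {Vp s1 s2 e1 sf ef} => p1 p2 /=; exact: near_fst.
    near=> q; have Vq : transition_dom c d q.1 by near: q.
    rewrite linfunE; apply: eq_bigr => i _.
    by rewrite /partial deriveE//; exact: (smooth_on_diff sm Vq).
  apply: strictly_diff_sum => i _.
  apply: (strictly_diff_scale_mx (strictly_diff_coord 0 i s2)).
  exact: (proj1 (strictly_diff_comp s1 (smooth_strictly_diff oV (smooth_on_partial i sm) Vp))).
have [sfg efg] := strictly_diff_pair sf sg.
split; first exact: sfg.
by move=> h; rewrite efg /= ef e1.
Unshelve. all: by end_near. Qed.
End Charts.

Section State.
Context (R : realType) (n : nat) (N : manifold R n) (g : riemannian_metric N).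

Definition state (d : chart R n N) (gamma : R -> N) (t : R) : 'rV[R]_n * 'rV[R]_n :=
  (d (gamma t), derive1 (d \o gamma) t).

Lemma state_derive d gamma t : atlas d -> is_geodesic g gamma -> chart_dom d (gamma t) ->
  is_derive t 1 (state d gamma) (geodesic_field (g d) (state d gamma t)).
Proof.
move=> ad [cg geo] dt; have [d1 d2 e] := geo d t ad dt.
have h1 : is_derive t 1 (d \o gamma) (derive1 (d \o gamma) t).
  exact: derivable_is_derive1.
have h2 : is_derive t 1 (derive1 (d \o gamma)) (- christoffel (g d) (d (gamma t)) (derive1 (d \o gamma) t) (derive1 (d \o gamma) t)).
  apply: DeriveDef; first exact: d2.
  by rewrite -derive1E; apply/eqP; rewrite -addr_eq0 e.
exact: (is_derive_pair h1 h2).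
Qed.

Lemma state_continuous d gamma t : atlas d -> is_geodesic g gamma -> chart_dom d (gamma t) ->
  {for t, continuous (state d gamma)}.
Proof.
by move=> ad ge dt; have [/derivable1_diffP/differentiable_continuous] := state_derive ad ge dt.
Qed.

Lemma geodesic_dom_near (d : chart R n N) gamma t : is_geodesic g gamma -> chart_dom d (gamma t) ->
  \forall s \near t, chart_dom d (gamma s).
Proof. by move=> [cg _] dt; exact: (cg t _ (chart_dom_nbhs dt)). Qed.

Lemma state_transition c d gamma t : atlas c -> atlas d -> is_geodesic g gamma ->
  chart_dom c (gamma t) -> chart_dom d (gamma t) ->
  state d gamma t = tangent_transition c d (state c gamma t).
Proof.
move=> ac ad ge ct dt; rewrite /state /tangent_transition /= transitionE//; congr (_, _).
have [cg geo] := ge; have [d1 _ _] := geo c t ac ct.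
have sm := atlas_compatible ac ad.
have dpsi : differentiable (transition c d) (c (gamma t)).
  exact: (smooth_on_diff sm (transition_domP ct dt)).
have h1 : is_derive t 1 (c \o gamma) (derive1 (c \o gamma) t).
  exact: derivable_is_derive1.
have h2 := is_derive_chain dpsi h1.
have [_ <-] : is_derive t 1 (d \o gamma) ('d (transition c d) (c (gamma t)) (derive1 (c \o gamma) t)).
  apply: near_eq_is_derive h2.
  have := geodesic_dom_near ge ct => nc.
  near=> s; rewrite /= transitionE//; near: s.
  exact: nc.
by rewrite derive1E.
Unshelve. all: by end_near. Qed.

Lemma metric_form_transition c d x u v : atlas c -> atlas d ->
  chart_dom c x -> chart_dom d x ->
  form (g c (c x)) u v =
  form (g d (d x)) ('d (transition c d) (c x) u) ('d (transition c d) (c x) v).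
Proof.
move=> ac ad cx dx; have := metric_compatible g ac ad cx dx => /= ->.
have dpsi : differentiable (transition c d) (c x).
  exact: (smooth_on_diff (atlas_compatible ac ad) (transition_domP cx dx)).
have JE w : 'd (transition c d) (c x) w = w *m 'J (d \o chart_inv c) (c x).
  by rewrite /jacobian mul_rV_lin1.
Transparent form.
by rewrite /form !JE trmx_mul !mulmxA.
Opaque form.
Qed.
End State.

(** * Differentiable dependence of geodesics on their initial velocity *)

Lemma dist_le_add (R : realType) (W : normedModType R) (x y z : W) (a b c : R) :
  `|x - y| <= a -> `|y - z| <= b -> a + b <= c -> `|x - z| <= c.
Proof.
move=> h1 h2 h3; apply: le_trans h3; apply: le_trans (ler_distD y x z) _.
exact: lerD.
Qed.

Lemma gronwall_diff (R : realType) (W : normedModType R) (x y dx dy : R -> W)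
    (a b c L : R) :
  a <= c <= b -> 0 <= L -> L * (b - a) <= 2^-1 ->
  (forall t, a <= t <= b -> is_derive t 1 x (dx t)) ->
  (forall t, a <= t <= b -> is_derive t 1 y (dy t)) ->
  (forall t, a <= t <= b -> `|dx t - dy t| <= L * `|x t - y t|) ->
  forall t, a <= t <= b -> `|x t - y t| <= 2 * `|x c - y c|.
Proof.
move=> acb L0 Lab hx hy hL t tab.
have := @gronwall_short _ _ (x - y) a b c L 0 acb L0 (lexx 0) Lab _ t tab.
rewrite mulr0 addr0; apply=> s sab.
have [d1 d2] := is_deriveB (hx s sab) (hy s sab).
by split; [exact: d1|rewrite d2 addr0; exact: hL].
Qed.

Lemma near_eq_diff (R : realType) (V W : normedModType R) (f h : V -> W) a :
  (\near a, f a = h a) -> differentiable f a -> differentiable h a ->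
  forall u, 'd f a u = 'd h a u.
Proof. by move=> fh df dh u; rewrite -!deriveE//; exact: near_eq_derive. Qed.

Lemma diff_lip_bound (R : realType) (V W : normedModType R) (f : V -> W) x (k : R) :
  differentiable f x -> (\forall y \near x, `|f y - f x| <= k * `|y - x|) ->
  forall h, `|'d f x h| <= k * `|h|.
Proof.
move=> df fk h.
have cv : `|s^-1 *: (f (s *: h + x) - f x)| @[s --> 0^'] --> `|'d f x h|.
  by apply: cvg_norm; rewrite -deriveE//; exact: diff_derivable.
have lk : \forall s \near (0 : R), `|f (s *: h + x) - f x| <= k * `|s *: h + x - x|.
  have h1 : {for 0, continuous (fun s : R => s *: h + x)}.
    by apply: continuousD; [exact: scalel_continuous|exact: cst_continuous].
  have H : \forall y \near (0 : R) *: h + x, `|f y - f x| <= k * `|y - x|.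
    by rewrite scale0r add0r.
  exact: h1 H.
have {}lk : \forall s \near 0^', `|f (s *: h + x) - f x| <= k * `|s *: h + x - x|.
  exact: cvg_within.
apply: ler_cvg_to cv (cvg_cst _) _; near=> s.
have s0 : s != 0 by near: s; exact: nbhs_dnbhs_neq.
rewrite normrZ normfV mulrC ler_pdivrMr ?normr_gt0//.
have : `|f (s *: h + x) - f x| <= k * `|s *: h + x - x| by near: s.
by rewrite addrK normrZ -mulrA (mulrC `|h|).
Unshelve. all: by end_near. Qed.

(** The coordinate ball is compact, so its image is closed in a Hausdorff space: a curve whose
    coordinates stay in the ball cannot leave the chart in the limit. *)
Lemma chart_closed_ball (R : realType) n (T : topologicalType) (d : chart R n T) y0 :
  hausdorff_space T -> chart_img d y0 ->
  exists2 r, 0 < r & (forall y, `|y - y0| <= r -> chart_img d y) /\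
    closed (chart_inv d @` [set y | `|y - y0| <= r]).
Proof.
move=> hT dy; have /nbhs_ballP[r /= r0 Hr] := chart_img_nbhs dy.
have r20 : 0 < r / 2 by rewrite divr_gt0.
have sub y : `|y - y0| <= r / 2 -> chart_img d y.
  by move=> h; apply: Hr; rewrite -ball_normE /= distrC; lra.
exists (r / 2) => //; split => //.
apply: compact_closed => //; apply: continuous_compact.
  apply: continuous_subspaceW (@chart_inv_continuous _ _ _ d).
  by move=> y /sub.
have -> : [set y | `|y - y0| <= r / 2] = closed_ball_ (fun x => `|x|) y0 (r / 2).
  by apply/seteqP; split => x; rewrite /closed_ball_ /= distrC.
apply: bounded_closed_compact; last exact: closed_closed_ball_.
exists (r / 2 + `|y0|); split; first exact: num_real.
move=> M hM y; rewrite /closed_ball_ /= distrC => hy.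
have := ler_normD (y - y0) y0; rewrite subrK => h1; apply: ltW.
by apply: le_lt_trans h1 _; lra.
Qed.

(** Serves to extend a symmetric time interval past both ends at once. *)
Lemma dist_endpoint (R : realType) (h h' m t rho s : R) : m <= h -> m <= h' ->
  0 < m -> rho < `|s - t| -> `|s - t| <= rho + m / 2 ->
  `|t + rho - s| < h \/ `|t - rho - s| < h'.
Proof.
have [ts|st] := leP t s.
  by rewrite ger0_norm ?subr_ge0// => *; left; rewrite ltr_norml; lra.
by rewrite ltr0_norm ?subr_lt0// => *; right; rewrite ltr_norml; lra.
Qed.

(* The tangent bundle of a chart, as one normed space; the name keeps unification
   from comparing the two ways a product inherits its algebraic structure. *)
Definition phase (R : realType) (n : nat) : normedModType R := ('rV[R]_n * 'rV[R]_n)%type.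

Lemma phase_complete (R : realType) (n : nat) : dir_complete (phase R n).
Proof.
apply: (@dir_complete_pair R 'rV[R]_n 'rV[R]_n);
  exact: (@dir_complete_complete R (HB.pack_for (completeNormedModType R) 'rV[R]_n)).
Qed.

Section Flow.
Context (R : realType) (n : nat) (N : manifold R n) (g : riemannian_metric N)
  (gam : 'rV[R]_n -> R -> N).
Hypothesis geo : forall v, is_geodesic g (gam v).

(** Chart maps are total, so differentiability of the state alone would say nothing about geodesics
    outside the chart; hence the condition that the neighbouring geodesics are inside at time
    [t]. *)
Definition regular_at v0 d t : Prop := [/\ atlas d, chart_dom d (gam v0 t),
  \forall v \near v0, chart_dom d (gam v t) &
  strictly_diff (fun v => state d (gam v) t) v0].

Lemma regular_transition v0 c d t : regular_at v0 c t -> atlas d ->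
  chart_dom d (gam v0 t) -> regular_at v0 d t /\
  forall h, ('d (fun v => state d (gam v) t) v0 h).1 =
    'd (transition c d) (c (gam v0 t)) ('d (fun v => state c (gam v) t) v0 h).1.
Proof.
move=> [ac ct nc sc] ad dt.
have nV : \forall v \near v0, transition_dom c d (c (gam v t)).
  have cst : {for v0, continuous (fun v => c (gam v t))}.
    have [df _] := proj1 (strictly_diff_comp sc (proj1 (strictly_diff_fst _))).
    exact: (differentiable_continuous df).
  have := cst _ (open_nbhs_nbhs (conj (@transition_dom_open _ _ _ c d) (transition_domP ct dt))).
  exact.
have nd : \forall v \near v0, chart_dom d (gam v t).
  near=> v.
  have cv : chart_dom c (gam v t) by near: v.
  have [x [cx dx] e] : transition_dom c d (c (gam v t)) by near: v.
  by rewrite -(chart_inj cx cv e).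
have sm := atlas_compatible ac ad.
have [sT eT] := @tangent_transition_strictly_diff _ _ _ c d (state c (gam v0) t) sm (transition_domP ct dt).
have [sS eS] := strictly_diff_comp sc sT.
have E : \forall v \near v0, (tangent_transition c d \o (fun v => state c (gam v) t)) v = state d (gam v) t.
  near=> v; rewrite /= -(state_transition ac ad (geo v))//; near: v; [exact: nc|exact: nd].
have sD := strictly_diff_near_eq E sS.
split; first by split.
move=> h; have [[dTS _] [dD _]] := (sS, sD).
exact: (etrans (congr1 fst (esym (near_eq_diff E dTS dD h)))
  (etrans (congr1 (fun L => (L h).1) eS) (eT _))).
Unshelve. all: by end_near. Qed.

Let Sd d t v : phase R n := state d (gam v) t.

Let Fd d : phase R n -> phase R n := geodesic_field (g d).

Let dSd d t v : atlas d -> chart_dom d (gam v t) ->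
  is_derive t 1 (fun s => Sd d s v) (Fd d (Sd d t v)).
Proof. by move=> ad dt; exact: state_derive. Qed.

Let cSd d t v : atlas d -> chart_dom d (gam v t) ->
  {for t, continuous (fun s => Sd d s v)}.
Proof. by move=> ad dt; have [/derivable1_diffP/differentiable_continuous] := dSd ad dt. Qed.

Lemma chart_field_strictly_diff (d : chart R n N) (p : 'rV[R]_n * 'rV[R]_n) : atlas d ->
  chart_img d p.1 -> strictly_diff (geodesic_field (g d)) p.
Proof.
move=> ad dp; apply: (@geodesic_field_strictly_diff _ _ (g d) (chart_img d)) => //.
- exact: chart_img_open.
- exact: metric_smooth.
- by move=> y dy; exact: metric_sym.
- by move=> y u dy; exact: metric_pos.
Qed.

(* As long as two solutions stay in the chart, their distance at most doubles;
   hence the set of radii [rho] up to which they stay is open and closed. *)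
Lemma stay_in_chart v0 d t0 : atlas d -> chart_dom d (gam v0 t0) ->
  forall e, 0 < e -> exists2 L, 0 < L & exists2 r, 0 < r & exists2 del, 0 < del &
   [/\ r <= e, L * (6 * del) <= 2^-1,
     (forall x y : phase R n, `|x - Sd d t0 v0| <= r -> `|y - Sd d t0 v0| <= r ->
       `|Fd d x - Fd d y| <= L * `|x - y|) &
     forall v t1, `|t1 - t0| < del -> chart_dom d (gam v t1) ->
      `|Sd d t1 v - Sd d t1 v0| <= r / 12 ->
      forall t, `|t - t1| <= 2 * del ->
        [/\ chart_dom d (gam v t), `|Sd d t v - Sd d t0 v0| < r & chart_dom d (gam v0 t)]].
Proof.
move=> ad dt0 e e0.
have [k k0 Lk] := @strictly_diff_lip R (phase R n) (phase R n) (Fd d) _ (chart_field_strictly_diff (p := Sd d t0 v0) ad (chart_imgP dt0)).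
have [[A B] [/= An Bn] AB] := Lk.
have /nbhs_ballP[r1 /= r10 Hr1] : nbhs (Sd d t0 v0) (A `&` B) by exact: filterI.
have [r2 r20 [r2img r2cl]] := chart_closed_ball (@manifold_hausdorff _ _ N) (chart_imgP dt0).
(* [r1] is a radius of Lipschitz control and [r2] that of a closed ball inside the chart. A distance
   r / 12 at time [t1] doubles to r / 6, strictly below the r / 3 of [good]; another r / 3 for the
   base geodesic keeps everything within [r]. *)
pose r := Num.min (r1 / 2) (Num.min r2 e).
have r0 : 0 < r by rewrite /r !lt_min r20 e0 divr_gt0.
have [q1 q2 q3 q4] : [/\ r / 3 + r / 3 <= r, r / 3 <= r, 2 * (r / 12) <= r / 6 & r / 6 <= r / 3] by split; lra.
have [q5 q6 q7 q8] : [/\ r / 6 < r / 3, r / 3 + r / 3 < r, r / 12 <= r / 3 & 0 <= r / 12] by split; lra.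
have rr1 : r < r1 by rewrite /r gt_min; apply/orP; left; lra.
have rr2 : r <= r2 by rewrite /r !ge_min lexx !orbT.
have re : r <= e by rewrite /r !ge_min lexx !orbT.
have Lip (x y : phase R n) : `|x - Sd d t0 v0| <= r -> `|y - Sd d t0 v0| <= r ->
    `|Fd d x - Fd d y| <= k * `|x - y|.
  move=> xr yr; apply: (AB (x, y)); split => /=.
    have [] // : (A `&` B) x by apply: Hr1; rewrite -ball_normE /= distrC; lra.
  have [] // : (A `&` B) y by apply: Hr1; rewrite -ball_normE /= distrC; lra.
have cS := state_continuous ad (geo v0) dt0.
have : \forall t \near t0, chart_dom d (gam v0 t) /\ `|Sd d t v0 - Sd d t0 v0| <= r / 3.
  have h1 := geodesic_dom_near (geo v0) dt0.
  have h2 : \forall t \near t0, `|state d (gam v0) t0 - state d (gam v0) t| <= r / 3.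
    by move/cvgrPdist_le : cS; apply; rewrite divr_gt0.
  by near=> t; split; [near: t|rewrite distrC; near: t].
move=> /nbhs_ballP[d1 /= d10 Hd1].
(* The bound d1 / 6 keeps times up to 3 del in the window of the base geodesic; 1 / (12 k) makes a
   length of 6 del short enough for Grönwall. *)
pose del := Num.min (d1 / 6) (12 * k)^-1.
have del0 : 0 < del by rewrite /del lt_min divr_gt0//= invr_gt0 mulr_gt0.
have d6 : 2 * (2 * del) <= 6 * del by lra.
have deld1 : 3 * del < d1.
  have : del <= d1 / 6 by rewrite /del ge_min lexx.
  lra.
have kdel : k * (6 * del) <= 2^-1.
  have h : del <= (12 * k)^-1 by rewrite /del ge_min lexx orbT.
  apply: (@le_trans _ _ (k * (6 * (12 * k)^-1))).
    by apply: ler_wpM2l; [exact: ltW|apply: ler_wpM2l].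
  by rewrite le_eqVlt; apply/orP; left; apply/eqP; field; rewrite gt_eqF.
have base t : `|t - t0| <= 3 * del -> chart_dom d (gam v0 t) /\ `|Sd d t v0 - Sd d t0 v0| <= r / 3.
  by move=> h; apply: Hd1; rewrite -ball_normE /= distrC; exact: le_lt_trans deld1.
exists k => //; exists r => //; exists del => //; split => // v t1 t1d dt1 D1.
pose good t := chart_dom d (gam v t) /\ `|Sd d t v - Sd d t v0| <= r / 3.
have near_t t : `|t - t1| <= 2 * del -> `|t - t0| <= 3 * del.
  by move=> h; apply: (dist_le_add h (ltW t1d)); have -> : 3 * del = 2 * del + del by ring.
have est rho : 0 <= rho -> rho <= 2 * del -> (forall s, `|s - t1| <= rho -> good s) ->
    forall s, `|s - t1| <= rho -> `|Sd d s v - Sd d s v0| <= r / 6.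
  move=> rho0 rhod G s sr.
  have g1 : t1 - rho <= t1 <= t1 + rho by rewrite gerBl lerDl rho0.
  have g2 : k * (t1 + rho - (t1 - rho)) <= 2^-1.
    apply: le_trans kdel; apply: ler_wpM2l; first exact: ltW.
    have -> : t1 + rho - (t1 - rho) = 2 * rho by ring.
    by apply: le_trans d6; rewrite ler_wpM2l.
  have g4 : t1 - rho <= s <= t1 + rho by rewrite -ler_distl.
  have ut u : t1 - rho <= u <= t1 + rho -> `|u - t1| <= rho by rewrite -ler_distl.
  have gv u : t1 - rho <= u <= t1 + rho ->
      is_derive u 1 (fun s => Sd d s v) (Fd d (Sd d u v)).
    by move=> /ut /G[dv _]; exact: dSd.
  have gv0 u : t1 - rho <= u <= t1 + rho ->
      is_derive u 1 (fun s => Sd d s v0) (Fd d (Sd d u v0)).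
    move=> /ut h; have [dv0 _] := base u (near_t u (le_trans h rhod)); exact: dSd.
  have gL u : t1 - rho <= u <= t1 + rho ->
      `|Fd d (Sd d u v) - Fd d (Sd d u v0)|
        <= k * `|Sd d u v - Sd d u v0|.
    move=> /ut h; have [_ Dv] := G u h.
    have [_ Dv0] := base u (near_t u (le_trans h rhod)).
    have D3 : `|Sd d u v - Sd d t0 v0| <= r.
      exact: (dist_le_add Dv Dv0 q1).
    exact: (Lip _ _ D3 (le_trans Dv0 q2)).
  apply: le_trans (gronwall_diff g1 (ltW k0) g2 gv gv0 gL g4) _.
  by apply: le_trans q3; apply: ler_wpM2l; [exact: ler0n|exact: D1].
have good1 : good t1 by split; [exact: dt1|exact: le_trans D1 q7].
have main : forall s, `|s - t1| <= 2 * del -> good s.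
  apply: (@real_ind _ (fun rho => forall s, `|s - t1| <= rho -> good s)).
  - by rewrite mulr_ge0// ltW.
  - by move=> s t s0 st H u us; apply: H; exact: le_trans st.
  - move=> s; rewrite normr_le0 subr_eq0 => /eqP ->; exact: good1.
  - move=> rho rho0 rhod IH s; rewrite le_eqVlt => /predU1P[sr|sr]; last first.
      by apply: (IH (`|s - t1|)).
    pose w (l : R) := t1 + l * (s - t1).
    have w1 : w 1 = s by rewrite /w mul1r addrC subrK.
    have cw : {for (1 : R), continuous w}.
      apply: continuousD; first exact: cst_continuous.
      by apply: cvgMl; exact: cvg_id.
    have gw l : 0 <= l -> l < 1 -> good (w l) /\ `|Sd d (w l) v - Sd d (w l) v0| <= r / 6.
      move=> l0 l1.
      have wl : `|w l - t1| = l * rho.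
        by rewrite /w addrAC subrr add0r normrM sr ger0_norm.
      have lr : l * rho < rho by rewrite gtr_pMl.
      have G : forall s, `|s - t1| <= l * rho -> good s.
        by apply: IH => //; rewrite mulr_ge0// ltW.
      split; first by apply: G; rewrite wl.
      apply: (est (l * rho)) => //; [by rewrite mulr_ge0// ltW|exact: le_trans (ltW lr) rhod|by rewrite wl].
    have nl : \forall l \near (1 : R)^'-, 0 <= l /\ l < 1.
      near=> l; split; last by near: l; exact: nbhs_left_lt.
      by apply: ltW; near: l; apply: nbhs_left_gt.
    have ds : chart_dom d (gam v s).
      (* Time [s] is approached along the segment from [t1]; the positions on the way lie in a
         closed set contained in the chart domain, so the limit does too. *)
      have cl : (chart_inv d @` [set y | `|y - d (gam v0 t0)| <= r2]) (gam v s).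
        have cg : gam v (w l) @[l --> (1 : R)^'-] --> gam v s.
          apply: cvg_at_left_filter; rewrite -w1.
          apply: (@continuous_comp _ _ _ w (gam v)) => //.
          by have [cg _] := geo v; exact: cg.
        apply: (closed_cvg _ r2cl _ _ cg).
        near=> l.
        have [l0 l1] : 0 <= l /\ l < 1 by near: l.
        have [[dw Dw] _] := gw l l0 l1.
        exists (d (gam v (w l))); last by rewrite chart_funK.
        have wd : `|w l - t1| <= 2 * del.
          rewrite /w addrAC subrr add0r normrM sr ger0_norm//.
          by apply: le_trans rhod; rewrite ger_pMl// ltW.
        have [_ b2] := base _ (near_t _ wd).
        have h2 : `|(Sd d (w l) v - Sd d t0 v0).1| <= `|Sd d (w l) v - Sd d t0 v0|.
          by rewrite [leRHS]prod_normE le_max lexx.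
        by apply: (le_trans h2); apply: le_trans rr2; exact: (dist_le_add Dw b2 q1).
      have [y yr <-] := cl.
      by have [] := chart_inv_dom (r2img y yr).
    split=> //.
    have sd : `|s - t1| <= 2 * del by rewrite sr.
    have [dv0 _] := base _ (near_t _ sd).
    have cS' : `|Sd d (w l) v - Sd d (w l) v0| @[l --> (1 : R)^'-] --> `|Sd d s v - Sd d s v0|.
      have cwl : w l @[l --> (1 : R)^'-] --> s.
        by rewrite -w1; apply: cvg_at_left_filter; exact: cw.
      apply: cvg_norm; apply: cvgB.
        exact: (cvg_comp _ _ cwl (cSd ad ds)).
      exact: (cvg_comp _ _ cwl (cSd ad dv0)).
    apply: le_trans q4.
    apply: ler_cvg_to cS' (cvg_cst _) _; near=> l.
    have [l0 l1] : 0 <= l /\ l < 1 by near: l.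
    by have [_] := gw l l0 l1.
  - move=> rho rho0 rhod G.
    have E := est rho rho0 (ltW rhod) G.
    have op s : `|s - t1| = rho -> \forall u \near s, good u.
      move=> sr; have srl : `|s - t1| <= rho by rewrite sr.
      have [ds _] := G s srl; have Es := E s srl.
      have sd : `|s - t1| <= 2 * del by rewrite sr ltW.
      have [dv0 _] := base _ (near_t _ sd).
      have h1 := geodesic_dom_near (geo v) ds.
      have h2 : `|Sd d u v - Sd d u v0| @[u --> s] --> `|Sd d s v - Sd d s v0|.
        by apply: cvg_norm; apply: cvgB; [exact: (cSd ad ds)|exact: (cSd ad dv0)].
      have h3 : \forall u \near s, `|Sd d u v - Sd d u v0| < r / 3.
        by move/cvgr_lt : h2; apply; exact: le_lt_trans Es q5.
      by near=> u; split; [near: u|apply: ltW; near: u].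
    have e1 : `|t1 + rho - t1| = rho by rewrite addrAC subrr add0r ger0_norm.
    have e2 : `|t1 - rho - t1| = rho by rewrite addrAC subrr add0r normrN ger0_norm.
    have /nbhs_ballP[h1 /= h10 H1] := op _ e1.
    have /nbhs_ballP[h2 /= h20 H2] := op _ e2.
    exists (Num.min h1 h2 / 2); first by rewrite divr_gt0// lt_min h10.
    have m1 : Num.min h1 h2 <= h1 by rewrite ge_min lexx.
    have m2 : Num.min h1 h2 <= h2 by rewrite ge_min lexx orbT.
    have m0 : 0 < Num.min h1 h2 by rewrite lt_min h10.
    move=> s sr; have [s1|s1] := leP `|s - t1| rho; first exact: G.
    case: (dist_endpoint m1 m2 m0 s1 sr) => hs; [apply: H1|apply: H2];
      rewrite -ball_normE; exact: hs.
move=> t tt; have [dv Dv] := main t tt; have [dv0 Dv0] := base _ (near_t _ tt).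
split => //.
by apply: le_lt_trans q6; exact: (dist_le_add Dv Dv0).
Unshelve. all: by end_near. Qed.
End Flow.

Lemma near_dist (R : realType) (W : normedModType R) (x z : W) (r : R) :
  `|x - z| < r -> \forall y \near x, `|y - z| < r.
Proof.
move=> h; have cv : `|y - z| @[y --> x] --> `|x - z|.
  by apply: cvg_norm; apply: cvgB; [exact: cvg_id|exact: cvg_cst].
by move/cvgr_lt : cv; apply.
Qed.

Section FlowRegularity.
Context (R : realType) (n : nat) (N : manifold R n) (g : riemannian_metric N)
  (gam : 'rV[R]_n -> R -> N).
Hypothesis geo : forall v, is_geodesic g (gam v).

Let Sd d t v : phase R n := state d (gam v) t.

Let Fd d : phase R n -> phase R n := geodesic_field (g d).

Let dSd d t v : atlas d -> chart_dom d (gam v t) ->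
  is_derive t 1 (fun s => Sd d s v) (Fd d (Sd d t v)).
Proof. by move=> ad dt; exact: state_derive. Qed.

(** [del] is chosen before [t1], so regularity passes between any two times of the window, as the
    chain argument requires. The regular time [t1] is the reference time of the ODE estimates. *)
Lemma flow_step v0 d t0 : atlas d -> chart_dom d (gam v0 t0) ->
  exists2 del, 0 < del & forall t1, `|t1 - t0| < del -> regular_at gam v0 d t1 ->
    forall t, `|t - t0| < del -> regular_at gam v0 d t /\
      forall h, is_derive t 1 (fun s => 'd (fun v => state d (gam v) s) v0 h)
        ('d (geodesic_field (g d)) (state d (gam v0) t)
           ('d (fun v => state d (gam v) t) v0 h)).
Proof.
move=> ad dt0.
have [L L0 [r r0 [del del0 [_ Ldel Lip stay]]]] := stay_in_chart geo ad dt0 ltr01.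
exists del; first exact: del0.
move=> t1 t1d [_ dt1 nd1 sd1].
have sS : @strictly_diff R 'rV[R]_n (phase R n) (Sd d t1) v0 by exact: sd1.
have cS1 : {for v0, continuous (Sd d t1)} := differentiable_continuous (proj1 sS).
have near_v : \forall v \near v0, chart_dom d (gam v t1) /\ `|Sd d t1 v - Sd d t1 v0| <= r / 12.
  have h : \forall v \near v0, `|Sd d t1 v0 - Sd d t1 v| <= r / 12.
    by move/cvgrPdist_le : cS1; apply; rewrite divr_gt0.
  by near=> v; split; [near: v|rewrite distrC; near: v].
have tt1 t : t0 - del <= t <= t0 + del -> `|t - t1| <= 2 * del.
  move=> /andP[h1 h2]; move: t1d; rewrite ltr_norml => /andP[h3 h4].
  by rewrite ler_norml; apply/andP; split; lra.
have inball : \forall v \near v0, forall t, t0 - del <= t <= t0 + del ->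
    chart_dom d (gam v t) /\ `|Sd d t v - Sd d t0 v0| < r.
  have H : forall v, chart_dom d (gam v t1) /\ `|Sd d t1 v - Sd d t1 v0| <= r / 12 ->
      forall t, t0 - del <= t <= t0 + del ->
      chart_dom d (gam v t) /\ `|Sd d t v - Sd d t0 v0| < r.
    by move=> v [h1 h2] t /tt1 h3; have [] := stay v t1 t1d h1 h2 t h3.
  exact: filterS near_v.
have in0 := nbhs_singleton inball.
pose S v t : phase R n := Sd d t v.
have acb : t0 - del < t1 < t0 + del by rewrite -ltr_distl.
have Lab : L * (t0 + del - (t0 - del)) <= 2^-1.
  apply: le_trans Ldel; apply: ler_wpM2l; first exact: ltW.
  have -> : t0 + del - (t0 - del) = 2 * del by ring.
  by apply: ler_wpM2r; [exact: ltW|rewrite ler_nat].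
have sF t : t0 - del <= t <= t0 + del -> strictly_diff (Fd d) (S v0 t).
  by move=> /in0[h _]; exact: (chart_field_strictly_diff g (p := Sd d t v0) ad (chart_imgP h)).
have dFL t : t0 - del <= t <= t0 + del -> forall h, `|'d (Fd d) (S v0 t) h| <= L * `|h|.
  move=> tab; apply: diff_lip_bound; first by case: (sF t tab).
  have [_ hr] := in0 t tab.
  have nb := near_dist hr; near=> y.
  have hy : `|y - Sd d t0 v0| < r by near: y; exact: nb.
  exact: (Lip _ _ (ltW hy) (ltW hr)).
have dS : \forall v \near v0, forall t, t0 - del <= t <= t0 + del ->
    is_derive t 1 (S v) (Fd d (S v t)).
  have H : forall v, (forall t, t0 - del <= t <= t0 + del ->
    chart_dom d (gam v t) /\ `|Sd d t v - Sd d t0 v0| < r) ->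
    forall t, t0 - del <= t <= t0 + del -> is_derive t 1 (S v) (Fd d (S v t)).
    by move=> v h t /h[dv _]; exact: dSd.
  exact: filterS inball.
have FLp : \forall p \near (v0, v0), forall t, t0 - del <= t <= t0 + del ->
    `|Fd d (S p.1 t) - Fd d (S p.2 t)| <= L * `|S p.1 t - S p.2 t|.
  pose I v := forall t, t0 - del <= t <= t0 + del ->
    chart_dom d (gam v t) /\ `|Sd d t v - Sd d t0 v0| < r.
  have hI : (\forall p \near (v0, v0), I p.1) /\ (\forall p \near (v0, v0), I p.2).
    by split; [exact: (near_fst v0 inball)|exact: (near_snd v0 inball)].
  have {}hI : \forall p \near (v0, v0), I p.1 /\ I p.2.
    by move: I hI => I [h1 h2]; near=> p; split; near: p.
  have H p : I p.1 /\ I p.2 -> forall t, t0 - del <= t <= t0 + del ->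
      `|Fd d (S p.1 t) - Fd d (S p.2 t)| <= L * `|S p.1 t - S p.2 t|.
    move=> [k1 k2] t tab.
    exact: (Lip _ _ (ltW (proj2 (k1 t tab))) (ltW (proj2 (k2 t tab)))).
  exact: filterS hI.
move=> t td.
have tab : t0 - del < t < t0 + del by rewrite -ltr_distl.
have tab' : t0 - del <= t <= t0 + del by case/andP: tab => /ltW -> /ltW ->.
have cX := @phase_complete R n.
split; last first.
  move=> h; exact: (ode_param_variation cX acb (ltW L0) Lab sF dFL dS FLp sS h tab).
split; [exact: ad|by case: (in0 t tab')| |].
  have H : forall v, (forall t, t0 - del <= t <= t0 + del ->
    chart_dom d (gam v t) /\ `|Sd d t v - Sd d t0 v0| < r) -> chart_dom d (gam v t).
    by move=> v /(_ t tab')[].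
  exact: filterS inball.
exact: (ode_param_strictly_diff cX acb (ltW L0) Lab sF dFL dS FLp sS tab).
Unshelve. all: by end_near. Qed.

Hypothesis start : forall v, exists d, regular_at gam v d 0.

Lemma connected_real : connected [set: R].
Proof. by apply/connected_intervalP; move=> x y _ _ z _. Qed.

(** Regularity spreads from time 0 over the connected time line, changing charts on the way. *)
Lemma flow_regular v d t : atlas d -> chart_dom d (gam v t) -> regular_at gam v d t.
Proof.
have H : forall t, exists d, regular_at gam v d t.
  move=> s; apply: (@connected_chain _ [set: R] (fun t => exists d, regular_at gam v d t) 0 connected_real) => // t0 _.
  have [c ac ct0] := atlas_cover (gam v t0).
  have [del del0 step] := flow_step ac ct0.
  have near_dom : \forall s \near t0, chart_dom c (gam v s) := geodesic_dom_near (geo v) ct0.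
  exists [set s | chart_dom c (gam v s) /\ `|s - t0| < del].
    near=> u; split; first by near: u.
    rewrite distrC; near: u; apply: cvgr_dist_lt del0; exact: cvg_id.
  move=> s1 s2 _ _ [c1 h1] [c2 h2] [d1 R1].
  have [R1' _] := regular_transition geo R1 ac c1.
  by exists c; have [] := step s1 h1 R1' s2 h2.
move=> ad dt; have [c Rc] := H t.
by have [] := regular_transition geo Rc ad dt.
Unshelve. all: by end_near. Qed.

Lemma flow_variation v d t h : atlas d -> chart_dom d (gam v t) ->
  is_derive t 1 (fun s => 'd (fun u => state d (gam u) s) v h)
    ('d (geodesic_field (g d)) (state d (gam v) t) ('d (fun u => state d (gam u) t) v h)).
Proof.
move=> ad dt; have [del del0 step] := flow_step ad dt.
have t0 : `|t - t| < del by rewrite subrr normr0.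
by have [_] := step t t0 (flow_regular ad dt) t t0; apply.
Qed.
End FlowRegularity.

(** * Jacobi fields of the exponential map *)

(** The derivative is nondecreasing. The first bound feeds the maximum principle, the second the
    injectivity of dE. *)
Lemma convex_derive_bound (R : realType) (phi phi1 : R -> R) :
  (forall t : R, is_derive t (1 : R) phi (phi1 t)) ->
  (forall t : R, exists2 c, 0 <= c & is_derive t (1 : R) phi1 c) ->
  (forall t, 0 <= phi t) -> phi 0 = 0 ->
  phi 1 <= phi1 1 /\ (phi1 1 <= 0 -> forall t, 0 <= t -> t <= 1 -> phi t = 0).
Proof.
move=> d1 d2 pos p0.
have cphi t : {for t, continuous phi}.
  by have [/derivable1_diffP/differentiable_continuous] := d1 t.
have mono a b : a <= b -> phi1 a <= phi1 b.
  move=> ab; apply: (@ger0_derive1_le_cc _ phi1 a b); rewrite ?in_itv /= ?lexx ?ab//.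
  - by move=> x _; have [c _ []] := d2 x.
  - by move=> x _; have [c c0 [_ E]] := d2 x; rewrite derive1E E.
  - apply: derivable_within_continuous => x _; by have [c _ []] := d2 x.
have mvt a b : a <= b -> exists2 c, a <= c <= b & phi b - phi a = phi1 c * (b - a).
  move=> ab; have [|] := @MVT_segment _ phi phi1 a b ab (fun x _ => d1 x).
    by apply: derivable_within_continuous => x _; case: (d1 x).
  by move=> c; rewrite in_itv; exists c.
split.
  have [c /andP[_ c1]] := mvt 0 1 ler01.
  by rewrite p0 !subr0 mulr1 => ->; exact: mono.
move=> n1 t t0 t1; apply/eqP; rewrite eq_le pos andbT.
have [c /andP[_ ct]] := mvt 0 t t0.
rewrite p0 !subr0 => ->; rewrite mulr_le0_ge0//.
by apply: le_trans n1; apply: mono; exact: le_trans t1.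
Qed.

Lemma right_derive0 (R : realType) (V : normedModType R) (f : R -> V) (df : V) :
  is_derive (0 : R) 1 f df -> (\forall t \near (0 : R)^'+, f t = 0) -> df = 0.
Proof.
move=> h fz; have [d1 e] := h.
have f0 : f 0 = 0.
  have cf : f t @[t --> (0 : R)^'+] --> f 0.
    apply: cvg_at_right_filter.
    by move/derivable1_diffP/differentiable_continuous : d1; apply.
  have c0 : f t @[t --> (0 : R)^'+] --> (0 : V) by apply: cvg_near_cst.
  exact: (cvg_unique (@norm_hausdorff _ _) cf c0).
Transparent derive.
have cd : t^-1 *: (f (t *: 1 + 0) - f 0) @[t --> (0 : R)^'+] --> df.
  by rewrite -e; apply: cvg_dnbhs_at_right; exact: d1.
Opaque derive.
apply: (cvg_unique (@norm_hausdorff _ _) cd); apply: cvg_near_cst.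
near=> t; rewrite f0 [_%:A]mulr1 addr0 subr0.
have -> : f t = 0 by near: t.
by rewrite scaler0.
Unshelve. all: by end_near. Qed.

Section Exponential.
Context (R : realType) (n : nat) (N : manifold R n) (g : riemannian_metric N)
  (gam : 'rV[R]_n -> R -> N) (d0 : chart R n N) (p : N).
Hypothesis geo : forall v, is_geodesic g (gam v).
Hypothesis atlas0 : atlas d0.
Hypothesis dom0 : chart_dom d0 p.
Hypothesis gam0 : forall v, gam v 0 = p.
Hypothesis vel0 : forall v, derive1 (d0 \o gam v) 0 = v.

Let oU (d : chart R n N) : open (chart_img d) := @chart_img_open R n N d.
Let sG (d : chart R n N) (ad : atlas d) : smooth_on (chart_img d) (g d) := metric_smooth g ad.
Let symG (d : chart R n N) (ad : atlas d) y (dy : chart_img d y) : (g d y)^T = g d y :=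
  metric_sym g ad dy.
Let posG (d : chart R n N) (ad : atlas d) y u (dy : chart_img d y) (u0 : u != 0) :
  0 < form (g d y) u u := metric_pos g ad dy u0.

Lemma state_start v : state d0 (gam v) 0 = (d0 p, v).
Proof. by rewrite /state gam0 vel0. Qed.

Lemma state_start_diff v :
  strictly_diff (fun u => state d0 (gam u) 0) v /\
  forall h, 'd (fun u => state d0 (gam u) 0) v h = (0, h).
Proof.
have -> : (fun u => state d0 (gam u) 0) = (fun u => (d0 p, u)).
  by apply/funext => u; rewrite state_start.
have sid : strictly_diff (fun u : 'rV[R]_n => u) v.
  by apply: (@strictly_diff_lin _ _ _ idfun) => x; exact: cvg_id.
have [s e] := strictly_diff_pair (strictly_diff_cst (d0 p) v) sid.
split; first exact: s.
move=> h; rewrite e; congr (_, _); first by rewrite diff_cst.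
exact: (congr1 (fun L => L h) (@diff_lin R 'rV[R]_n 'rV[R]_n idfun v (fun x => cvg_id))).
Qed.

Lemma regular_start v : exists d, regular_at gam v d 0.
Proof.
exists d0; split; [exact: atlas0|by rewrite gam0| |by case: (state_start_diff v)].
by near=> u; rewrite gam0.
Unshelve. all: by end_near. Qed.

Let reg v d t : atlas d -> chart_dom d (gam v t) -> regular_at gam v d t :=
  @flow_regular _ _ _ _ _ geo regular_start v d t.

Definition velocity d v t : 'rV[R]_n := derive1 (d \o gam v) t.
(** The variation of the geodesics from [p] as the initial velocity moves in direction [h]: the
    Jacobi field with J(0) = 0 and J'(0) = [h]. At time 1 it is the differential of the exponential
    map. *)
Definition jacobi d v h t : 'rV[R]_n := ('d (fun u => state d (gam u) t) v h).1.
Definition jacobi' d v h t : 'rV[R]_n := ('d (fun u => state d (gam u) t) v h).2.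
(** The covariant derivative along the geodesic; unlike [jacobi'] it is the coordinate expression of
    a tangent vector. *)
Definition jacobi_cov d v h t : 'rV[R]_n :=
  jacobi' d v h t + christoffel (g d) (d (gam v t)) (velocity d v t) (jacobi d v h t).

Let img (d : chart R n N) v t : chart_dom d (gam v t) -> chart_img d (d (gam v t)) := @chart_imgP _ _ _ _ _.

Lemma coord_derive d v t : atlas d -> chart_dom d (gam v t) ->
  is_derive t 1 (d \o gam v) (velocity d v t) /\
  is_derive t 1 (velocity d v)
    (- christoffel (g d) (d (gam v t)) (velocity d v t) (velocity d v t)).
Proof.
move=> ad dt; have h := state_derive ad (geo v) dt.
split; [exact: (is_derive_fst h)|exact: (is_derive_snd h)].
Qed.

Lemma jacobi_is_derive d v h t : atlas d -> chart_dom d (gam v t) ->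
  is_derive t 1 (jacobi d v h) (jacobi' d v h t) /\
  is_derive t 1 (jacobi' d v h)
    (- ('D_(jacobi d v h t) (fun x => christoffel (g d) x (velocity d v t) (velocity d v t)) (d (gam v t)) +
     2 *: christoffel (g d) (d (gam v t)) (velocity d v t) (jacobi' d v h t))).
Proof.
move=> ad dt; have H := flow_variation geo regular_start h ad dt.
have E := geodesic_field_diff (@oU d) (sG ad) (symG ad) (posG ad)
  (jacobi d v h t) (jacobi' d v h t) (p := state d (gam v) t) (img dt).
have e2 : 'd (fun u => state d (gam u) t) v h = (jacobi d v h t, jacobi' d v h t).
  exact: surjective_pairing.
have {}H := is_derive_eq H (etrans (congr1 _ e2) E).
split; [exact: (is_derive_fst H)|exact: (is_derive_snd H)].
Qed.

Lemma jacobi_transition c d v h t : atlas c -> atlas d ->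
  chart_dom c (gam v t) -> chart_dom d (gam v t) ->
  jacobi d v h t = 'd (transition c d) (c (gam v t)) (jacobi c v h t).
Proof. by move=> ac ad ct dt; have [_] := regular_transition geo (reg ac ct) ad dt; exact. Qed.

Lemma velocity_transition c d v t : atlas c -> atlas d ->
  chart_dom c (gam v t) -> chart_dom d (gam v t) ->
  velocity d v t = 'd (transition c d) (c (gam v t)) (velocity c v t).
Proof. by move=> ac ad ct dt; have := state_transition ac ad (geo v) ct dt; move=> [_]. Qed.

(** A geodesic may cross several charts; a chart chosen at each point turns inner products along it
    into functions on all of R. The lemmas [jacobi_sqE], [jacobi_velE] and [speed_sqE] remove the
    dependence on that choice. *)
Let at_ y : chart R n N := s2val (cid2 (atlas_cover y)).
Let at_atlas y : atlas (at_ y) := s2valP (cid2 (atlas_cover y)).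
Let at_dom y : chart_dom (at_ y) y := s2valP' (cid2 (atlas_cover y)).

Definition jacobi_sq v h t : R := let d := at_ (gam v t) in
  form (g d (d (gam v t))) (jacobi d v h t) (jacobi d v h t).
Definition jacobi_vel v h t : R := let d := at_ (gam v t) in
  form (g d (d (gam v t))) (jacobi d v h t) (velocity d v t).
Definition speed_sq v t : R := let d := at_ (gam v t) in
  form (g d (d (gam v t))) (velocity d v t) (velocity d v t).

Lemma jacobi_sqE d v h t : atlas d -> chart_dom d (gam v t) ->
  jacobi_sq v h t = form (g d (d (gam v t))) (jacobi d v h t) (jacobi d v h t).
Proof.
move=> ad dt; rewrite /jacobi_sq (jacobi_transition h (at_atlas (gam v t)) ad (at_dom _) dt).
exact: metric_form_transition (at_atlas _) ad (at_dom _) dt.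
Qed.

Lemma jacobi_velE d v h t : atlas d -> chart_dom d (gam v t) ->
  jacobi_vel v h t = form (g d (d (gam v t))) (jacobi d v h t) (velocity d v t).
Proof.
move=> ad dt; rewrite /jacobi_vel (jacobi_transition h (at_atlas (gam v t)) ad (at_dom _) dt).
rewrite (velocity_transition (at_atlas (gam v t)) ad (at_dom _) dt).
exact: metric_form_transition (at_atlas _) ad (at_dom _) dt.
Qed.

Lemma speed_sqE d v t : atlas d -> chart_dom d (gam v t) ->
  speed_sq v t = form (g d (d (gam v t))) (velocity d v t) (velocity d v t).
Proof.
move=> ad dt; rewrite /speed_sq (velocity_transition (at_atlas (gam v t)) ad (at_dom _) dt).
exact: metric_form_transition (at_atlas _) ad (at_dom _) dt.
Qed.

(** The velocity of a geodesic is parallel, so its square norm has derivative 0. *)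
Lemma speed_sq_cst v t : speed_sq v t = form (g d0 (d0 p)) v v.
Proof.
have -> : form (g d0 (d0 p)) v v = speed_sq v 0.
  by rewrite (speed_sqE atlas0) /velocity ?vel0 gam0.
apply: is_derive_0_is_cst => s.
have [d ad ds] := atlas_cover (gam v s).
have nd := geodesic_dom_near (geo v) ds.
have [dc dT] := coord_derive ad ds.
have H := is_derive_form (@oU d) (sG ad) (symG ad) (posG ad) (img ds) dc dT dT.
have E : \forall u \near s, form (g d ((d \o gam v) u)) (velocity d v u) (velocity d v u) = speed_sq v u.
  by near=> u; rewrite (speed_sqE ad)//; near: u; exact: nd.
have := near_eq_is_derive E H.
by rewrite addNr form0 form0r addr0.
Unshelve. all: by end_near. Qed.

(* Differentiating the conservation of energy with respect to the initial velocity. *)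
Lemma jacobi_cov_velocity d v h t : atlas d -> chart_dom d (gam v t) ->
  form (g d (d (gam v t))) (jacobi_cov d v h t) (velocity d v t) = form (g d0 (d0 p)) h v.
Proof.
move=> ad dt; have [_ _ nd sd] := reg ad dt.
have E0 : (v + (0 : R) *: h) = v by rewrite scale0r addr0.
have dst : differentiable (fun u => state d (gam u) t) (v + (0 : R) *: h).
  by rewrite E0; case: sd.
have hst := is_derive_chain dst (is_derive_affine v h 0).
rewrite E0 in hst.
pose c (s : R) := d (gam (v + s *: h) t).
pose T (s : R) := velocity d (v + s *: h) t.
have dc : is_derive (0 : R) 1 c (jacobi d v h t) := is_derive_fst hst.
have dT : is_derive (0 : R) 1 T (jacobi' d v h t) := is_derive_snd hst.
have Uc : chart_img d (c 0) by rewrite /c E0; exact: img.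
have H := is_derive_form (@oU d) (sG ad) (symG ad) (posG ad) Uc dc dT dT.
have nd' : \forall s \near (0 : R), chart_dom d (gam (v + s *: h) t).
  exact: line_cvg0 nd.
have en : \forall s \near (0 : R), form (g d (c s)) (T s) (T s) =
   form (g d0 (d0 p)) v v + s * (2 * form (g d0 (d0 p)) h v) + s * s * form (g d0 (d0 p)) h h.
  near=> s.
  have ds : chart_dom d (gam (v + s *: h) t) by near: s; exact: nd'.
  rewrite -(speed_sqE ad ds) speed_sq_cst !formD !formDr !formZ !formZr.
  rewrite (formC v h); last exact: (symG atlas0 (chart_imgP dom0)).
  ring.
have H2 : is_derive (0 : R) 1 (fun s : R => form (g d0 (d0 p)) v v +
    s * (2 * form (g d0 (d0 p)) h v) + s * s * form (g d0 (d0 p)) h h) (2 * form (g d0 (d0 p)) h v).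
  have i1 := @is_derive_id R R (0 : R) 1.
  have c1 k := is_derive_cst (k : R) (0 : R) (1 : R).
  apply: (is_derive_eq (is_deriveD (is_deriveD (c1 (form (g d0 (d0 p)) v v)) (is_derive_mulr i1 (c1 (2 * form (g d0 (d0 p)) h v))))
     (is_derive_mulr (is_derive_mulr i1 i1) (c1 (form (g d0 (d0 p)) h h))))).
  by rewrite /cst; ring.
have := is_derive_unique (near_eq_is_derive en H) H2.
rewrite /c /T E0 (formC (velocity d v t)); last exact: (symG ad (img dt)).
rewrite (christoffelC (@oU d) (sG ad) (symG ad) _ _ (img dt)) -/(jacobi_cov d v h t) -mulr2n.
by move=> e; lra.
Unshelve. all: by end_near. Qed.

Lemma jacobi0 v h : jacobi d0 v h 0 = 0.
Proof. by rewrite /jacobi (proj2 (state_start_diff v)). Qed.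

(** The derivative of <J, T> is <J', T>, which is the constant <h, v>; as <J, T> is 0 at time 0, it
    equals [t] times that constant. *)
Lemma gauss_lemma d v h : atlas d -> chart_dom d (gam v 1) ->
  form (g d (d (gam v 1))) (jacobi d v h 1) (velocity d v 1) = form (g d0 (d0 p)) h v.
Proof.
move=> ad1 dt1; rewrite -(jacobi_velE h ad1 dt1).
set k := form _ h v.
have dom00 : chart_dom d0 (gam v 0) by rewrite gam0.
pose f (t : R) := jacobi_vel v h t - t * k.
have : f 1 = f 0.
  apply: is_derive_0_is_cst => s.
  have [c ac cs] := atlas_cover (gam v s).
  have nc := geodesic_dom_near (geo v) cs.
  have [dc dT] := coord_derive ac cs; have [dJ _] := jacobi_is_derive h ac cs.
  have H := is_derive_form (@oU c) (sG ac) (symG ac) (posG ac) (img cs) dc dJ dT.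
  have E : \forall u \near s, form (g c ((c \o gam v) u)) (jacobi c v h u) (velocity c v u) = jacobi_vel v h u.
    by near=> u; rewrite (jacobi_velE h ac)//; near: u; exact: nc.
  have H1 := near_eq_is_derive E H.
  rewrite addNr form0r addr0 -/(jacobi_cov c v h s) (jacobi_cov_velocity h ac cs) -/k in H1.
  have := is_deriveB H1 (is_derive_mulr (@is_derive_id R R s 1) (is_derive_cst (k : R) s (1 : R))).
  by rewrite mulr0 addr0 mul1r subrr.
have J00 : jacobi_vel v h 0 = 0 by rewrite (jacobi_velE h atlas0 dom00) jacobi0 form0.
rewrite /f J00 mul1r mul0r subr0 => /eqP.
by rewrite subr_eq0 => /eqP.
Unshelve. all: by end_near. Qed.

Hypothesis curv : nonpositively_curved g.

Lemma jacobi_sq_derive v h t d : atlas d -> chart_dom d (gam v t) ->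
  is_derive t 1 (jacobi_sq v h)
    (2 * form (g d (d (gam v t))) (jacobi_cov d v h t) (jacobi d v h t)).
Proof.
move=> ad dt; have nd := geodesic_dom_near (geo v) dt.
have [dc dT] := coord_derive ad dt; have [dJ _] := jacobi_is_derive h ad dt.
have H := is_derive_form (@oU d) (sG ad) (symG ad) (posG ad) (img dt) dc dJ dJ.
have E : \forall u \near t, form (g d ((d \o gam v) u)) (jacobi d v h u) (jacobi d v h u) = jacobi_sq v h u.
  by near=> u; rewrite (jacobi_sqE h ad)//; near: u; exact: nd.
have := near_eq_is_derive E H.
rewrite -/(jacobi_cov d v h t) (formC (jacobi d v h t)); last exact: (symG ad (img dt)).
by move=> {}H; apply: (is_derive_eq H); rewrite mulr_natl mulr2n.
Unshelve. all: by end_near. Qed.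

(** Half the second derivative of |J|^2 is |J'|^2 - <R(J, T) T, J>, and neither summand is
    negative. *)
Lemma jacobi_sq_convex v h (t : R) :
  exists2 k, 0 <= k & is_derive t (1 : R) (derive1 (jacobi_sq v h)) k.
Proof.
have [d ad dt] := atlas_cover (gam v t).
have nd := geodesic_dom_near (geo v) dt.
have [dc dT] := coord_derive ad dt; have [dJ dK] := jacobi_is_derive h ad dt.
have [B' dB EB] := jacobi_derive (@oU d) (sG ad) (symG ad) (posG ad) (img dt) dc dT dJ dK.
have H := is_derive_form (@oU d) (sG ad) (symG ad) (posG ad) (img dt) dc dB dJ.
have H2 := is_derive_mulr (is_derive_cst (2 : R) t (1 : R)) H.
exists (2 * (form (g d (d (gam v t))) (- curvature (g d) (d (gam v t)) (jacobi d v h t) (velocity d v t) (velocity d v t)) (jacobi d v h t) +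
   form (g d (d (gam v t))) (jacobi_cov d v h t) (jacobi_cov d v h t))).
  rewrite mulr_ge0// addr_ge0//.
    rewrite formN oppr_ge0.
    apply: (curvature_form_le0 (@oU d) (sG ad) (symG ad) (posG ad) _ _ (img dt)) => a b ab.
    exact: (curv ad (img dt) ab).
  have [->|J0] := eqVneq (jacobi_cov d v h t) 0; first by rewrite form0.
  exact: ltW (posG ad (img dt) J0).
have E : \forall u \near t, 2 * form (g d ((d \o gam v) u)) (jacobi_cov d v h u) (jacobi d v h u) = derive1 (jacobi_sq v h) u.
  near=> u; have du : chart_dom d (gam v u) by near: u; exact: nd.
  by rewrite derive1E; have [_ ->] := jacobi_sq_derive h ad du.
have := near_eq_is_derive E H2.
by rewrite mul0r add0r EB.
Unshelve. all: by end_near. Qed.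

Lemma jacobi_sq_ge0 v h t : 0 <= jacobi_sq v h t.
Proof.
have [d ad dt] := atlas_cover (gam v t); rewrite (jacobi_sqE h ad dt).
have [->|J0] := eqVneq (jacobi d v h t) 0; first by rewrite form0.
exact: ltW (posG ad (img dt) J0).
Qed.

Lemma jacobi_sq0 v h : jacobi_sq v h 0 = 0.
Proof.
have dom00 : chart_dom d0 (gam v 0) by rewrite gam0.
by rewrite (jacobi_sqE h atlas0 dom00) jacobi0 form0.
Qed.

Let jacobi_sq_derive1 v h t : is_derive t (1 : R) (jacobi_sq v h) (derive1 (jacobi_sq v h) t).
Proof.
have [d ad dt] := atlas_cover (gam v t).
by apply: derivable_is_derive1; have [] := jacobi_sq_derive h ad dt.
Qed.

Lemma jacobi_cov_ge d v h : atlas d -> chart_dom d (gam v 1) ->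
  form (g d (d (gam v 1))) (jacobi d v h 1) (jacobi d v h 1) <=
  2 * form (g d (d (gam v 1))) (jacobi_cov d v h 1) (jacobi d v h 1).
Proof.
move=> ad dt; rewrite -(jacobi_sqE h ad dt).
have [H _] := convex_derive_bound (@jacobi_sq_derive1 v h) (@jacobi_sq_convex v h) (@jacobi_sq_ge0 v h) (jacobi_sq0 v h).
apply: le_trans H _; rewrite derive1E.
by have [_ ->] := jacobi_sq_derive h ad dt.
Qed.

(** If J(1) = 0, the derivative of |J|^2 vanishes at 1, so by convexity J vanishes on [0, 1]; and
    [h] is its derivative at 0. *)
Lemma jacobi_inj d v h : atlas d -> chart_dom d (gam v 1) ->
  jacobi d v h 1 = 0 -> h = 0.
Proof.
move=> ad dt J0.
have [_ H] := convex_derive_bound (@jacobi_sq_derive1 v h) (@jacobi_sq_convex v h) (@jacobi_sq_ge0 v h) (jacobi_sq0 v h).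
have {}H t : 0 <= t -> t <= 1 -> jacobi_sq v h t = 0.
  apply: H; rewrite derive1E; have [_ ->] := jacobi_sq_derive h ad dt.
  by rewrite J0 form0r mulr0.
have dom00 : chart_dom d0 (gam v 0) by rewrite gam0.
have nd := geodesic_dom_near (geo v) dom00.
have [dJ _] := jacobi_is_derive h atlas0 dom00.
have e' : jacobi' d0 v h 0 = h by rewrite /jacobi' (proj2 (state_start_diff v)).
rewrite e' in dJ; apply: (right_derive0 dJ).
near=> t.
have t0 : 0 < t by near: t; exact: nbhs_right_gt.
have t1 : t <= 1 by near: t; apply: nbhs_right_le.
have dt' : chart_dom d0 (gam v t) by near: t; exact: cvg_at_right_filter nd.
apply: contra_eq (H t (ltW t0) t1) => J1.
by rewrite (jacobi_sqE h atlas0 dt') gt_eqF// (posG atlas0 (img dt') J1).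
Unshelve. all: by end_near. Qed.
End Exponential.

(** * Lifting through a covering *)

Lemma continuous_glue (R : realType) (T : topologicalType) (a b : R -> T) (c : R) :
  continuous a -> continuous b -> a c = b c ->
  continuous (fun t => if t <= c then a t else b t).
Proof.
move=> ca cb ab t U Ut; rewrite -nearE near_map.
have [tc|ct|tc] := ltgtP t c.
- rewrite (ltW tc) in Ut.
  have h1 : \forall s \near t, s < c by exact: lt_nbhsl.
  have h2 := ca t U Ut; near=> s.
  have sc : s < c by near: s.
  by rewrite (ltW sc); near: s.
- rewrite leNgt ct /= in Ut.
  have h1 : \forall s \near t, c < s by exact: lt_nbhsr.
  have h2 := cb t U Ut; near=> s.
  have sc : c < s by near: s.
  by rewrite leNgt sc /=; near: s.
- rewrite tc lexx in Ut.
  have h1 := ca c U Ut; rewrite ab in Ut; have h2 := cb c U Ut.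
  rewrite tc; near=> s.
  by case: ifP => _; near: s.
Unshelve. all: by end_near. Qed.

(** The retraction of R onto [0, 1]. Composing with it makes paths and homotopies continuous on the
    whole space, so that lifting can ignore subspace topologies. *)
Definition clamp (R : realType) (t : R) : R := Num.max 0 (Num.min t 1).

Lemma continuous_maxmin (R : realType) (a b : R) : continuous (fun t : R => Num.max a (Num.min t b)).
Proof.
move=> t; apply: (@continuous_max R R (fun=> a) (fun s : R => Num.min s b) t); first exact: cst_continuous.
by apply: (@continuous_min R R idfun (fun=> b) t); [exact: cvg_id|exact: cst_continuous].
Qed.

Lemma clamp_continuous (R : realType) : continuous (@clamp R).
Proof. exact: continuous_maxmin. Qed.

Lemma clamp_itv (R : realType) (t : R) : 0 <= clamp t <= 1.
Proof. by rewrite /clamp le_max lexx ge_max ler01 ge_min lexx orbT. Qed.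

Lemma clamp_id (R : realType) (t : R) : 0 <= t <= 1 -> clamp t = t.
Proof. by move=> /andP[h0 h1]; rewrite /clamp (min_idPl h1) (max_idPr h0). Qed.

Lemma clamp_le0 (R : realType) (t : R) : t <= 0 -> clamp t = 0.
Proof. by move=> t0; rewrite /clamp; apply/max_idPl; rewrite ge_min t0. Qed.

Lemma clamp_ge1 (R : realType) (t : R) : 1 <= t -> clamp t = 1.
Proof. by move=> t1; rewrite /clamp (min_idPr t1); apply/max_idPr. Qed.

Section LocalHomeomorphism.
Context (R : realType) (V : normedModType R) (N : topologicalType) (E : V -> N).
Hypothesis E_cont : continuous E.
Hypothesis E_inj : forall v, exists2 A : set V, open A & A v /\
  forall x y, A x -> A y -> E x = E y -> x = y.
Hypothesis E_open : forall v A, nbhs v A -> nbhs (E v) (E @` A).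

(** The inverse of [E] on the open image of a set where [E] is injective; its continuity is the
    openness of [E]. *)
Lemma local_section v : exists A B (rho : N -> V),
  [/\ open A /\ A v, open B /\ B (E v),
    forall x y, A x -> A y -> E x = E y -> x = y &
    forall y, B y -> [/\ A (rho y), E (rho y) = y & {for y, continuous rho}]].
Proof.
have [A oA [Av Ainj]] := E_inj v.
pose rho y := xget 0 [set w | A w /\ E w = y].
have rhoP w : A w -> A (rho (E w)) /\ E (rho (E w)) = E w.
  by move=> Aw; apply: (@xgetPex _ 0 [set w' | A w' /\ E w' = E w]); exists w.
have rhoE w : A w -> rho (E w) = w.
  by move=> Aw; have [h1 h2] := rhoP w Aw; exact: Ainj.
exists A, (E @` A), rho; split=> //.
- split; last by exists v.
  by rewrite openE => _ [w Aw <-]; apply: E_open; exact: open_nbhs_nbhs.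
- move=> _ [w Aw <-]; have [h1 h2] := rhoP w Aw; split=> //.
  rewrite /prop_for /continuous_at (rhoE w Aw) => U Uw.
  have : nbhs w (A `&` U) by apply: filterI => //; exact: open_nbhs_nbhs.
  by move=> /E_open; apply: filterS => _ [z [Az Uz] <-] /=; rewrite rhoE.
Qed.

(** Agreement spreads locally by injectivity of [E], and disagreement spreads because two continuous
    maps into a normed space that differ at a time differ nearby. *)
Lemma lift_unique (C : set R) (w w' : R -> V) (s0 : R) : connected C -> C s0 ->
  (forall s, C s -> [/\ {for s, continuous w}, {for s, continuous w'} & E (w s) = E (w' s)]) ->
  w s0 = w' s0 -> forall s, C s -> w s = w' s.
Proof.
move=> cC C0 H e0; apply: (connected_chain cC C0 e0) => t Ct.
have [ct ct' _] := H t Ct.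
have [e|ne] := eqVneq (w t) (w' t).
- have [A oA [Aw Ainj]] := E_inj (w t).
  exists [set s | A (w s) /\ A (w' s)].
    have h1 : \forall s \near t, A (w s) by apply: ct; exact: open_nbhs_nbhs.
    have h2 : \forall s \near t, A (w' s) by apply: ct'; rewrite -e; exact: open_nbhs_nbhs.
    by near=> s; split; near: s.
  move=> s s' _ Cs' _ [a a'] _; have [_ _ es] := H s' Cs'; exact: Ainj.
- have h : \forall s \near t, w s != w' s.
    have cv : `|w s - w' s| @[s --> t] --> `|w t - w' t|.
      by apply: cvg_norm; apply: cvgB.
    have p : 0 < `|w t - w' t| by rewrite normr_gt0 subr_eq0.
    move/cvgr_gt : cv => /(_ _ p); apply: filterS => s.
    by rewrite normr_gt0 subr_eq0.
  exists [set s | w s != w' s]; first exact: h.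
  by move=> s s' _ _ /eqP ne1 _ es; case: ne1.
Unshelve. all: by end_near. Qed.

Lemma lift_extend (a : R -> N) (w : R -> V) (rho : N -> V) (s1 s2 : R) : 0 <= s1 ->
  continuous w -> (forall s, s <= s1 -> E (w s) = a s) -> s1 <= s2 -> continuous a ->
  (forall s, s1 <= s <= s2 -> E (rho (a s)) = a s /\ {for a s, continuous rho}) ->
  rho (a s1) = w s1 ->
  exists2 w' : R -> V, continuous w' & w' 0 = w 0 /\ forall s, s <= s2 -> E (w' s) = a s.
Proof.
move=> s10 cw Ew s12 ca rhoP e1.
have K s : s1 <= Num.max s1 (Num.min s s2) <= s2.
  by rewrite le_max lexx ge_max s12 ge_min lexx orbT.
(* Clamping to [s1, s2] keeps [rho] where it is continuous, so both pieces of the gluing are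
   continuous on all of R. *)
exists (fun s => if s <= s1 then w s else rho (a (Num.max s1 (Num.min s s2)))).
  apply: continuous_glue => //.
    move=> s; have [_ cr] := rhoP _ (K s).
    apply: (@continuous_comp _ _ _ (fun s => a (Num.max s1 (Num.min s s2))) rho); last exact: cr.
    apply: (@continuous_comp _ _ _ (fun s => Num.max s1 (Num.min s s2)) a); last exact: ca.
    exact: continuous_maxmin.
  by rewrite (min_idPl s12) maxxx e1.
split; first by rewrite s10.
move=> s ss2; case: ifP => [|/negbT]; first exact: Ew.
rewrite -ltNge => /ltW s1s.
by rewrite (min_idPl ss2) (max_idPr s1s); have [] := rhoP s; rewrite ?s1s.
Qed.

(** Continuity in [x] is carried along the time axis: near (x0, t) uniqueness of lifts gives W = rho
    \o H for one local section [rho], so continuity at one time of the window implies it at all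
    others. *)
Lemma lift_stable (T : topologicalType) (H : T -> R -> N) (W : T -> R -> V) (D : set T) (x0 : T) :
  nbhs x0 D ->
  (forall x t, D x -> {for (x, t), continuous (fun p : T * R => H p.1 p.2)}) ->
  (forall x, D x -> continuous (W x)) -> (forall x t, D x -> E (W x t) = H x t) ->
  {for x0, continuous (W ^~ 0)} -> forall t, {for x0, continuous (W ^~ t)}.
Proof.
move=> nD cH cW EW c0 t; have D0 := nbhs_singleton nD.
apply: (@connected_chain _ setT (fun t => {for x0, continuous (W ^~ t)}) 0) => //.
  exact: connected_real.
move=> {}t _; have [A [B [rho [[oA Av] [oB Bv] Ainj rhoP]]]] := local_section (W x0 t).
have : \forall p \near (x0, t), B (H p.1 p.2).
  by apply: (cH x0 t D0); apply: open_nbhs_nbhs; split=> //=; rewrite -EW.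
move=> [[X Y] /= [Xn Yn] XY].
have : nbhs t (Y `&` (W x0 @^-1` A)).
  by apply: filterI => //; apply: (cW x0 D0 t); exact: open_nbhs_nbhs.
move=> /nbhs_ballP[r /= r0 Hr].
exists (ball t r); first exact: nbhsx_ballx.
move=> s s' _ _ bs bs' cs.
have As : \forall x \near x0, A (W x s).
  by apply: cs; apply: open_nbhs_nbhs; split=> //; case: (Hr s bs).
have eq : \forall x \near x0, W x s' = rho (H x s').
  near=> x.
  have Dx : D x by near: x.
  have Xx : X x by near: x.
  have Bu u : ball t r u -> B (H x u) by move=> bu; apply: (XY (x, u)); split=> //=; case: (Hr u bu).
  apply: (@lift_unique (ball t r) (W x) (fun u => rho (H x u)) s) => //.
  - have -> : ball t r = `]t - r, t + r[%classic.
      by apply/seteqP; split=> u; rewrite -ball_normE /= in_itv /= distrC ltr_distl.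
    by apply/connected_intervalP; exact: interval_is_interval.
  - move=> u bu; split; first exact: (cW x Dx).
      have [_ _ cr] := rhoP _ (Bu u bu).
      apply: (@continuous_comp _ _ _ (H x) rho); last exact: cr.
      move=> U /(cH x u Dx)[[X' Y'] /= [X'n Y'n] XY'].
      by apply: filterS Y'n => z Y'z; apply: (XY' (x, z)); split=> //=; exact: nbhs_singleton.
    by have [_ -> _] := rhoP _ (Bu u bu); rewrite EW.
  - have [Ar Er _] := rhoP _ (Bu s bs).
    by apply: Ainj => //; [near: x|rewrite Er EW].
rewrite /prop_for /continuous_at (nbhs_singleton eq) => U HU.
have [_ _ cr] := rhoP _ (XY (x0, s') (conj (nbhs_singleton Xn) (proj1 (Hr s' bs')))).
have h1 : \forall x \near x0, U (rho (H x s')).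
  move/cr : HU => /(cH x0 s' D0)[[X' Y'] /= [X'n Y'n] XY'].
  by apply: filterS X'n => z X'z; apply: (XY' (z, s')); split=> //=; exact: nbhs_singleton.
rewrite -nearE near_map; near=> x.
have -> : W x s' = rho (H x s') by near: x.
by near: x.
Unshelve. all: by end_near. Qed.

(** A local homeomorphism may fail to lift a path only if the lift escapes; when all partial lifts
    stay in a compact set, a cluster point supplies the sheet that carries the lift through the
    limit time. *)
Lemma lift_confined (a : R -> N) (v1 : V) (K : set V) : hausdorff_space N ->
  continuous a -> compact K -> (forall s, s <= 0 -> a s = a 0) -> E v1 = a 0 ->
  (forall (t : R) (w : R -> V), 0 <= t -> t <= 1 -> continuous w -> w 0 = v1 ->
    (forall s, s <= t -> E (w s) = a s) -> K (w t)) ->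
  exists2 w : R -> V, continuous w & w 0 = v1 /\ forall s, s <= 1 -> E (w s) = a s.
Proof.
move=> hN ca cK a0 Ev conf.
pose P (t : R) := exists2 w : R -> V, continuous w & w 0 = v1 /\ forall s, s <= t -> E (w s) = a s.
apply: (@real_ind _ P 1) => //.
- by move=> s t s0 st [w cw [w0 Ew]]; exists w => //; split=> // u us; apply: Ew; exact: le_trans st.
- exists (fun=> v1); first by move=> x; exact: cst_continuous.
  by split=> // s s0; rewrite a0.
- move=> t t0 t1 IH.
  (* Each time gets its own lift, chosen independently; the endpoints [W s] lie in [K] and cluster
     there as [s] tends to [t]. *)
  have sel (s : R) : exists v, 0 <= s -> s < t -> K v /\
      exists2 w : R -> V, continuous w & [/\ w 0 = v1, v = w s & forall u, u <= s -> E (w u) = a u].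
    have [s0|s0] := leP 0 s; last by exists 0.
    have [st|st] := ltP s t; last by exists 0.
    have [w cw [w0 Ew]] := IH s s0 st; exists (w s) => _ _; split; last by exists w.
    by apply: conf => //; exact: le_trans (ltW st) t1.
  have [W WP] := choice sel.
  have nt : \forall s \near t^'-, 0 <= s /\ s < t.
    near=> s; split; last by near: s; exact: nbhs_left_lt.
    by apply: ltW; near: s; exact: nbhs_left_gt.
  have [v Kv clv] : exists2 v, K v & cluster (W @ t^'-) v.
    have [|v [Kv clv]] := cK (W @ t^'-) _; last by exists v.
    by rewrite nbhs_simpl /=; apply: filterS nt => s [s0 st]; have [] := WP s s0 st.
  (* Every neighbourhood of [E v] and every neighbourhood of [a t] share a point E (W s), so the two
     points coincide in a Hausdorff space. *)
  have Evt : E v = a t.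
    apply: hN => A B Av Bt.
    have h1 : nbhs t^'- (W @^-1` [set x | B (E x)]).
      have h : \forall s \near t^'-, B (a s) by apply: cvg_at_left_filter Bt; exact: ca.
      apply: filterS2 nt h => s [s0 st] Bs; have [_ [w cw [_ e Ew]]] := WP s s0 st.
      by rewrite /= e Ew.
    have [x [Bx Ax]] := clv _ _ h1 (E_cont Av).
    by exists (E x).
  have [A [B [rho [[oA Av] [oB Bv] Ainj rhoP]]]] := local_section v.
  have : nbhs t (a @^-1` B) by apply: ca; rewrite -Evt; exact: open_nbhs_nbhs.
  move=> /nbhs_ballP[r /= r0 Hr].
  have h1 : nbhs t^'- (W @^-1` [set x | exists2 s, W s = x & (0 <= s /\ s < t) /\ t - r < s]).
    have h : \forall s \near t^'-, t - r < s by apply: nbhs_left_gt; rewrite gtrBl.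
    by apply: filterS2 nt h => s sn sr; exists s.
  (* A time from which [a] stays in [B] up to [t] and whose lift ends in the sheet [A]; from there
     [rho] continues that lift. *)
  have [x [[s <- [[s0 st] sr]] Ax]] := clv _ _ h1 (open_nbhs_nbhs (conj oA Av)).
  have [_ [w cw [w0 e Ew]]] := WP s s0 st.
  have inB u : s <= u <= t -> B (a u).
    move=> /andP[su ut]; apply: Hr; rewrite -ball_normE /= ger0_norm ?subr_ge0//.
    by rewrite ltrBlDr -ltrBlDl; apply: lt_le_trans su.
  have := @lift_extend a w rho s t s0 cw Ew (ltW st) ca.
  have rP u : s <= u <= t -> E (rho (a u)) = a u /\ {for a u, continuous rho}.
    by move=> /inB/rhoP[].
  have es : rho (a s) = w s.
    have /rhoP[Ar Er _] : B (a s) by apply: inB; rewrite lexx ltW.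
    by rewrite -e; apply: Ainj => //; rewrite Er e Ew.
  by move=> /(_ rP es)[w' cw' [w'0 Ew']]; exists w' => //; split=> //; rewrite w'0.
- move=> t t0 t1 [w cw [w0 Ew]].
  have [A [B [rho [[oA Av] [oB Bv] Ainj rhoP]]]] := local_section (w t).
  rewrite Ew// in Bv.
  have : nbhs t (a @^-1` B) by apply: ca; exact: open_nbhs_nbhs.
  move=> /nbhs_ballP[r /= r0 Hr].
  have inB u : t <= u <= t + r / 2 -> B (a u).
    move=> /andP[tu ut]; apply: Hr; rewrite -ball_normE /= distrC ger0_norm ?subr_ge0//; lra.
  exists (r / 2); first by rewrite divr_gt0.
  have tr : t <= t + r / 2 by rewrite lerDl divr_ge0// ltW.
  have := @lift_extend a w rho t (t + r / 2) t0 cw Ew tr ca.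
  have rP u : t <= u <= t + r / 2 -> E (rho (a u)) = a u /\ {for a u, continuous rho}.
    by move=> /inB/rhoP[].
  have es : rho (a t) = w t.
    have /rhoP[Ar Er _] : B (a t) by apply: inB; rewrite lexx.
    by apply: Ainj => //; rewrite Er Ew.
  by move=> /(_ rP es)[w' cw' [w'0 Ew']]; exists w' => //; split=> //; rewrite w'0.
Unshelve. all: by end_near. Qed.

Hypothesis even : forall q, exists2 U, open U & U q /\ forall v, U (E v) ->
  exists2 s : N -> V, s (E v) = v & forall y, U y -> E (s y) = y /\ {for y, continuous s}.

(** Through each point above [U] passes a section over all of [U], so how far a lift extends depends
    on the base path and not on the lift. This uniformity is what the chain argument uses. *)
Lemma path_lift (a : R -> N) (v1 : V) : continuous a -> E v1 = a (clamp 0) ->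
  exists2 w : R -> V, continuous w & w 0 = v1 /\ forall s, E (w s) = a (clamp s).
Proof.
move=> ca Ev; pose b s := a (clamp s).
have cb : continuous b.
  by move=> s; apply: (@continuous_comp _ _ _ (@clamp R) a); [exact: clamp_continuous|exact: ca].
pose P (t : R) := exists2 w : R -> V, continuous w & w 0 = v1 /\ forall s, s <= t -> E (w s) = b s.
suff [w cw [w0 Ew]] : P 1.
  exists (fun s => w (Num.min s 1)).
    move=> s; apply: (@continuous_comp _ _ _ (fun s : R => Num.min s 1) w); last exact: cw.
    by apply: (@continuous_min R R idfun (fun=> 1) s); [exact: cvg_id|exact: cst_continuous].
  rewrite (min_idPl ler01); split=> // s; rewrite Ew ?ge_min ?lexx ?orbT//.
  by rewrite /b /clamp -minA minxx.
suff H : forall t : R, `[0, 1]%classic t -> P t by apply: H; rewrite /= in_itv /= lexx ler01.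
apply: (@connected_chain R `[0, 1]%classic P 0).
- by apply/connected_intervalP; exact: interval_is_interval.
- by rewrite /= in_itv /= lexx ler01.
- exists (fun=> v1); first by move=> x; exact: cst_continuous.
  by split=> // s s0; rewrite Ev /b (clamp_le0 s0) (@clamp_le0 _ 0).
move=> t _; have [U oU [Ut sec]] := even (b t).
have : nbhs t (b @^-1` U) by apply: cb; exact: open_nbhs_nbhs.
move=> /nbhs_ballP[r /= r0 Hr].
exists (ball t r); first exact: nbhsx_ballx.
move=> s s'; rewrite /= !in_itv /= => /andP[s0 s1] /andP[s'0 s'1] bs bs' [w cw [w0 Ew]].
have [ss'|s's] := leP s s'; last first.
  by exists w => //; split=> // u us'; apply: Ew; apply: le_trans us' (ltW s's).
have inU u : s <= u <= s' -> U (b u).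
  move=> /andP[su us']; apply: Hr; move: bs bs'; rewrite -!ball_normE /= !(distrC t) !ltr_distl; lra.
have [|rho rs rP] := sec (w s); first by rewrite Ew//; apply: inU; rewrite lexx.
have := @lift_extend b w rho s s' s0 cw Ew ss' cb.
have rP' u : s <= u <= s' -> E (rho (b u)) = b u /\ {for b u, continuous rho}.
  by move=> /inU/rP[].
rewrite Ew// in rs.
by move=> /(_ rP' rs)[w' cw' [w'0 Ew']]; exists w' => //; split=> //; rewrite w'0.
Qed.

(** * Monodromy, and lifting of maps from a simply connected space *)

Context (T : topologicalType) (f : T -> N) (x0 : T) (v0 : V).
Hypothesis f_cont : continuous f.
Hypothesis Ev0 : E v0 = f x0.
Hypothesis T_simply : simply_connected R T.
Hypothesis T_local : forall x U, nbhs x U -> \forall y \near x,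
  exists2 a : R -> T, continuous a & [/\ a 0 = x, a 1 = y & forall s, U (a s)].

Definition lifting (a : R -> T) (w : R -> V) : Prop :=
  [/\ continuous a, continuous w, a 0 = x0, w 0 = v0 &
    forall t, 0 <= t <= 1 -> E (w t) = f (a t)].

Lemma within_continuous_comp (X Y Z : topologicalType) (A : set Y) (h : Y -> Z) (phi : X -> Y) :
  {within A, continuous h} -> continuous phi -> (forall x, A (phi x)) -> continuous (h \o phi).
Proof.
move=> ch cphi Aphi x U Ux.
have := ch (phi x) U Ux.
rewrite /nbhs /= -nbhs_subspace_in; last exact: Aphi.
move=> w; have : nbhs x (phi @^-1` [set y | A y -> U (h y)]) by apply: cphi; exact: w.
by apply: filterS => y /=; apply; exact: Aphi.
Qed.

Lemma itv01 (t : R) : 0 <= t <= 1 -> t \in `[0, 1].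
Proof. by rewrite in_itv. Qed.

Lemma unit_interval_connected : connected `[(0 : R), 1]%classic.
Proof. by apply/connected_intervalP; exact: interval_is_interval. Qed.

Lemma lifting_exists a : continuous a -> a 0 = x0 -> exists w, lifting a w.
Proof.
move=> ca a0.
have c0 : clamp (0 : R) = 0 by rewrite clamp_le0.
have [||w cw [w0 Ew]] := @path_lift (f \o a) v0.
- by move=> s; apply: continuous_comp; [exact: ca|exact: f_cont].
- by rewrite /= c0 a0.
by exists w; split=> // t t01; rewrite Ew clamp_id.
Qed.

(** Lift every stage of the null homotopy from [v0]. The endpoints of these lifts depend
    continuously on the stage and lie over one point, so they are constant; the last stage is a
    constant loop, whose lift stays at [v0]. *)
Lemma loop_lift a w : lifting a w -> a 1 = x0 -> w 1 = v0.
Proof.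
move=> [ca cw a0 w0 Ew] a1; have [_ _ sc] := T_simply.
have [|H [cH H0 H1 Hs0 Hs1]] := sc a (continuous_subspaceT ca); first by rewrite a0 a1.
pose cl (p : R * R) := (clamp p.1, clamp p.2).
have ccl : continuous cl.
  move=> p U; apply: (@near_pair_cvg _ _ _ (fun p : R * R => clamp p.1) (fun p : R * R => clamp p.2)).
    apply: (@continuous_comp _ _ _ fst (@clamp R)); [exact: cvg_fst|exact: clamp_continuous].
  apply: (@continuous_comp _ _ _ snd (@clamp R)); [exact: cvg_snd|exact: clamp_continuous].
have cHc : continuous (H \o cl).
  apply: (within_continuous_comp cH ccl) => p.
  by split; rewrite /= in_itv; exact: clamp_itv.
have cfH : continuous (fun p : R * R => f (H (cl p))).
  by move=> p; apply: (@continuous_comp _ _ _ (H \o cl) f); [exact: cHc|exact: f_cont].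
have cHs s : continuous (fun t => f (H (cl (s, t)))).
  move=> t U /(cfH (s, t)); apply: (@near_pair_cvg _ _ _ (fun=> s) idfun); [exact: cst_continuous|exact: cvg_id].
have z01 : (0 : R) \in `[0, 1] by rewrite in_itv /= lexx ler01.
have c0 : clamp (0 : R) = 0 by rewrite clamp_le0.
have c1 : clamp (1 : R) = 1 by rewrite clamp_ge1.
have cc (t : R) : clamp (clamp t) = clamp t by rewrite clamp_id// clamp_itv.
have ci (t : R) : clamp t \in `[0, 1] by exact: itv01 (clamp_itv t).
have lift s : exists w : R -> V, continuous w /\ w 0 = v0 /\ forall t, E (w t) = f (H (cl (s, t))).
  have [|w' cw' [w'0 Ew']] := @path_lift (fun t => f (H (cl (s, t)))) v0 (cHs s).
    by rewrite /cl /= c0 c0 Hs0// a0.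
  by exists w'; split=> //; split=> // t; rewrite Ew' /cl /= cc.
have [W WP] := choice lift.
have stab t : continuous (W ^~ t).
  move=> s; apply: (@lift_stable R (fun s t => f (H (cl (s, t)))) W setT s).
  - exact: filterT.
  - by move=> p q _; exact: (cfH (p, q)).
  - by move=> s' _; case: (WP s').
  - by move=> s' t' _; case: (WP s') => _ [].
  - have -> : W^~ 0 = fun=> v0 by apply/funext => s'; case: (WP s') => _ [].
    exact: cst_continuous.
have e01 : W 0 1 = W 1 1.
  apply: (@lift_unique setT (fun s => W s 1) (fun=> W 1 1) 1) => //; first exact: connected_real.
  move=> s _; split; [exact: stab|exact: cst_continuous|].
  have [_ [_ ->]] := WP s; have [_ [_ ->]] := WP 1.
  have o01 : (1 : R) \in `[0, 1] by rewrite in_itv /= lexx ler01.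
  by rewrite /cl /= c1 (Hs1 _ (ci s)) (Hs1 _ o01).
have e1 : W 1 1 = v0.
  apply: (@lift_unique setT (W 1) (fun=> v0) 0) => //; first exact: connected_real.
    move=> t _; split; [exact: (proj1 (WP 1) t)|exact: cst_continuous|].
    by have [_ [_ ->]] := WP 1; rewrite /cl /= c1 H1// a0.
  by case: (WP 1) => _ [].
rewrite -e1 -e01; apply: (@lift_unique `[0, 1]%classic w (W 0) 0).
- exact: unit_interval_connected.
- exact: z01.
- move=> t t01; split; [exact: cw|exact: (proj1 (WP 0) t)|].
  have t01' : 0 <= t <= 1 by move: t01; rewrite /= in_itv.
  by rewrite Ew//; have [_ [_ ->]] := WP 0; rewrite /cl /= c0 H0// clamp_id.
- by rewrite w0; case: (WP 0) => _ [].
- by rewrite /= in_itv /= lexx ler01.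
Qed.

(** Following [a] and then [b] backwards gives a loop, whose lift returns to [v0]. Its two halves
    are the lifts of [a] and of [b] from [v0], and they meet at time 1/2. *)
Lemma lift_endpoint a b w w' : lifting a w -> lifting b w' -> a 1 = b 1 -> w 1 = w' 1.
Proof.
move=> [ca cw a0 w0 Ew] [cb cw' b0 w'0 Ew'] ab.
pose h : R := 2^-1.
pose l (t : R) := if t <= h then a (2 * t) else b (2 - 2 * t).
have clin (k k' : R) : continuous (fun t : R => k + k' * t).
  by move=> t; apply: (@continuousD R R R (fun=> k) (fun t => k' * t)); [exact: cst_continuous|exact: mulrl_continuous].
have e2 : 2 * h = 1 by rewrite /h; lra.
have e3 : 2 - 2 * h = 1 by rewrite /h; lra.
have cl : continuous l.
  apply: continuous_glue; last by rewrite e3 e2.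
    move=> t; apply: (@continuous_comp _ _ _ (fun t : R => 2 * t) a); last exact: ca.
    exact: mulrl_continuous.
  move=> t; apply: (@continuous_comp _ _ _ (fun t : R => 2 - 2 * t) b); last exact: cb.
  by apply: (@continuousB R R R (fun=> 2) (fun t => 2 * t)); [exact: cst_continuous|exact: mulrl_continuous].
have h0 : 0 <= h by rewrite invr_ge0.
have l0 : l 0 = x0 by rewrite /l h0 mulr0.
have [W [_ cW _ W0 EW]] := lifting_exists cl l0.
have l1 : l 1 = x0.
  rewrite /l ifF; first by rewrite mulr1 subrr b0.
  by apply/negbTE; rewrite -ltNge /h; lra.
have W1 : W 1 = v0 by apply: (@loop_lift l W).
(* Both halves in one statement: [k + k' * t] runs from 0 to 1/2 along [a], and from 1 back to 1/2
   along [b]. *)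
have two (u : R -> V) (c : R -> T) (k k' : R) : continuous u -> continuous W ->
  (forall t, 0 <= t <= 1 -> 0 <= k + k' * t <= 1 /\ f (c t) = f (l (k + k' * t))) ->
  (forall t, 0 <= t <= 1 -> E (u t) = f (c t)) -> u 0 = v0 -> W k = v0 -> u 1 = W (k + k').
  move=> cu _ kk Eu u0 Wk.
  rewrite -[in RHS](mulr1 k'); apply: (@lift_unique `[0, 1]%classic u (fun t => W (k + k' * t)) 0).
  - exact: unit_interval_connected.
  - by rewrite /= in_itv /= lexx ler01.
  - move=> t; rewrite /= in_itv /= => t01; have [h1 h2] := kk t t01; split; first exact: cu.
      apply: (@continuous_comp _ _ _ (fun t : R => k + k' * t) W); [exact: clin|exact: cW].
    by rewrite Eu// EW.
  - by rewrite mulr0 addr0 Wk.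
  - by rewrite /= in_itv /= lexx ler01.
rewrite (two w a 0 h)// ?(two w' b 1 (- h))//.
- by congr W; rewrite /h; lra.
- move=> t /andP[t0 t1]; split; first by rewrite /h; lra.
  have [th|th] := leP (1 - h * t) h.
    have -> : t = 1 by move: th; rewrite /h; lra.
    rewrite /l ifT; last by rewrite /h; lra.
    by rewrite -ab; congr (f (a _)); rewrite /h; lra.
  rewrite /l ifF; last by apply/negbTE; rewrite -ltNge mulNr.
  by congr (f (b _)); rewrite /h; lra.
- move=> t /andP[t0 t1]; split; first by rewrite /h; lra.
  rewrite /l ifT; last by rewrite /h; lra.
  by congr (f (a _)); rewrite /h; lra.
Qed.

(** The value at [x] is the endpoint of the lift of any path to [x]. Near [x] the path may be
    prolonged inside [U], where the lift is given by a section, so locally the lift is that section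
    composed with [f]. *)
Lemma global_lift : exists2 F : T -> V, continuous F & forall x, E (F x) = f x.
Proof.
have [_ pc _] := T_simply.
have sel x : exists v, exists a w, [/\ lifting a w, a 1 = x & w 1 = v].
  have [a [ca a0 a1]] := pc x0 x.
  have c0 : clamp (0 : R) = 0 by rewrite clamp_le0.
  have c1 : clamp (1 : R) = 1 by rewrite clamp_ge1.
  have cac : continuous (a \o @clamp R).
    apply: (within_continuous_comp ca (@clamp_continuous R)) => t.
    by rewrite /= in_itv; exact: clamp_itv.
  have [|w lw] := @lifting_exists (a \o @clamp R) cac; first by rewrite /= c0.
  by exists (w 1), (a \o @clamp R), w; split=> //=; rewrite c1.
have [F FP] := choice sel.
have i1 : 0 <= (1 : R) <= 1 by rewrite lexx ler01.
have EF x : E (F x) = f x.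
  by have [a [w [[_ _ _ _ Ew] <- <-]]] := FP x; rewrite Ew.
exists F => // x.
have [U oU [Ux sec]] := even (f x).
have [|s sF sP] := sec (F x); first by rewrite EF.
rewrite EF in sF.
have eq : \forall y \near x, F y = s (f y).
  have nU : nbhs x (f @^-1` U) by apply: f_cont; exact: open_nbhs_nbhs.
  apply: filterS (T_local nU) => y [b cb [b0 b1 Ub]].
  have [a [w [[ca cw a0 w0 Ew] a1 w1]]] := FP x.
  pose h : R := 2^-1.
  have csb : continuous (fun t => s (f (b t))).
    move=> t; have [_ cs] := sP _ (Ub t).
    apply: (@continuous_comp _ _ _ (fun t => f (b t)) s); last exact: cs.
    by apply: (@continuous_comp _ _ _ b f); [exact: cb|exact: f_cont].
  have c2 : continuous (fun t : R => 2 * t) by exact: mulrl_continuous.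
  have c3 : continuous (fun t : R => 2 * t - 1).
    by move=> t; apply: (@continuousB R R R (fun t => 2 * t) (fun=> 1)); [exact: c2|exact: cst_continuous].
  have e2 : 2 * h = 1 by rewrite /h; lra.
  have gl (Y : topologicalType) (p q : R -> Y) : continuous p -> continuous q -> p 1 = q 0 ->
      continuous (fun t : R => if t <= h then p (2 * t) else q (2 * t - 1)).
    move=> cp cq pq; apply: continuous_glue.
    - by move=> t; apply: (@continuous_comp _ _ _ (fun t : R => 2 * t) p); [exact: c2|exact: cp].
    - by move=> t; apply: (@continuous_comp _ _ _ (fun t : R => 2 * t - 1) q); [exact: c3|exact: cq].
    - by rewrite e2 subrr.
  have h0 : 0 <= h by rewrite invr_ge0.
  have h1 : (1 <= h) = false by apply/negbTE; rewrite -ltNge /h; lra.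
  have e1 : 2 * 1 - 1 = 1 :> R by lra.
  have [a' [w' [lw' a'1 w'1]]] := FP y.
  rewrite -w'1.
  have L : lifting (fun t : R => if t <= h then a (2 * t) else b (2 * t - 1))
                   (fun t : R => if t <= h then w (2 * t) else s (f (b (2 * t - 1)))).
    split.
    - by apply: gl => //; rewrite a1 b0.
    - by apply: (gl V w (fun t => s (f (b t)))) => //; rewrite w1 b0 sF.
    - by rewrite h0 mulr0.
    - by rewrite h0 mulr0.
    - move=> t /andP[t0 t1]; case: ifP => th.
        rewrite Ew//; move: th; rewrite /h; lra.
      by have [-> _] := sP _ (Ub (2 * t - 1)).
  by rewrite (lift_endpoint lw' L) ?h1 ?e1 ?a'1 ?b1.
rewrite /prop_for /continuous_at (nbhs_singleton eq) => A HA.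
have [_ cs] := sP _ Ux.
have h1 : \forall y \near x, A (s (f y)) by exact: (f_cont (cs _ HA)).
rewrite -nearE near_map; near=> y.
have -> : F y = s (f y) by near: y.
by near: y.
Unshelve. all: by end_near. Qed.
End LocalHomeomorphism.

(** * The exponential map is a covering *)

Lemma form_continuous (R : realType) n (G : 'M[R]_n) :
  continuous (fun v : 'rV[R]_n => form G v v).
Proof.
move=> v; have sid : strictly_diff (fun u : 'rV[R]_n => u) v.
  by apply: (@strictly_diff_lin _ _ _ idfun) => x; exact: cvg_id.
suff [/differentiable_continuous] : strictly_diff (fun v : 'rV[R]_n => form G v v) v by [].
have -> : (fun v : 'rV[R]_n => form G v v) = (fun v => \sum_i \sum_j v 0 i * G i j * v 0 j).
  by apply/funext => u; rewrite formE.
apply: strictly_diff_sum => i _; apply: strictly_diff_sum => j _.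
apply: strictly_diffM; last exact: strictly_diff_coord.
apply: strictly_diffM; first exact: strictly_diff_coord.
exact: strictly_diff_cst.
Qed.

(** The form has a positive minimum on the compact unit sphere, and it is homogeneous of degree
    2. *)
Lemma posdef_bounded (R : realType) n (G : 'M[R]_n) (K : R) :
  (forall u, u != 0 -> 0 < form G u u) ->
  exists M, forall v : 'rV[R]_n, form G v v <= K -> `|v| <= M.
Proof.
move=> pos.
(* In dimension 0 the unit sphere is empty and has no minimum. *)
have [[v0 nv0]|S0] := pselect (exists v : 'rV[R]_n, v != 0); last first.
  exists 0 => v _; have [->|v0] := eqVneq v 0; first by rewrite normr0.
  by case: S0; exists v.
pose S := [set v : 'rV[R]_n | `|v| = 1].
have cS : compact S.
  apply: bounded_closed_compact.
    exists 1; split; first exact: num_real.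
    by move=> M M1 v /= ->; exact: ltW.
  have -> : S = (fun v => `|v|) @^-1` [set 1] by [].
  apply: closed_comp; last exact: closed_eq.
  by move=> v _; exact: norm_continuous.
have unit (v : 'rV[R]_n) : v != 0 -> S (`|v|^-1 *: v).
  by move=> nv; rewrite /S /= normrZ normfV normr_id mulVf// normr_eq0.
have [|c] := EVT_min_rV _ cS (continuous_subspaceT (@form_continuous _ _ G)).
  by exists (`|v0|^-1 *: v0); exact: unit.
rewrite inE => Sc cmin.
have c0 : c != 0 by rewrite -normr_eq0 Sc oner_neq0.
pose k := form G c c.
have k0 : 0 < k by exact: pos.
(* [k] is the least value on the unit sphere, so k |v|^2 <= K; the absolute value keeps the radicand
   nonnegative. *)
exists (Num.sqrt (`|K| / k)) => v vK.
have [->|nv] := eqVneq v 0; first by rewrite normr0 sqrtr_ge0.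
have vp : 0 < `|v| by rewrite normr_gt0.
rewrite -(ger0_norm (normr_ge0 v)) -sqrtr_sqr ler_sqrt; last by rewrite divr_ge0// ltW.
rewrite ler_pdivlMr//.
have : k <= form G (`|v|^-1 *: v) (`|v|^-1 *: v) by apply: cmin; rewrite inE; exact: unit.
rewrite formZ formZr mulrA -invfM -expr2 mulrC ler_pdivlMr ?exprn_gt0// mulrC => h.
by apply: le_trans h (le_trans vK _); exact: ler_norm.
Qed.

Lemma convex_ball (R : realType) (W : normedModType R) (y0 y1 y : W) (r s : R) :
  0 <= s <= 1 -> `|y1 - y0| < r -> `|y - y0| < r -> `|y1 + s *: (y - y1) - y0| < r.
Proof.
move=> /andP[s0 s1] h1 h2.
have -> : y1 + s *: (y - y1) - y0 = (1 - s) *: (y1 - y0) + s *: (y - y0).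
  have -> : y - y1 = (y - y0) - (y1 - y0) by rewrite opprB addrA subrK.
  by rewrite addrAC scalerBr scalerBl scale1r addrCA addrC.
apply: le_lt_trans (ler_normD _ _) _; rewrite !normrZ (ger0_norm s0) ger0_norm ?subr_ge0//.
have [->|sn1] := eqVneq s 1; first by rewrite subrr mul0r add0r mul1r.
have s1' : 0 < 1 - s by rewrite subr_gt0 lt_neqAle sn1.
apply: (@lt_le_trans _ _ ((1 - s) * r + s * r)); last by rewrite -mulrDl subrK mul1r.
by apply: ltr_leD; [rewrite ltr_pM2l|apply: ler_wpM2l => //; exact: ltW].
Qed.

Section ExponentialCovering.
Context (R : realType) (n : nat) (N : manifold R n) (g : riemannian_metric N)
  (gam : 'rV[R]_n -> R -> N) (d0 : chart R n N) (p : N).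
Hypothesis geo : forall v, is_geodesic g (gam v).
Hypothesis atlas0 : atlas d0.
Hypothesis dom0 : chart_dom d0 p.
Hypothesis gam0 : forall v, gam v 0 = p.
Hypothesis vel0 : forall v, derive1 (d0 \o gam v) 0 = v.
Hypothesis curv : nonpositively_curved g.

Let E v := gam v 1.

Let start := regular_start atlas0 dom0 gam0 vel0.

Lemma exp_coord d v : atlas d -> chart_dom d (gam v 1) ->
  [/\ \forall u \near v, chart_dom d (gam u 1),
    strictly_diff (fun u => d (gam u 1)) v,
    forall h, 'd (fun u => d (gam u 1)) v h = jacobi gam d v h 1 &
    injective ('d (fun u => d (gam u 1)) v)].
Proof.
move=> ad dv; have [_ _ nd sd] := flow_regular geo start ad dv.
have [s1 e1] := strictly_diff_fst (state d (gam v) 1).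
have [s e] := strictly_diff_comp sd s1.
have eJ h : 'd (fun u => d (gam u 1)) v h = jacobi gam d v h 1.
  exact: (etrans (congr1 (fun L => L h) e) (congr1 (fun L => L _) e1)).
split; [exact: nd|exact: s|exact: eJ|].
move=> x y exy; apply/eqP; rewrite -subr_eq0; apply/eqP.
apply: (jacobi_inj geo atlas0 dom0 gam0 vel0 curv ad dv).
by rewrite -eJ linearB exy subrr.
Qed.

Lemma exp_continuous : continuous E.
Proof.
move=> v; have [d ad dv] := atlas_cover (E v).
have [nd [/differentiable_continuous cd _] _ _] := exp_coord ad dv.
rewrite /continuous_at -(chart_funK dv) => U HU.
have h : \forall u \near v, U (chart_inv d (d (gam u 1))).
  apply: (@continuous_comp _ _ _ (fun u => d (gam u 1)) (chart_inv d)); [exact: cd| |exact: HU].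
  exact: (chart_inv_cont (chart_imgP dv)).
rewrite -nearE near_map; near=> u.
have <- : chart_inv d (d (gam u 1)) = E u by rewrite chart_funK//; near: u.
by near: u.
Unshelve. all: by end_near. Qed.

Lemma exp_locally_injective v : exists2 A : set 'rV[R]_n, open A & A v /\
  forall x y, A x -> A y -> E x = E y -> x = y.
Proof.
have [d ad dv] := atlas_cover (E v).
have [_ s _ inj] := exp_coord ad dv.
have [r r0 [h _]] := inverse_function s inj.
exists (ball v r); first exact: ball_open.
split; first exact: ballxx.
move=> x y; rewrite -ball_normE /= !(distrC v) => xr yr e.
by apply: h => //; exact: (congr1 d e).
Qed.

Lemma exp_open v A : nbhs v A -> nbhs (E v) (E @` A).
Proof.
move=> Av; have [d ad dv] := atlas_cover (E v).
have [nd s _ inj] := exp_coord ad dv.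
have [r r0 [_ h]] := inverse_function s inj.
have : nbhs v (A `&` [set u | chart_dom d (gam u 1)]) by exact: filterI.
move=> /nbhs_ballP[e /= e0 He].
have [||k k0 hk] := h (Num.min r e); [by rewrite lt_min r0|by rewrite ge_min lexx|].
have h1 : \forall y \near E v, `|d y - d (E v)| < k.
  by have := chart_continuous dv; move/cvgr_distC_lt; apply.
apply: filterS2 (chart_dom_nbhs dv) h1 => y dy ky.
have [x xr ex] := hk (d y) ky.
have [Ax dx] : (A `&` [set u | chart_dom d (gam u 1)]) x.
  by apply: He; rewrite -ball_normE /= distrC; apply: lt_le_trans xr _; rewrite ge_min lexx orbT.
by exists x => //; exact: (chart_inj dx dy ex).
Qed.

Let en v := form (g d0 (d0 p)) v v.

(** The derivative of |w|^2 is 2 <w', w> at [p]; the Gauss lemma transports this product to time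
    1. *)
Lemma energy_derive (d : chart R n N) (w : R -> 'rV[R]_n) s w' :
  atlas d -> chart_dom d (gam (w s) 1) -> is_derive s (1 : R) w w' ->
  is_derive s (1 : R) (fun s => en (w s))
    (2 * form (g d (d (gam (w s) 1))) (jacobi gam d (w s) w' 1) (velocity gam d (w s) 1)).
Proof.
move=> ad dv hw; have img0 := chart_imgP dom0.
have hc := is_derive_cst (d0 p) s (1 : R).
have H := is_derive_form (@chart_img_open _ _ _ d0) (metric_smooth g atlas0)
  (fun y => @metric_sym _ _ _ g d0 y atlas0) (fun y z => @metric_pos _ _ _ g d0 y z atlas0) img0 hc hw hw.
have ch0 z : christoffel (g d0) (d0 p) 0 z = 0.
  have := christoffelZl (metric_smooth g atlas0) 0 0 z img0.
  by rewrite !scale0r.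
rewrite /= !ch0 !addr0 (formC (w s)) in H; last exact: (metric_sym g).
rewrite (gauss_lemma geo atlas0 dom0 gam0 vel0 _ ad dv).
by apply: (is_derive_eq H); rewrite mulr_natl mulr2n.
Qed.

(** Let e = |w|^2 and let tau be the velocity at time 1, so that |tau|^2 = e. Then e' = 2 <u, tau>
    <= 2 C + e / 2, and at the maximum of e over [0, t] the half is absorbed. The bound does not
    depend on [t], which confines all partial lifts at once. *)
Lemma line_energy_bound (d : chart R n N) (y1 u : 'rV[R]_n) (C t : R) (w : R -> 'rV[R]_n) :
  atlas d -> (forall s, 0 <= s <= 1 -> chart_img d (y1 + s *: u) /\
     form (g d (y1 + s *: u)) u u <= C) ->
  0 <= t -> t <= 1 -> continuous w ->
  (forall s, s <= t -> E (w s) = chart_inv d (y1 + clamp s *: u)) ->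
  en (w t) <= 2 * en (w 0) + 4 * C.
Proof.
move=> ad seg t0 t1 cw Ew.
pose e s := en (w s).
have img0 := chart_imgP dom0.
have symG := metric_sym g.
have pos (c : chart R n N) y z : atlas c -> chart_img c y -> 0 <= form (g c y) z z.
  move=> ac cy; have [->|z0] := eqVneq z 0; first by rewrite form0.
  exact: ltW (metric_pos g ac cy z0).
have C0 : 0 <= C.
  have [|i c] := seg 0; first by rewrite lexx ler01.
  by apply: le_trans c; exact: pos.
have de s : 0 < s -> s < t -> exists2 e', e' <= 2 * C + e s / 2 & is_derive s 1 e e'.
  move=> s0 st.
  have s01 : 0 <= s <= 1 by rewrite (ltW s0) (le_trans (ltW st) t1).
  have [iy Cs] := seg s s01.
  have [dx ex] := chart_inv_dom iy.
  have Es : E (w s) = chart_inv d (y1 + s *: u) by rewrite Ew ?clamp_id// ltW.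
  have dv : chart_dom d (gam (w s) 1) by have := dx; rewrite -Es.
  have dEs : d (gam (w s) 1) = y1 + s *: u by have := ex; rewrite -Es.
  have [_ [df _] eJ inj] := exp_coord ad dv.
  have ha := is_derive_affine y1 u s.
  have [dg eg] := ha; move/derivable1_diffP : dg => dg.
  have nw : \forall x \near s, d (gam (w x) 1) = y1 + x *: u.
    have h1 : \forall x \near s, 0 < x by exact: lt_nbhsr.
    have h2 : \forall x \near s, x < t by exact: lt_nbhsl.
    apply: filterS2 h1 h2 => x x0 xt.
    have x01 : 0 <= x <= 1 by rewrite (ltW x0) (le_trans (ltW xt) t1).
    have [ix _] := seg x x01.
    have := Ew x (ltW xt); rewrite clamp_id// /E => ->.
    by have [] := chart_inv_dom ix.
  have [dw ew] := lift_differentiable df inj (cw s) dg nw.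
  have dw1 : derivable w s 1 by exact/derivable1_diffP.
  have hw : is_derive s 1 w ('d w s 1) by rewrite -deriveE//; exact: derivableP.
  have eu : jacobi gam d (w s) ('d w s 1) 1 = u by rewrite -eJ ew -deriveE.
  have H := energy_derive ad dv hw.
  rewrite eu in H; set tau := velocity gam d (w s) 1 in H.
  exists (2 * form (g d (d (gam (w s) 1))) u tau); last exact: H.
  have es : e s = form (g d (y1 + s *: u)) tau tau.
    rewrite /e /en -(speed_sq_cst geo atlas0 dom0 gam0 vel0 (w s) 1).
    by rewrite (speed_sqE geo ad dv) dEs.
  (* Expanding |2 u - tau|^2 >= 0 gives 2 <u, tau> <= 2 |u|^2 + |tau|^2 / 2. *)
  have := pos d _ (2 *: u + (-1) *: tau) ad iy.
  rewrite dEs es !formD !formDr !formZ !formZr (formC tau u); last exact: symG.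
  by move: Cs; generalize (form (g d (y1 + s *: u)) u u) (form (g d (y1 + s *: u)) u tau)
    (form (g d (y1 + s *: u)) tau tau) => *; lra.
have ce s : {for s, continuous e}.
  by apply: (@continuous_comp _ _ _ w en); [exact: cw|exact: form_continuous].
have e0 s : 0 <= e s by exact: pos.
have [|c] := @EVT_max _ e 0 t t0; first exact: continuous_subspaceT.
rewrite in_itv /= => /andP[c0 ct] cmax.
have et : e t <= e c by apply: cmax; rewrite in_itv /= t0 lexx.
suff : e c <= e 0 + (2 * C + e c / 2) by rewrite -/(e t) -/(e 0); lra.
have [/eqP c00|c00] := boolP (c == 0).
  by rewrite c00 lerDl addr_ge0// ?mulr_ge0// divr_ge0.
have cp : 0 < c by rewrite lt_neqAle eq_sym c00.
have D (s : R) : s \in `]0, c[ -> is_derive s (1 : R) e (derive1 e s).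
  rewrite in_itv /= => /andP[s0 sc].
  by have [e' _ [de' _]] := de s s0 (lt_le_trans sc ct); exact: derivable_is_derive1.
have cec : {within `[0, c], continuous e} by exact: continuous_subspaceT.
have [s sc es] := MVT cp D cec.
move: sc; rewrite in_itv /= => /andP[s0 sc].
have [e' be' [_ de']] := de s s0 (lt_le_trans sc ct).
have es' := cmax s; rewrite in_itv /= (ltW s0) (ltW (lt_le_trans sc ct)) in es'.
rewrite derive1E de' subr0 in es.
have b1 : e' * c <= (2 * C + e c / 2) * 1.
  apply: (@le_trans _ _ ((2 * C + e c / 2) * c)).
    by apply: ler_wpM2r => //; apply: le_trans be' _; have := es' isT; lra.
  apply: ler_wpM2l; last exact: le_trans t1.
  by rewrite addr_ge0// ?mulr_ge0// divr_ge0.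
lra.
Qed.

(** [U] is a coordinate ball. Given [v] above it, the section at [y] is the endpoint of the lift
    from [v] of the coordinate segment ending at [y]; the energy bound makes the segment lift
    entirely, and stability of lifts makes the section continuous. *)
Lemma exp_evenly_covered (q : N) : exists2 U, open U & U q /\ forall v, U (E v) ->
  exists2 s : N -> 'rV[R]_n, s (E v) = v &
    forall y, U y -> E (s y) = y /\ {for y, continuous s}.
Proof.
have [d ad dq] := atlas_cover q.
have /nbhs_ballP[r /= r0 Hr] := chart_img_nbhs (chart_imgP dq).
have {}Hr y : `|y - d q| < r -> chart_img d y.
  by move=> yr; apply: Hr; rewrite -ball_normE /= distrC.
pose D := [set y : 'rV[R]_n | `|y - d q| < r].
have nD y : D y -> nbhs y D by move=> Dy; exact: (near_dist Dy).
pose U := [set x | chart_dom d x /\ D (d x)].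
exists U.
  rewrite openE => x [dx Dx]; apply: filterI; first exact: chart_dom_nbhs.
  by apply: (chart_continuous dx); exact: nD.
split; first by split=> //; rewrite /D /= subrr normr0.
move=> v [dv Dv]; pose y1 := d (E v).
pose H (y : 'rV[R]_n) (s : R) := chart_inv d (y1 + clamp s *: (y - y1)).
have inD y s : D y -> D (y1 + clamp s *: (y - y1)).
  by move=> Dy; apply: convex_ball => //; exact: clamp_itv.
have cH y s : D y -> {for (y, s), continuous (fun x => H x.1 x.2)}.
  move=> Dy; apply: (@continuous_comp _ _ _ (fun x : 'rV[R]_n * R => y1 + clamp x.2 *: (x.1 - y1)) (chart_inv d)).
    apply: continuousD; first exact: cst_continuous.
    apply: continuousZ.
      by apply: (@continuous_comp _ _ _ snd (@clamp R)); [exact: cvg_snd|exact: clamp_continuous].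
    by apply: continuousB; [exact: cvg_fst|exact: cst_continuous].
  by apply: chart_inv_cont; apply: Hr; exact: inD.
have c0 : clamp (0 : R) = 0 by rewrite clamp_le0.
have c1 : clamp (1 : R) = 1 by rewrite clamp_ge1.
have H0 y : H y 0 = E v by rewrite /H c0 scale0r addr0 chart_funK.
have H1 y : H y 1 = chart_inv d y by rewrite /H c1 scale1r addrC subrK.
have lift y : exists w : R -> 'rV[R]_n, D y -> [/\ continuous w, w 0 = v & forall s, E (w s) = H y s].
  have [Dy|nDy] := pselect (D y); last by exists (fun=> 0).
  have cHy : continuous (H y).
    move=> s U' /(cH y s Dy); apply: (@near_pair_cvg _ _ _ (fun=> y) idfun); [exact: cst_continuous|exact: cvg_id].
  have seg s : 0 <= s <= 1 -> chart_img d (y1 + s *: (y - y1)).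
    by move=> s01; apply: Hr; rewrite -(clamp_id s01); exact: inD.
  (* The direction has constant coordinates but its length varies with the metric; its maximum over
     the compact segment feeds the energy bound. *)
  have [C HC] : exists C, forall s, 0 <= s <= 1 -> form (g d (y1 + s *: (y - y1))) (y - y1) (y - y1) <= C.
    pose h s := form (g d (y1 + s *: (y - y1))) (y - y1) (y - y1).
    have [||c _ hc] := @EVT_max R (h \o @clamp R) 0 1; first exact: ler01.
      apply: continuous_subspaceT => s.
      apply: (@continuous_comp _ _ _ (@clamp R) h); first exact: clamp_continuous.
      have iy := seg _ (clamp_itv s).
      have dl := is_derive_affine y1 (y - y1) (clamp s).
      have du := is_derive_cst (y - y1) (clamp s) (1 : R).
      have [] := is_derive_form (@chart_img_open _ _ _ d) (metric_smooth g ad)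
        (fun y => @metric_sym _ _ _ g d y ad) (fun y z => @metric_pos _ _ _ g d y z ad) iy dl du du.
      by move/derivable1_diffP/differentiable_continuous.
    exists (h (clamp c)) => s s01; have := hc s; rewrite in_itv /= s01 /= clamp_id//.
    exact.
  have [M HM] := posdef_bounded (2 * en v + 4 * C) (fun u => @metric_pos _ _ _ g d0 (d0 p) u atlas0 (chart_imgP dom0)).
  pose K := [set u : 'rV[R]_n | `|u| <= M].
  have cK : compact K.
    apply: bounded_closed_compact.
      exists M; split; first exact: num_real.
      by move=> M' MM' u /= uM; apply: le_trans uM (ltW MM').
    have -> : K = (fun v => `|v|) @^-1` [set x | x <= M] by [].
    apply: closed_comp; last exact: closed_le.
    by move=> u _; exact: norm_continuous.
  have [|||w cw [w0 Ew]] := @lift_confined _ _ _ _ exp_continuous exp_locally_injective exp_open (H y) v K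
      (@manifold_hausdorff _ _ N) cHy cK.
  - by move=> s s0; rewrite H0 /H (clamp_le0 s0) scale0r addr0 chart_funK.
  - by rewrite H0.
  - move=> t w t0 t1 cw w0 Ew; apply: HM.
    rewrite -[in leRHS]w0; apply: (line_energy_bound ad _ t0 t1 cw Ew) => s s01.
    by split; [exact: seg|exact: HC].
  exists (fun s => w (Num.min s 1)) => _; split.
  - move=> s; apply: (@continuous_comp _ _ _ (fun s : R => Num.min s 1) w); last exact: cw.
    by apply: (@continuous_min R R idfun (fun=> 1) s); [exact: cvg_id|exact: cst_continuous].
  - by rewrite (min_idPl ler01).
  - by move=> s; rewrite Ew ?ge_min ?lexx ?orbT// /H /clamp -minA minxx.
have [W WP] := choice lift.
exists (fun x => W (d x) 1).
  (* The segment from [y1] to itself is constant, so its lift stays at [v]. *)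
  have [cw w0 Ew] := WP y1 Dv.
  apply: (@lift_unique _ _ _ E exp_locally_injective setT (W y1) (fun=> v) 0) => //.
    exact: connected_real.
  move=> s _; split; [exact: cw|exact: cst_continuous|].
  by rewrite Ew /H subrr scaler0 addr0 chart_funK.
move=> y [dy Dy]; have [cw w0 Ew] := WP (d y) Dy.
split; first by rewrite Ew H1 chart_funK.
apply: (@continuous_comp _ _ _ d (W ^~ 1)); first exact: chart_continuous.
apply: (@lift_stable _ _ _ E exp_locally_injective exp_open _ H W D).
- exact: nD.
- by move=> x t Dx; exact: cH.
- by move=> x Dx; case: (WP x Dx).
- by move=> x t Dx; case: (WP x Dx).
- have e : \forall x \near d y, W x 0 = v.
    by apply: filterS (nD _ Dy) => x Dx; case: (WP x Dx).
  rewrite /prop_for /continuous_at w0 => U' HU'.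
  by apply: filterS e => x /= ->; exact: nbhs_singleton.
Qed.

Lemma lift_through_exp (T : topologicalType) (f : T -> N) (x0 : T) (v0 : 'rV[R]_n) :
  continuous f -> E v0 = f x0 -> simply_connected R T ->
  (forall x U, nbhs x U -> \forall y \near x,
     exists2 a : R -> T, continuous a & [/\ a 0 = x, a 1 = y & forall s, U (a s)]) ->
  exists2 F : T -> 'rV[R]_n, continuous F & forall x, gam (F x) 1 = f x.
Proof.
move=> cf e sc loc.
exact: (global_lift exp_locally_injective exp_open exp_evenly_covered cf e sc loc).
Qed.
End ExponentialCovering.

(** * The maximum principle *)

Lemma invmx_posdef (R : realType) m (A : 'M[R]_m) : A^T = A ->
  (forall u, u != 0 -> 0 < form A u u) ->
  (invmx A)^T = invmx A /\ forall u, u != 0 -> 0 < form (invmx A) u u.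
Proof.
move=> sA pA; have uA := posdef_unitmx pA.
have sI : (invmx A)^T = invmx A by rewrite trmx_inv sA.
split=> // u u0.
have -> : form (invmx A) u u = form A (u *m invmx A) (u *m invmx A).
  Transparent form.
  by rewrite /form trmx_mul sI !mulmxA mulmxKV.
  Opaque form.
apply: pA; apply: contra_neq u0 => h.
by rewrite -(mulmxKV uA u) h mul0mx.
Qed.

Lemma diff_derive_sum (R : realType) m n (W : set 'rV[R]_m) (F : 'rV[R]_m -> 'rV[R]_n) y u v :
  open W -> smooth_on W F -> W y ->
  is_derive y u (fun z => 'd F z v) (\sum_j v 0 j *: 'd (partial j F) y u).
Proof.
move=> oW sF Wy.
have E : \forall z \near y, \sum_j v 0 j *: partial j F z = 'd F z v.
  have nW : \forall z \near y, W z by exact: open_nbhs_nbhs.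
  apply: filterS nW => z Wz; rewrite linfunE; apply: eq_bigr => j _.
  by rewrite /partial deriveE//; exact: (smooth_on_diff sF Wz).
apply: near_eq_is_derive E _.
have -> : (fun z => \sum_j v 0 j *: partial j F z) = \sum_j (fun z => v 0 j *: partial j F z).
  by apply/funext => z; rewrite fct_sumE.
apply: is_derive_sum => j; apply: is_deriveZ.
have dj : differentiable (partial j F) y := smooth_on_diff (smooth_on_partial j sF) Wy.
by rewrite -deriveE//; apply: derivableP; exact: diff_derivable.
Qed.

Lemma diff_differentiable (R : realType) m n (W : set 'rV[R]_m) (F : 'rV[R]_m -> 'rV[R]_n) y v :
  open W -> smooth_on W F -> W y -> differentiable (fun z => 'd F z v) y.
Proof.
move=> oW sF Wy.
apply: (proj1 (@strictly_diff_near_eq _ _ _ (fun z => \sum_j v 0 j *: partial j F z) _ _ _ _)).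
  have nW : \forall z \near y, W z by exact: open_nbhs_nbhs.
  apply: filterS nW => z Wz; rewrite linfunE; apply: eq_bigr => j _.
  by rewrite /partial deriveE//; exact: (smooth_on_diff sF Wz).
apply: strictly_diff_sum => j _; apply: strictly_diffZr.
exact: (smooth_strictly_diff oW (smooth_on_partial j sF) Wy).
Qed.

Lemma scalable_sum (R : realType) (V W : lmodType R) (h : V -> W) k (a : 'I_k -> R) (x : 'I_k -> V) :
  (forall u v, h (u + v) = h u + h v) -> (forall c u, h (c *: u) = c *: h u) ->
  h (\sum_i a i *: x i) = \sum_i a i *: h (x i).
Proof.
move=> hD hZ; have h0 : h 0 = 0 by rewrite -(scale0r 0) hZ scale0r.
by rewrite (big_morph h hD h0); apply: eq_bigr => i _; rewrite hZ.
Qed.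

Section MeanCurvature.
Context (R : realType) (m n : nat) (G : 'rV[R]_n -> 'M[R]_n) (U : set 'rV[R]_n)
  (F : 'rV[R]_m -> 'rV[R]_n) (W : set 'rV[R]_m) (y : 'rV[R]_m) (tau : 'rV[R]_n).
Hypothesis oU : open U.
Hypothesis sG : smooth_on U G.
Hypothesis symG : forall y, U y -> (G y)^T = G y.
Hypothesis posG : forall y u, U y -> u != 0 -> 0 < form (G y) u u.
Hypothesis oW : open W.
Hypothesis sF : smooth_on W F.
Hypothesis Wy : W y.
Hypothesis UFy : U (F y).
Hypothesis inj : injective ('d F y).
Hypothesis m_gt0 : (0 < m)%N.

Let b u v := 'D_u (fun z => 'd F z v) y + christoffel G (F y) ('d F y u) ('d F y v).

Let bE u v : b u v = \sum_i \sum_j (u 0 i * v 0 j) *: b (delta_mx 0 i) (delta_mx 0 j).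
Proof.
have DE u' v' : 'D_u' (fun z => 'd F z v') y = \sum_j v' 0 j *: 'd (partial j F) y u'.
  by have [_ ->] := diff_derive_sum u' v' oW sF Wy.
have De i j : 'D_(delta_mx 0 i) (fun z => 'd F z (delta_mx 0 j)) y = 'd (partial j F) y (delta_mx 0 i).
  rewrite DE (bigD1 j)//= big1 ?addr0 => [|k kj]; first by rewrite mxE !eqxx scale1r.
  by rewrite mxE eqxx (negbTE kj) scale0r.
rewrite /b; under eq_bigr do under eq_bigr do rewrite scalerDr.
under eq_bigr do rewrite big_split.
rewrite big_split /=; congr (_ + _).
  rewrite DE exchange_big; apply: eq_bigr => j _ /=.
  apply: (etrans (congr1 (fun z => v 0 j *: z) (linfunE ('d (partial j F) y) u))).
  rewrite scaler_sumr; apply: eq_bigr => i _.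
  by rewrite De scalerA mulrC.
apply: (etrans (congr2 (christoffel G (F y)) (linfunE ('d F y) u) (linfunE ('d F y) v))).
rewrite (@scalable_sum R 'rV[R]_n 'rV[R]_n (fun w => christoffel G (F y) w _)) => [|w w'|k w]; last 2 first.
- exact: (christoffelDl sG).
- exact: (christoffelZl sG).
apply: eq_bigr => i _.
rewrite (@scalable_sum R 'rV[R]_n 'rV[R]_n (fun w => christoffel G (F y) _ w)) => [|w w'|k w]; last 2 first.
- exact: (christoffelDr oU sG symG).
- exact: (christoffelZr oU sG symG).
by rewrite scaler_sumr; apply: eq_bigr => j _; rewrite scalerA.
Qed.

(** Pairing with a normal vector undoes [normal_part], so [m] times <H, tau> is the trace of the
    inverse induced metric against the matrix [q] of <II, tau>. A positive definite matrix against a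
    negative definite form has negative trace. *)
Lemma mean_curvature_neq0 :
  (forall u, form (G (F y)) ('d F y u) tau = 0) ->
  (forall u, u != 0 -> form (G (F y)) (b u u) tau < 0) ->
  mean_curvature G F y <> 0.
Proof.
move=> orth neg H.
have dF : differentiable F y := smooth_on_diff sF Wy.
have JE w : 'd F y w = w *m 'J F y by rewrite /jacobian mul_rV_lin1.
have indE u v : form (induced_metric G F y) u v = form (G (F y)) ('d F y u) ('d F y v).
  Transparent form.
  by rewrite /form /induced_metric !JE trmx_mul !mulmxA.
  Opaque form.
have symI : (induced_metric G F y)^T = induced_metric G F y.
  by rewrite /induced_metric !trmx_mul trmxK (symG UFy) mulmxA.
have posI u : u != 0 -> 0 < form (induced_metric G F y) u u.
  move=> u0; rewrite indE; apply: posG => //; apply: contra_neq u0 => h.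
  by apply: inj; rewrite h linear0.
have [symS posS] := invmx_posdef symI posI.
set S := invmx (induced_metric G F y) in symS posS.
pose q : 'M[R]_m := \matrix_(i, j) form (G (F y)) (b (delta_mx 0 i) (delta_mx 0 j)) tau.
have quad u : (u *m q *m u^T) 0 0 = form (G (F y)) (b u u) tau.
  rewrite -[LHS]/(form q u u) formE bE form_suml; apply: eq_bigr => i _.
  rewrite form_suml; apply: eq_bigr => j _.
  by rewrite formZ mxE mulrAC.
have : \tr (S *m q) < 0.
  by apply: trace_negative => // u u0; rewrite quad; exact: neg.
have normal w : form (G (F y)) (normal_part G F y w) tau = form (G (F y)) w tau.
  by rewrite /normal_part formD formN -JE orth oppr0 addr0.
suff -> : \tr (S *m q) = 0 by rewrite ltxx.
have : form (G (F y)) (m%:R *: mean_curvature G F y) tau = 0 by rewrite H scaler0 form0.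
rewrite /mean_curvature scalerA mulfV ?pnatr_eq0 -?lt0n// scale1r form_suml => <-.
rewrite /mxtrace; under eq_bigr do rewrite mxE; rewrite exchange_big /=.
apply: eq_bigr => i _; rewrite form_suml; apply: eq_bigr => j _.
by rewrite formZ -/S /second_fundamental_form normal mxE -[in LHS]symS mxE.
Qed.
End MeanCurvature.

Section EnergyMaximum.
Context (R : realType) (m n : nat) (N : manifold R n) (g : riemannian_metric N)
  (gam : 'rV[R]_n -> R -> N) (d0 : chart R n N) (p : N).
Hypothesis geo : forall v, is_geodesic g (gam v).
Hypothesis atlas0 : atlas d0.
Hypothesis dom0 : chart_dom d0 p.
Hypothesis gam0 : forall v, gam v 0 = p.
Hypothesis vel0 : forall v, derive1 (d0 \o gam v) 0 = v.
Hypothesis curv : nonpositively_curved g.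
Context (d : chart R n N) (W : set 'rV[R]_m) (F V : 'rV[R]_m -> 'rV[R]_n) (y : 'rV[R]_m).
Hypothesis ad : atlas d.
Hypothesis oW : open W.
Hypothesis sF : smooth_on W F.
Hypothesis Wy : W y.
Hypothesis inj : injective ('d F y).
Hypothesis cV : forall z, W z -> {for z, continuous V}.
Hypothesis VF : forall z, W z -> chart_dom d (gam (V z) 1) /\ d (gam (V z) 1) = F z.

Let en v := form (g d0 (d0 p)) v v.

Hypothesis maxV : forall z, W z -> en (V z) <= en (V y).

Let tau := velocity gam d (V y) 1.

(** A coordinate line y + s u serves in place of a geodesic of the submanifold: as [tau] is normal,
    the tangential part of the acceleration has product 0 with it. Only one more derivative of <dF
    u, tau> is taken, where [tau] moves with the initial velocity. *)
Lemma energy_max : 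
  (forall u, form (g d (F y)) ('d F y u) tau = 0) /\
  (forall u, u != 0 ->
    form (g d (F y)) ('D_u (fun z => 'd F z u) y + christoffel (g d) (F y) ('d F y u) ('d F y u)) tau < 0).
Proof.
have dV z : W z -> differentiable V z /\ forall h, jacobi gam d (V z) ('d V z h) 1 = 'd F z h.
  move=> Wz; have [dz _] := VF Wz.
  have [_ [df _] eJ jnj] := exp_coord geo atlas0 dom0 gam0 vel0 curv ad dz.
  have nW : \forall x \near z, d (gam (V x) 1) = F x.
    have nWz : \forall x \near z, W x by exact: open_nbhs_nbhs.
    by apply: filterS nWz => x /VF[].
  have [dVz e] := lift_differentiable df jnj (cV Wz) (smooth_on_diff sF Wz) nW.
  by split; [exact: dVz|move=> h; rewrite -eJ; exact: e].
suff key u : form (g d (F y)) ('d F y u) tau = 0 /\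
    (u != 0 -> form (g d (F y)) ('D_u (fun z => 'd F z u) y + christoffel (g d) (F y) ('d F y u) ('d F y u)) tau < 0).
  by split=> u; [case: (key u)|move=> u0; have [_ /(_ u0)] := key u].
pose l (s : R) := y + s *: u.
have l0 : l 0 = y by rewrite /l scale0r addr0.
have nl : \forall s \near (0 : R), W (l s).
  have nWy : nbhs y W by exact: open_nbhs_nbhs.
  exact: (@line_cvg0 _ _ y u W nWy).
have dl s : is_derive s (1 : R) l u := is_derive_affine y u s.
have dw s : W (l s) -> is_derive s (1 : R) (fun s => V (l s)) ('d V (l s) u).
  by move=> Wl; exact: (is_derive_chain (proj1 (dV _ Wl)) (dl s)).
pose k s := en (V (l s)).
pose k1 s := 2 * form (g d (F (l s))) ('d F (l s) u) (velocity gam d (V (l s)) 1).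
have dk : \forall s \near (0 : R), is_derive s (1 : R) k (k1 s).
  apply: filterS nl => s Wl; have [dz ez] := VF Wl.
  have := energy_derive geo atlas0 dom0 gam0 vel0 ad dz (dw s Wl).
  by rewrite (proj2 (dV _ Wl)) ez.
have [dy ey] := VF Wy.
have Uy : chart_img d (F y) by rewrite -ey; exact: chart_imgP.
have eJ := proj2 (dV y Wy) u.
have hF : is_derive (0 : R) (1 : R) (fun s => F (l s)) ('d F y u).
  have df : differentiable F (l 0) by rewrite l0; exact: (smooth_on_diff sF Wy).
  by have := is_derive_chain df (dl 0); rewrite l0.
have hdF : is_derive (0 : R) (1 : R) (fun s => 'd F (l s) u) ('D_u (fun z => 'd F z u) y).
  have dfy := diff_differentiable u oW sF Wy.
  have df : differentiable (fun z => 'd F z u) (l 0) by rewrite l0; exact: dfy.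
  apply: (is_derive_eq (is_derive_chain df (dl 0))).
  rewrite l0; exact: (esym (deriveE u dfy)).
(* [tau] is the velocity component of the state at time 1, so differentiability of the state in the
   initial velocity gives its derivative. *)
have hT : is_derive (0 : R) (1 : R) (fun s => velocity gam d (V (l s)) 1) (jacobi' gam d (V y) ('d V y u) 1).
  have [_ _ _ [dst _]] := flow_regular geo (regular_start atlas0 dom0 gam0 vel0) ad dy.
  have dst' : differentiable (fun v => state d (gam v) 1) (V (l 0)) by rewrite l0.
  have Wl0 : W (l 0) by rewrite l0.
  have := is_derive_snd (is_derive_chain dst' (dw 0 Wl0)).
  by rewrite l0.
have Ul : chart_img d (F (l 0)) by rewrite l0.
have H := is_derive_form (@chart_img_open _ _ _ d) (metric_smooth g ad)
  (fun y => @metric_sym _ _ _ g d y ad) (fun y z => @metric_pos _ _ _ g d y z ad) Ul hF hdF hT.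
have dk1 := is_derive_mulr (is_derive_cst (2 : R) (0 : R) (1 : R)) H.
have mk : \forall s \near (0 : R), k s <= k 0.
  by apply: filterS nl => s Wl; rewrite /k l0; exact: maxV.
have [k10 c0] := second_derivative_max dk dk1 mk.
have o : form (g d (F y)) ('d F y u) tau = 0.
  by move: k10; rewrite /k1 l0 => /eqP; rewrite mulf_eq0 pnatr_eq0 => /eqP.
split; first exact: o.
move=> u0; move: c0; rewrite mul0r add0r l0 -/tau.
set B := form _ _ tau.
have J0 : 'd F y u != 0.
  by apply: contra_neq u0 => h; apply: inj; rewrite h linear0.
have Jp := metric_pos g ad Uy J0.
(* The second derivative 2 (B + <J', J>) is at most 0, while 2 <J', J> >= |dF u|^2 > 0; hence [B] is
   negative. *)
have := jacobi_cov_ge geo atlas0 dom0 gam0 vel0 curv ('d V y u) ad dy.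
rewrite /jacobi_cov eJ ey (christoffelC (@chart_img_open _ _ _ d) (metric_smooth g ad)
  (fun y => @metric_sym _ _ _ g d y ad) _ _ Uy) -/tau.
rewrite (formC ('d F y u)); last exact: (metric_sym g ad Uy).
rewrite /cst; set X := form _ (jacobi' _ _ _ _ _ + _) _.
move: Jp; generalize (form (g d (F y)) ('d F y u) ('d F y u)) => Z *; lra.
Qed.
End EnergyMaximum.

Lemma cst_geodesic (R : realType) (n : nat) (N : manifold R n) (g : riemannian_metric N) (p : N) :
  is_geodesic g (fun=> p).
Proof.
split; first by move=> t; exact: cst_continuous.
move=> d t ad dp c.
have c1 : derive1 c = cst 0 by apply/funext => s; rewrite derive1E; exact: derive_cst.
split; first exact: derivable_cst.
  by rewrite c1; exact: derivable_cst.
rewrite c1 derive1_cst add0r.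
have := christoffelZl (metric_smooth g ad) 0 0 0 (chart_imgP dp).
by rewrite !scale0r.
Qed.

Lemma manifold_local_path (R : realType) (m : nat) (M : manifold R m) (x : M) (U : set M) :
  nbhs x U -> \forall y \near x,
    exists2 a : R -> M, continuous a & [/\ a 0 = x, a 1 = y & forall s, U (a s)].
Proof.
move=> Ux; have [c ac cx] := atlas_cover x.
have : \forall z \near c x, chart_img c z /\ U (chart_inv c z).
  have h1 := chart_img_nbhs (chart_imgP cx).
  have h2 : \forall z \near c x, U (chart_inv c z).
    by apply: (chart_inv_cont (chart_imgP cx)); rewrite chart_funK.
  by apply: filterS2 h1 h2 => z.
move=> /nbhs_ballP[r /= r0 Hr].
have h1 : \forall y \near x, `|c y - c x| < r.
  by have := chart_continuous cx; move/cvgr_distC_lt; apply.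
apply: filterS2 (chart_dom_nbhs cx) h1 => y cy yr.
pose l (s : R) := c x + clamp s *: (c y - c x).
have Hl s : chart_img c (l s) /\ U (chart_inv c (l s)).
  apply: Hr; rewrite -ball_normE /= distrC; apply: convex_ball => //; first exact: clamp_itv.
  by rewrite subrr normr0.
exists (fun s => chart_inv c (l s)).
  move=> s; apply: (@continuous_comp _ _ _ l (chart_inv c)).
    apply: continuousD; first exact: cst_continuous.
    apply: continuousZr_tmp; exact: clamp_continuous.
  by apply: chart_inv_cont; case: (Hl s).
split; last by move=> s; case: (Hl s).
  by rewrite /l clamp_le0// scale0r addr0 chart_funK.
by rewrite /l clamp_ge1// scale1r addrC subrK chart_funK.
Qed.

Theorem corollary36 (R : realType) (m n : nat)
    (M : manifold R m) (N : manifold R n) (g : riemannian_metric N)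
    (m_gt0 : (0 < m)%N) (m_lt_n : (m < n)%N)
    (M_compact : compact [set: M]) (M_connected : connected [set: M])
    (M_simply_connected : simply_connected R M)
    (N_complete : complete_metric g)
    (N_curvature : nonpositively_curved g) :
  ~ exists f : M -> N, minimal_immersion g f.
Proof.
move=> [f [[[cf smf] immf] minf]].
have [[x0 _] _ _] := M_simply_connected.
have [d0 ad0 dx0] := atlas_cover (f x0).
(* For [v = 0] the constant geodesic is selected, so that 0 lies above [f x0] without appeal to
   uniqueness of geodesics. *)
have sel v : exists gamma : R -> N, [/\ is_geodesic g gamma, gamma 0 = f x0,
    derive1 (d0 \o gamma) 0 = v & v = 0 -> gamma 1 = f x0].
  have [->|v0] := eqVneq v 0.
    exists (fun=> f x0); split=> //; first exact: cst_geodesic.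
    by rewrite derive1E; exact: derive_cst.
  have [gamma [h1 h2 h3]] := N_complete d0 (f x0) v ad0 dx0.
  by exists gamma; split=> // e; rewrite e eqxx in v0.
have [gam gamP] := choice sel.
have geo v : is_geodesic g (gam v) by case: (gamP v).
have gam0 v : gam v 0 = f x0 by case: (gamP v).
have vel0 v : derive1 (d0 \o gam v) 0 = v by case: (gamP v).
have E0 : gam 0 1 = f x0 by case: (gamP 0) => _ _ _; apply.
have [F cF EF] := lift_through_exp geo ad0 dx0 gam0 vel0 N_curvature cf E0 M_simply_connected
  (@manifold_local_path _ _ M).
pose en v := form (g d0 (d0 (f x0))) v v.
have cen : continuous (fun x => en (F x)).
  by move=> x; apply: (@continuous_comp _ _ _ F en); [exact: cF|exact: form_continuous].
(* Compactness of [M] enters here: the lift of [f] attains its largest energy. *)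
have [|x _ xmax] := compact_EVT_max _ M_compact (continuous_subspaceT cen); first by exists x0.
have [c ac cx] := atlas_cover x.
have [d ad dx] := atlas_cover (f x).
pose W := c @` (chart_dom c `&` f @^-1` chart_dom d).
have oW : open W.
  by apply: chart_image_open; apply: open_comp; [move=> z _; exact: cf|exact: chart_dom_open].
have Wy : W (c x) by exists x.
have WP z : W z -> [/\ chart_img c z & chart_dom d (f (chart_inv c z))].
  by move=> [w [cw dw] <-]; rewrite chart_funK//; split=> //; exact: chart_imgP.
pose V := F \o chart_inv c.
have cV z : W z -> {for z, continuous V}.
  by move=> /WP[cz _]; apply: continuous_comp; [exact: chart_inv_cont|exact: cF].
have VF z : W z -> chart_dom d (gam (V z) 1) /\ d (gam (V z) 1) = local_map f c d z.
  by move=> /WP[cz dz]; rewrite /V /= EF.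
have maxV z : W z -> en (V z) <= en (V (c x)).
  by move=> _; rewrite /V /= chart_funK//; apply: xmax; rewrite inE.
have sm := smf c d ac ad.
have inj := immf c d x ac ad cx dx.
have [orth neg] := energy_max geo ad0 dx0 gam0 vel0 N_curvature ad oW sm Wy inj cV VF maxV.
have UF : chart_img d (local_map f c d (c x)).
  by rewrite /local_map /= chart_funK//; exact: chart_imgP.
exact: (mean_curvature_neq0 (@chart_img_open _ _ _ d) (metric_smooth g ad)
  (fun y => @metric_sym _ _ _ g d y ad) (fun y z => @metric_pos _ _ _ g d y z ad)
  oW sm Wy UF inj m_gt0 orth neg (minf c d x ac ad cx dx)).
Qed.
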